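(* Let $p$ be a prime and let $F\rtimes H$ be a semidirect product of a free pro-$p$ group $F$ and a finite $p$-group $H$. Then the action of $H$ on $F$ extends to an action of $H$ on some free pro-$p$ group $\tilde F$ containing $F$ such that $H$ permutes the elements of some basis of $\tilde F$.
   Context: Subgroups are closed, homomorphisms and actions are continuous. ''Basis'' is understood as a (pointed profinite) basis: a pointed profinite space $(X,* )$ is a profinite space with a distinguished point $*$; the free pro-$p$ group $F(X,* )$ on $(X,* )$ is a pro-$p$ group with a continuous map of pointed spaces $\omega:(X,* )\to (F(X,* ),1)$ such that every continuous map of pointed spaces $(X,* )\to (P,1)$ into a pro-$p$ group $P$ extends uniquely to a continuous homomorphism $F(X,* )\to P$. A pointed basis of a free pro-$p$ group $\tilde F$ is a pointed profinite subspace $(X,1)\subseteq\tilde F$ with $\tilde F=F(X,1)$. That the action extends means that $F$ is an $H$-invariant subgroup of $\tilde F$ on which the action of $H$ on $\tilde F$ restricts to the given one. *)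

(* Defs.v *)
From HB Require Import structures.
From mathcomp Require Import all_boot all_order all_fingroup all_solvable.
From mathcomp Require Import all_classical topology.

Set Implicit Arguments.
Unset Strict Implicit.
Unset Printing Implicit Defensive.

Local Open Scope classical_set_scope.
Local Open Scope card_scope.
Local Open Scope group_scope.

HB.mixin Record isTopologicalGroup G & monoid.Group G & Topological G := {
  mulg_continuous : continuous (fun u : G * G => u.1 * u.2);
  invg_continuous : continuous (fun x : G => x^-1)
}.

#[short(type="topologicalGroupType")]
HB.structure Definition TopologicalGroup :=
  {G of monoid.Group G & Topological G & isTopologicalGroup G}.

Definition profinite_space (T : topologicalType) : Prop :=
  [/\ compact [set: T], hausdorff_space T & totally_disconnected [set: T]].

Definition open_normal_subgroup (G : topologicalGroupType) (N : set G) : Prop :=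
  [/\ open N, N 1, forall x y : G, N x -> N y -> N (x * y^-1)
    & forall x y : G, N x -> N (x ^ y)].

Definition pro_p_group (p : nat) (G : topologicalGroupType) : Prop :=
  profinite_space G /\
  forall N : set G, open_normal_subgroup N ->
    exists n : nat, [set (fun y => x * y) @` N | x in [set: G]] #= `I_(p ^ n).

Definition continuous_hom (G K : topologicalGroupType) (f : G -> K) : Prop :=
  {morph f : x y / x * y} /\ continuous f.

Definition free_pro_p_on (p : nat) (X : topologicalType) (x0 : X)
    (F : topologicalGroupType) (omega : X -> F) : Prop :=
  [/\ profinite_space X, pro_p_group p F, continuous omega, omega x0 = 1
    & forall (P : topologicalGroupType) (f : X -> P),
        pro_p_group p P -> continuous f -> f x0 = 1 ->
        exists! g : F -> P,
          continuous_hom g /\ (forall x : X, g (omega x) = f x)].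

Definition free_pro_p_group (p : nat) (F : topologicalGroupType) : Prop :=
  exists (X : topologicalType) (x0 : X) (omega : X -> F),
    free_pro_p_on p x0 omega.

(* The canonical topology of set_type B is the subspace topology. *)
Definition pointed_basis (p : nat) (F : topologicalGroupType) (B : set F) :
    Prop :=
  exists B1 : 1 \in B,
    @free_pro_p_on p (set_type B) (exist _ 1 B1) F set_val.

Definition continuous_action (H : finGroupType) (F : topologicalGroupType)
    (a : H -> F -> F) : Prop :=
  [/\ forall x : F, a 1 x = x,
      forall (h k : H) (x : F), a (h * k) x = a h (a k x),
      forall h : H, {morph a h : x y / x * y}
    & continuous (fun u : discrete_topology H * F => a u.1 u.2)].

(* Containment of topological groups is rendered by an embedding: the last
   clause says that F carries the topology induced from G. *)
Definition closed_subgroup_embedding (F G : topologicalGroupType)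
    (iota : F -> G) : Prop :=
  [/\ {morph iota : x y / x * y}, injective iota, closed (range iota)
    & forall U : set F, open U <-> exists2 V : set G, open V & iota @^-1` V = U].

(* Main.v *)
Require Import Defs.
From HB Require Import structures.
From mathcomp Require Import all_boot all_order all_fingroup all_solvable.
From mathcomp Require Import all_algebra ring.
From mathcomp Require Import all_classical topology.

(* Let Omega be the set of functions H -> F, on which F acts by left
   multiplication and H by (h w)(k) = h (w (h^-1 k)). The free pro-p group E on
   the pointed space Omega has a basis permuted by H, and it maps onto each
   coordinate, so that rho : E -> Omega has the basis map as a section. It
   suffices to find a continuous H-equivariant section g of rho with
   g (f w) = g (const f) g w, since then f |-> g (const f) is the embedding. Each
   coordinate of Omega is the vertex set of the Cayley graph of F, a pro-p tree;
   the product of these trees is acyclic for locally constant cochains, Smith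
   theory makes its equivariant cohomology relative to any family of
   stabilizers vanish in degree two, and this kills the obstruction to
   shrinking a minimal multivalued section (Zorn), one character of order p at
   a time. *)
Set Implicit Arguments.
Unset Strict Implicit.
Unset Printing Implicit Defensive.
Import GRing.Theory.

Local Open Scope ring_scope.

(** * Cochains on lists *)

(** No basis of [F] need be permuted by [H], so the Cayley graph for a single basis carries no
    action of [H]. The product of the Cayley graphs for the translates of one basis under all [k] in
    [H] does: [H] permutes the factors and [F] acts freely on the vertices. Hence functions from [H]
    to [F] rather than elements of [F]. The equation for [g] is a lifting problem for the semidirect
    product, and the difficulty is its torsion: over a simplex with stabilizer [S] only elements of
    [E] fixed by [S] are allowed. If [N] is the group of ambiguity of a multivalued section and
    [chi] a character of it, the values over that simplex can be corrected as soon as [chi] is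
    nonzero on some [S]-fixed element of [N]. The subgroups for which this fails form the family
    relative to which cohomology is taken. The cochains are genuinely invariant ones, and averaging
    over [H] is impossible modulo [p]; Smith theory replaces it and needs [H] to be a [p]-group.
    Invariance under [F] restricts vanishing to degrees at least two, which is where the obstruction
    lies. *)

Section Coboundary.
Variables (R : comNzRingType) (T : Type).
Implicit Types (c : seq T -> R) (s t : seq T).

(** The recursion on the first vertex produces the signs of the alternating sum over all deletions
    of one entry. A list of length n carries degree n - 1; the empty list is the augmentation. *)
Fixpoint cobd c s : R :=
  if s is x :: t then c t - cobd (fun u => c (x :: u)) t else 0.

Lemma cobd_cons c x t :
  cobd c (x :: t) = c t - cobd (fun u => c (x :: u)) t.
Proof. by []. Qed.

Lemma eq_cobd c c' s :
  (forall s1 x s2, s = s1 ++ x :: s2 -> c (s1 ++ s2) = c' (s1 ++ s2)) ->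
  cobd c s = cobd c' s.
Proof.
elim: s c c' => [//|x t IH] c c' e /=; congr (_ - _); first exact: (e [::] x t).
by apply: IH => s1 y s2 et; apply: (e (x :: s1) y s2); rewrite et.
Qed.

Lemma cobdD c c' s : cobd (fun u => c u + c' u) s = cobd c s + cobd c' s.
Proof.
by elim: s c c' => [|x t IH] c c' /=; rewrite ?addr0 // IH opprD addrACA.
Qed.

Lemma cobdN c s : cobd (fun u => - c u) s = - cobd c s.
Proof. by elim: s c => [|x t IH] c /=; rewrite ?oppr0 // IH opprD. Qed.

Lemma cobdB c c' s : cobd (fun u => c u - c' u) s = cobd c s - cobd c' s.
Proof. by rewrite cobdD cobdN. Qed.

Lemma cobd0 s : cobd (fun=> 0) s = 0.
Proof. by elim: s => [|x t IH] //=; rewrite IH subr0. Qed.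

Lemma cobd_sum I r (P : pred I) (c : I -> seq T -> R) s :
  cobd (fun u => \sum_(i <- r | P i) c i u) s = \sum_(i <- r | P i) cobd (c i) s.
Proof.
elim: r => [|i r IH].
  by rewrite big_nil -[RHS](cobd0 s); apply: eq_cobd => *; rewrite big_nil.
rewrite big_cons; under (eq_cobd (c' := fun u => (if P i then c i u else 0) +
    \sum_(j <- r | P j) c j u)).
  by move=> *; rewrite big_cons; case: ifP => // _; rewrite add0r.
rewrite /= cobdD IH; case: (P i) => //; by rewrite cobd0 add0r.
Qed.

Lemma cobdK c s : cobd (cobd c) s = 0.
Proof.
by elim: s c => [//|x t IH] c /=; rewrite cobdB IH subr0 subrr.
Qed.

Lemma cobd_map (f : T -> T) c s :
  cobd (fun u => c (map f u)) s = cobd c (map f s).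
Proof. by elim: s c => [//|x t IH] c /=; rewrite -IH. Qed.

Definition normalized c := forall s1 x s2, c (s1 ++ x :: x :: s2) = 0.

Lemma normalized_cobd c : normalized c -> normalized (cobd c).
Proof.
move=> nc s1 x s2; elim: s1 c nc => [|y s1 IH] c nc.
  rewrite /= subKr -[RHS](cobd0 s2); apply: eq_cobd => *; exact: (nc [::]).
rewrite cat_cons cobd_cons nc IH ?subr0 // => t1 z t2; exact: (nc (y :: t1)).
Qed.

(** This is the signed sum of the values of [c] at [f x_0, ..., f x_i, x_i, ..., x_n], the
    triangulated prism between a simplex and its image. *)
Fixpoint prism (f : T -> T) c s : R :=
  if s is x :: t then c (f x :: x :: t) - prism f (fun u => c (f x :: u)) t
  else 0.

Lemma prism_cons f c x t :
  prism f c (x :: t) = c (f x :: x :: t) - prism f (fun u => c (f x :: u)) t.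
Proof. by []. Qed.

Lemma eq_prism f c c' s :
  (forall s1 x s2, s = s1 ++ x :: s2 ->
     c (map f s1 ++ f x :: x :: s2) = c' (map f s1 ++ f x :: x :: s2)) ->
  prism f c s = prism f c' s.
Proof.
elim: s c c' => [//|x t IH] c c' e /=; congr (_ - _); first exact: (e [::] x t).
by apply: IH => s1 y s2 et; apply: (e (x :: s1) y s2); rewrite et.
Qed.

Lemma prismD f c c' s :
  prism f (fun u => c u + c' u) s = prism f c s + prism f c' s.
Proof.
by elim: s c c' => [|x t IH] c c' /=; rewrite ?addr0 // IH opprD addrACA.
Qed.

Lemma prismN f c s : prism f (fun u => - c u) s = - prism f c s.
Proof. by elim: s c => [|x t IH] c /=; rewrite ?oppr0 // IH opprD. Qed.

Lemma prism0 f s : prism f (fun=> 0) s = 0.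
Proof. by elim: s => [|x t IH] //=; rewrite IH subr0. Qed.

Lemma normalized_prism f c : normalized c -> normalized (prism f c).
Proof.
move=> nc s1 x s2; elim: s1 c nc => [|y s1 IH] c nc.
  rewrite /= (nc [:: f x]) (nc [::]) !sub0r opprK -[RHS](prism0 f s2).
  by apply: eq_prism => *; apply: (nc [::]).
rewrite cat_cons prism_cons (nc [:: _, _ & s1]) IH ?subr0 // => t1 z t2.
exact: (nc (_ :: t1)).
Qed.

(* [prism f] is a cochain homotopy between the identity and [f]. *)
Lemma cobd_prism f c s :
  cobd (prism f c) s + prism f (cobd c) s = c s - c (map f s).
Proof.
elim: s c => [|x t IH] c; first by rewrite /= subrr addr0.
rewrite cobd_cons prism_cons /=.
rewrite (cobdB (fun u => c (f x :: x :: u)) (prism f (fun u => c (f x :: u)))).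
rewrite (prismD f c (fun u => - cobd (fun v => c (f x :: v)) u)) prismN.
have := IH (fun u => c (f x :: u)).
move: (prism f c t) (cobd _ t) (cobd _ t) (prism _ _ t) => A B D E /eqP.
rewrite -subr_eq0 => /eqP e; apply/eqP; rewrite -subr_eq0 -e; apply/eqP; ring.
Qed.

End Coboundary.

(** * Entrywise related lists *)

Section ListRelation.
Variables (T T' : Type) (r : T -> T' -> Prop).

Fixpoint rel2 (s : seq T) (t : seq T') : Prop :=
  match s, t with
  | [::], [::] => True
  | x :: s', y :: t' => r x y /\ rel2 s' t'
  | _, _ => False
  end.

Lemma rel2_size s t : rel2 s t -> size s = size t.
Proof. by elim: s t => [|x s IH] [|y t] //= [_ /IH ->]. Qed.

Lemma rel2_cat s1 s2 t1 t2 : rel2 s1 t1 -> rel2 s2 t2 ->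
  rel2 (s1 ++ s2) (t1 ++ t2).
Proof. by elim: s1 t1 => [|x s IH] [|y t] //= [? ?] ?; split => //; apply: IH. Qed.

Lemma rel2_nth x0 y0 s t j : rel2 s t -> (j < size s)%N -> r (nth x0 s j) (nth y0 t j).
Proof. by elim: s t j => [//|x s IH] [//|y t] [|j] /= [] // ? /IH; apply. Qed.

Lemma rel2_split s1 x s2 t : rel2 (s1 ++ x :: s2) t ->
  exists t1 y t2, [/\ t = t1 ++ y :: t2, rel2 s1 t1, r x y & rel2 s2 t2].
Proof.
elim: s1 t => [|z s1 IH] [|y t] //= [ry rt]; first by exists [::], y, t.
by have [t1 [y' [t2 [-> r1 r' r2]]]] := IH _ rt; exists (y :: t1), y', t2.
Qed.

Variable R : comNzRingType.

Lemma eq_cobd2 (c : seq T -> R) (c' : seq T' -> R) s t : rel2 s t ->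
  (forall s1 x s2 t1 y t2, s = s1 ++ x :: s2 -> t = t1 ++ y :: t2 ->
     rel2 s1 t1 -> rel2 s2 t2 -> c (s1 ++ s2) = c' (t1 ++ t2)) ->
  cobd c s = cobd c' t.
Proof.
elim: s t c c' => [|x s IH] [|y t] c c' //= [rxy st] e.
congr (_ - _)%R; first exact: (e [::] x s [::] y t).
apply: IH => // s1 x' s2 t1 y' t2 es et r1 r2.
by apply: (e (x :: s1) x' s2 (y :: t1) y' t2); rewrite ?es ?et.
Qed.

Lemma eq_prism2 f f' (c : seq T -> R) (c' : seq T' -> R) s t : rel2 s t ->
  (forall s1 x s2 t1 y t2, s = s1 ++ x :: s2 -> t = t1 ++ y :: t2 ->
     rel2 s1 t1 -> rel2 s2 t2 -> r x y ->
     c (map f s1 ++ f x :: x :: s2) = c' (map f' t1 ++ f' y :: y :: t2)) ->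
  prism f c s = prism f' c' t.
Proof.
elim: s t c c' => [|x s IH] [|y t] c c' //= [rxy st] e.
congr (_ - _)%R; first exact: (e [::] x s [::] y t).
apply: IH => // s1 x' s2 t1 y' t2 es et r1 r2 rxy'.
by apply: (e (x :: s1) x' s2 (y :: t1) y' t2); rewrite ?es ?et.
Qed.

End ListRelation.

Lemma rel2_map (T1 T2 T1' T2' : Type) (r : T1 -> T2 -> Prop)
    (r' : T1' -> T2' -> Prop) f g s t :
  (forall x y, r x y -> r' (f x) (g y)) -> rel2 r s t ->
  rel2 r' (map f s) (map g t).
Proof.
move=> e; elim: s t => [|x s IH] [|y t] //= [/e ? ?]; split => //; exact: IH.
Qed.

Lemma rel2_refl (T : Type) (r : T -> T -> Prop) s : (forall x, r x x) -> rel2 r s s.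
Proof. by move=> rr; elim: s. Qed.

Lemma rel2_sym (T T' : Type) (r : T -> T' -> Prop) (r' : T' -> T -> Prop) s t :
  (forall x y, r x y -> r' y x) -> rel2 r s t -> rel2 r' t s.
Proof. by move=> rs; elim: s t => [|x s IH] [|y t] //= [/rs ? /IH]. Qed.

Lemma rel2_trans (T1 T2 T3 : Type) (r : T1 -> T2 -> Prop) (r' : T2 -> T3 -> Prop)
    (r'' : T1 -> T3 -> Prop) s t u :
  (forall x y z, r x y -> r' y z -> r'' x z) ->
  rel2 r s t -> rel2 r' t u -> rel2 r'' s u.
Proof.
move=> rt; elim: s t u => [|x s IH] [|y t] [|z u] //= [/rt xy st] [yz tu].
by split; [apply: xy | apply: IH st tu].
Qed.

Lemma rel2_sub (T T' : Type) (r r' : T -> T' -> Prop) s t :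
  (forall x y, r x y -> r' x y) -> rel2 r s t -> rel2 r' s t.
Proof. by move=> rs; elim: s t => [|x s IH] [|y t] //= [/rs ? /IH]. Qed.

Lemma map_split (T T' : Type) (f : T -> T') s s1 x s2 : map f s = s1 ++ x :: s2 ->
  exists t1 y t2, [/\ s = t1 ++ y :: t2, s1 = map f t1, x = f y & s2 = map f t2].
Proof.
elim: s s1 => [|y s IH] [|z s1] //= [].
  by move=> <- <-; exists [::], y, s.
move=> <- /IH [t1 [y' [t2 [-> -> -> ->]]]].
by exists (y :: t1), y', t2.
Qed.

Local Close Scope ring_scope.
Local Open Scope group_scope.

(* [lev] is a base of neighbourhoods of 1 made of normal [H]-invariant
   subgroups; compactness is stated as: every net of finite tuples clusters. *)
Record leveled_action (H : finGroupType) (G : groupType) (a : H -> G -> G)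
    (lev : set (set G)) : Prop := LeveledAction {
  lact1 : forall x, a 1 x = x;
  lactM : forall h k x, a (h * k) x = a h (a k x);
  lactD : forall h, {morph a h : x y / x * y};
  lev_has : exists U, lev U;
  lev_1 : forall U, lev U -> U 1;
  lev_div : forall U x y, lev U -> U x -> U y -> U (x * y^-1);
  lev_conj : forall U x y, lev U -> U x -> U (x ^ y);
  lev_act : forall U h x, lev U -> U x -> U (a h x);
  lev_cap : forall U V, lev U -> lev V ->
    exists2 W, lev W & forall x, W x -> U x /\ V x;
  lev_sep : forall x, (forall U, lev U -> U x) -> x = 1;
  lev_compact : forall (I : finType) (D : Type) (le : D -> D -> Prop)
      (x : D -> I -> G),
    inhabited D ->
    (forall d e, exists2 f, le d f & le e f) ->
    (forall d e f, le d e -> le e f -> le d f) ->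
    exists y : I -> G, forall U d, lev U ->
      exists2 e, le d e & forall i, U ((y i)^-1 * x e i)
}.

Section Level.
Variables (H : finGroupType) (G : groupType) (a : H -> G -> G).
Variables (lev : set (set G)) (La : leveled_action a lev).

Definition eqm (U : set G) (x y : G) := U (x^-1 * y).

Lemma lact1r h : a h 1 = 1.
Proof.
by apply: (mulgI (a h 1)); rewrite -(lactD La) !mulg1.
Qed.

Lemma lactV h x : a h x^-1 = (a h x)^-1.
Proof.
by apply: (mulgI (a h x)); rewrite -(lactD La) !mulgV lact1r.
Qed.

Lemma lactK h : cancel (a h) (a h^-1).
Proof. by move=> x; rewrite -(lactM La) mulVg (lact1 La). Qed.

Lemma lactKV h : cancel (a h^-1) (a h).
Proof. by move=> x; rewrite -(lactM La) mulgV (lact1 La). Qed.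

Section OneLevel.
Variables (U : set G) (lU : lev U).

Lemma levV x : U x -> U x^-1.
Proof. by move=> Ux; rewrite -[x^-1]mul1g; apply: lev_div La _ _ _ lU _ Ux; apply: lev_1 La _ lU. Qed.

Lemma levM x y : U x -> U y -> U (x * y).
Proof. by move=> Ux /levV Uy; rewrite -[y]invgK; apply: lev_div La _ _ _ lU Ux Uy. Qed.

Lemma eqm_refl x : eqm U x x.
Proof. by rewrite /eqm mulVg; apply: lev_1 La _ lU. Qed.

Lemma eqm_sym x y : eqm U x y -> eqm U y x.
Proof. by move=> /levV; rewrite /eqm invgM invgK. Qed.

Lemma eqm_trans y x z : eqm U x y -> eqm U y z -> eqm U x z.
Proof. by move=> xy yz; move: (levM xy yz); rewrite /eqm mulgA mulgK. Qed.

Lemma eqmM x y z t : eqm U x y -> eqm U z t -> eqm U (x * z) (y * t).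
Proof.
rewrite /eqm => xy zt; rewrite invgM.
have -> : z^-1 * x^-1 * (y * t) = (x^-1 * y) ^ z * (z^-1 * t).
  by rewrite conjgE !mulgA mulgK.
by apply: levM => //; apply: lev_conj La _ _ _ lU _.
Qed.

Lemma eqmV x y : eqm U x y -> eqm U x^-1 y^-1.
Proof.
move=> /eqm_sym; rewrite /eqm invgK => /(fun h => lev_conj La x^-1 lU h).
by rewrite conjgE invgK !mulgA mulgK.
Qed.

Lemma eqm_act h x y : eqm U x y -> eqm U (a h x) (a h y).
Proof. by move=> /(lev_act La h lU); rewrite /eqm (lactD La) lactV. Qed.

End OneLevel.

Lemma eqm_sub (U V : set G) x y : (forall z, U z -> V z) -> eqm U x y -> eqm V x y.
Proof. by move=> UV /UV. Qed.

Lemma eqm_sep x y : (forall U, lev U -> eqm U x y) -> x = y.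
Proof.
by move=> e; apply: (mulgI x^-1); rewrite mulVg [RHS](lev_sep La).
Qed.

(** Otherwise each [i] fails at some level, and below all of these finitely many levels every [i]
    fails. *)
Lemma lev_pigeonhole (I : finType) (P : set G -> I -> Prop) :
  (forall U V i, lev U -> lev V -> (forall x, U x -> V x) -> P U i -> P V i) ->
  (forall U, lev U -> exists i, P U i) ->
  exists i, forall U, lev U -> P U i.
Proof.
move=> mono ex; apply: contrapT => no.
have f i : exists2 U, lev U & ~ P U i.
  by apply: contrapT => h; apply: no; exists i => U lU; apply: contrapT => n;
    apply: h; exists U.
have [W lW hW] : exists2 W, lev W & forall i, ~ P W i.
  suff [W lW hW] : exists2 W, lev W & forall i, i \in enum I -> ~ P W i.
    by exists W => // i; apply: hW; rewrite mem_enum.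
  elim: (enum I) => [|i s [W lW IH]]; first by have [U lU] := lev_has La; exists U.
  have [U lU nU] := f i; have [V lV sV] := lev_cap La lU lW.
  exists V => // j; rewrite in_cons => /orP [/eqP ->|/IH n] p.
    by apply: nU; apply: mono p => // x /sV [].
  by apply: n; apply: mono p => // x /sV [].
by have [i /hW] := ex W lW.
Qed.

End Level.

(** * Simplices of a product of trees *)

Section Cut.
Variable F : groupType.

(** A block of [u] followed by a block of [v], as [cutP] says; either block may be empty. In the
    recursive form, stability under deletion and repetition of entries is a direct induction. *)
Fixpoint cut (u v : F) (us : seq F) : Prop :=
  if us is y :: t then (y = u /\ cut u v t) \/ all (pred1 v) us else True.

Lemma cut_all u v us : all (pred1 v) us -> cut u v us.
Proof. by case: us => // y t; right. Qed.

Lemma cut_del u v us1 x us2 : cut u v (us1 ++ x :: us2) -> cut u v (us1 ++ us2).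
Proof.
elim: us1 => [|y us1 IH] /=.
  by case=> [[_ //]|/andP [_]]; apply: cut_all.
case=> [[yu c]|/andP [yv]]; first by left; split => //; apply: IH.
by rewrite all_cat /= => /and3P [a1 _ a2]; right; rewrite yv all_cat a1 a2.
Qed.

Lemma cut_dup u v us1 x us2 :
  cut u v (us1 ++ x :: us2) -> cut u v (us1 ++ x :: x :: us2).
Proof.
elim: us1 => [|y us1 IH] /=.
  case=> [[-> c]|/andP [/eqP -> a]]; first by left; split => //; left.
  by right; rewrite /= eqxx.
case=> [[yu c]|/andP [yv]]; first by left; split => //; apply: IH.
by rewrite all_cat /= => /and3P [a1 xv a2]; right; rewrite yv all_cat a1 /= xv a2.
Qed.

Lemma cut_suf u v us1 us2 : cut u v (us1 ++ us2) -> cut u v us2.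
Proof.
elim: us1 => [|y us1 IH] //= [[_ /IH] //|/andP [_]].
by rewrite all_cat => /andP [_ /cut_all].
Qed.

Lemma cut_nseq u v i us : cut u v us -> cut u v (nseq i u ++ us).
Proof. by move=> c; elim: i => //= i IH; left. Qed.

Lemma cut_nseq2 u v i j : cut u v (nseq i u ++ nseq j v).
Proof. by apply/cut_nseq/cut_all; rewrite all_nseq /= eqxx orbT. Qed.

Lemma cutP u v us : cut u v us -> exists i j, us = nseq i u ++ nseq j v.
Proof.
elim: us => [|y us IH]; first by exists 0%N, 0%N.
case=> [[-> /IH [i [j ->]]]|/all_pred1P ->]; first by exists i.+1, j.
by exists 0%N, (size (y :: us)).
Qed.

Lemma cut_map u v f us : cut u v us -> cut (f u) (f v) (map f us).
Proof. by move=> /cutP [i [j ->]]; rewrite map_cat !map_nseq; apply: cut_nseq2. Qed.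

End Cut.

(* The tree in the coordinate [k] is the Cayley graph of [G] with respect to
   [B k]; [tree_integral] and [tree_const] say that it is simply connected and
   connected, as seen by locally constant functions. *)
Record tree_family (p : nat) (H : finGroupType) (G : groupType)
    (a : H -> G -> G) (lev : set (set G)) (B : H -> set G) : Prop := TreeFamily {
  tree1 : forall k, B k 1;
  tree_act : forall h k x, B k x -> B (h * k) (a h x);
  tree_closed : forall k x, (forall U, lev U -> exists2 b, B k b & eqm U x b) ->
    B k x;
  tree_integral : forall k (c : G -> G -> 'F_p),
    (exists2 U, lev U & forall u u' x x', eqm U u u' -> eqm U x x' ->
       B k x -> B k x' -> c u x = c u' x') ->
    (forall u, c u 1 = 0%R) ->
    exists g : G -> 'F_p, [/\ exists2 U, lev U & forall u u', eqm U u u' -> g u = g u',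
      g 1 = 0%R & forall u x, B k x -> g (u * x) = (g u + c u x)%R];
  tree_const : forall k (g : G -> 'F_p),
    (exists2 U, lev U & forall u u', eqm U u u' -> g u = g u') ->
    (forall u x, B k x -> g (u * x) = g u) -> forall u, g u = g 1
}.

Section Complex.
Variables (p : nat) (H : finGroupType) (F : groupType) (a : H -> F -> F).
Variables (lev : set (set F)) (B : H -> set F).
Hypotheses (La : leveled_action a lev) (TB : tree_family p a lev B).
Local Notation Om := (H -> F).
Local Notation R := ('F_p : comNzRingType).
Implicit Types (J : {set H}) (s t : seq Om) (c : seq Om -> R) (U : set F).

Definition eqs U J s t := rel2 (fun x y : Om => forall k, k \in J -> eqm U (x k) (y k)) s t.

(* A simplex is an ordered tuple, possibly with repetitions, along which each
   coordinate stays put or crosses one oriented edge once. *)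
Definition step k (us : seq F) := exists u v, B k (u^-1 * v) /\ cut u v us.
Definition simplex J s := forall k, k \in J -> step k (map (fun w : Om => w k) s).

Definition lmul (f : F) (w : Om) : Om := fun k => f * w k.
Definition hact (h : H) (w : Om) : Om := fun k => a h (w (h^-1 * k)).
Definition setc (k : H) (u : F) (w : Om) : Om := fun l => if l == k then u else w l.

Lemma hactE h w k : hact h w k = a h (w (h^-1 * k)).
Proof. by []. Qed.

Lemma eqs_refl U J s : lev U -> eqs U J s s.
Proof. by move=> lU; apply: rel2_refl => x k _; apply: eqm_refl La _ lU _. Qed.

Lemma eqs_sym U J s t : lev U -> eqs U J s t -> eqs U J t s.
Proof.
move=> lU; apply: rel2_sym => x y e k /e; exact: (eqm_sym La lU).
Qed.

Lemma eqs_trans U J s t u : lev U -> eqs U J s t -> eqs U J t u -> eqs U J s u.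
Proof.
move=> lU; apply: rel2_trans => x y z e1 e2 k kJ.
exact: eqm_trans La _ lU _ _ _ (e1 _ kJ) (e2 _ kJ).
Qed.

Lemma eqs_sub U V J J' s t : (forall x, U x -> V x) -> J' \subset J ->
  eqs U J s t -> eqs V J' s t.
Proof.
by move=> UV /fintype.subsetP sJ; apply: rel2_sub => x y e k /sJ /e; apply: eqm_sub.
Qed.

Lemma step_del k us1 x us2 : step k (us1 ++ x :: us2) -> step k (us1 ++ us2).
Proof. by move=> [u [v [b c]]]; exists u, v; split => //; apply: cut_del c. Qed.

Lemma step_dup k us1 x us2 : step k (us1 ++ x :: us2) -> step k (us1 ++ x :: x :: us2).
Proof. by move=> [u [v [b c]]]; exists u, v; split => //; apply: cut_dup c. Qed.

Lemma step_const k u us : all (pred1 u) us -> step k us.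
Proof.
by move=> c; exists u, u; split; [rewrite mulVg; apply: tree1 TB k | apply: cut_all].
Qed.

(** If the list starts inside the block of [u'], overwriting an initial segment by its first value
    and inserting that value once more only lengthens this block; otherwise the list is constant. *)
Lemma step_prism k u us1 x us2 : step k (us1 ++ x :: us2) -> head x us1 = u ->
  step k (nseq (size us1) u ++ u :: x :: us2).
Proof.
move=> [u' [v [b c]]] eu.
have -> : nseq (size us1) u ++ u :: x :: us2 = nseq (size us1).+1 u ++ x :: us2.
  by rewrite -cat1s catA -(nseqD (size us1) 1) addn1.
suff cuv : u = u' \/ u' = u' /\ u = v /\ all (pred1 v) (us1 ++ x :: us2).
  case: cuv => [->|[_ [-> al]]]; first by exists u', v; split => //; apply/cut_nseq/(cut_suf c).
  apply: (@step_const _ v); rewrite all_cat all_nseq /= eqxx /=.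
  by move: al; rewrite all_cat => /andP [].
case: us1 c eu => [|y us1] /= [[-> _]|al] <-; try by left.
  by right; split => //; split => //; case/andP: al => /eqP.
by right; split => //; split => //; case/andP: al => /eqP.
Qed.

Lemma simplex_sub J J' s : J' \subset J -> simplex J s -> simplex J' s.
Proof. by move=> /fintype.subsetP sJ X k /sJ /X. Qed.

Lemma simplex_del J s1 x s2 : simplex J (s1 ++ x :: s2) -> simplex J (s1 ++ s2).
Proof. by move=> X k /X; rewrite !map_cat; apply: step_del. Qed.

Lemma simplex_dup J s1 x s2 : simplex J (s1 ++ x :: s2) ->
  simplex J (s1 ++ x :: x :: s2).
Proof. by move=> X k /X; rewrite !map_cat; apply: step_dup. Qed.

Lemma simplex_lmul J f s : simplex J s -> simplex J (map (lmul f) s).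
Proof.
move=> X k /X [u [v [b c]]]; exists (f * u), (f * v); split.
  by rewrite invgM !mulgA mulgVK.
by move: (cut_map (fun x => f * x) c); rewrite -!map_comp.
Qed.

Lemma simplex_hact h s : simplex [set: H] s -> simplex [set: H] (map (hact h) s).
Proof.
move=> X k _; have [u [v [b c]]] := X (h^-1 * k) (finset.in_setT _).
exists (a h u), (a h v); split.
  by rewrite -(lactV La) -(lactD La) -[k](mulKVg h); apply: tree_act TB _ _ _ b.
by move: (cut_map (a h) c); rewrite -!map_comp.
Qed.

Lemma setc_lmul k f u w : setc k (f * u) (lmul f w) = lmul f (setc k u w).
Proof. by apply/funext => l; rewrite /setc /lmul; case: eqP. Qed.

Lemma setcE k u w : setc k u w k = u.
Proof. by rewrite /setc eqxx. Qed.

Lemma setc_setc k u v w : setc k u (setc k v w) = setc k u w.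
Proof. by apply/funext => l; rewrite /setc; case: eqP. Qed.

Lemma map_setc_setc k u v s : map (setc k u) (map (setc k v) s) = map (setc k u) s.
Proof. by rewrite -map_comp; apply: eq_map => w /=; rewrite setc_setc. Qed.

Lemma map_setc_id k u s : all (pred1 u) (map (fun w : Om => w k) s) ->
  map (setc k u) s = s.
Proof.
elim: s => //= x s IH /andP [/eqP xu /IH ->]; congr (_ :: _).
by apply/funext => l; rewrite /setc; case: eqP => [->|].
Qed.

Lemma coord_setc k u s : map (fun w : Om => w k) (map (setc k u) s) = nseq (size s) u.
Proof. by elim: s => //= x s ->; rewrite setcE. Qed.

Lemma coord_setcN k l u s : l != k ->
  map (fun w : Om => w l) (map (setc k u) s) = map (fun w : Om => w l) s.
Proof. by move=> /negPf lk; elim: s => //= x s ->; rewrite /setc lk. Qed.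

Lemma simplex_setc J k u s : simplex (J :\ k) s -> simplex J (map (setc k u) s).
Proof.
move=> X l lJ; have [->|lk] := eqVneq l k.
  by rewrite coord_setc; apply: (@step_const _ u); rewrite all_nseq /= eqxx orbT.
by rewrite coord_setcN //; apply: X; rewrite !inE lk.
Qed.

Lemma simplex_prism J k u s1 x s2 :
  simplex J (s1 ++ x :: s2) -> (head x s1) k = u ->
  simplex J (map (setc k u) s1 ++ setc k u x :: x :: s2).
Proof.
move=> X eu l lJ; rewrite map_cat /=.
have [lk|lk] := eqVneq l k; last first.
  rewrite coord_setcN // {1}/setc (negPf lk); apply: step_dup.
  by move: (X _ lJ); rewrite map_cat.
move: {lJ} (X _ lJ); rewrite lk map_cat /= => Xl.
rewrite coord_setc setcE -(size_map (fun w : Om => w k) s1).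
by apply: step_prism => //; case: (s1) eu.
Qed.

Lemma simplex_edge J k u x0 s1 x s2 : B k x0 ->
  simplex (J :\ k) (s1 ++ x :: s2) ->
  simplex J (map (setc k u) s1 ++ setc k u x :: setc k (u * x0) x ::
             map (setc k (u * x0)) s2).
Proof.
move=> b X l lJ; rewrite map_cat /=.
have [lk|lk] := eqVneq l k; last first.
  rewrite !coord_setcN // /setc (negPf lk); apply: step_dup.
  have lJ' : l \in J :\ k by rewrite !inE lk lJ.
  by move: (X _ lJ'); rewrite map_cat.
rewrite lk !coord_setc !setcE; exists u, (u * x0); rewrite mulKg; split => //.
rewrite -[_ :: nseq (size s2) _]/(nseq (size s2).+1 (u * x0)).
rewrite -cat1s catA -(nseqD (size s1) 1); exact: cut_nseq2.
Qed.

End Complex.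

(** * Compactness and uniform local constancy *)

Section Limits.
Variables (p : nat) (H : finGroupType) (F : groupType) (a : H -> F -> F).
Variables (lev : set (set F)) (B : H -> set F).
Hypotheses (La : leveled_action a lev) (TB : tree_family p a lev B).
Local Notation Om := (H -> F).
Local Notation R := ('F_p : comNzRingType).
Implicit Types (J : {set H}) (s t : seq Om) (c : seq Om -> R) (U : set F).
Local Notation w1 := ((fun=> 1) : Om).

Lemma cluster_seq m (D : Type) (le : D -> D -> Prop) (s : D -> seq Om) :
  inhabited D -> (forall d e, exists2 f, le d f & le e f) ->
  (forall d e f, le d e -> le e f -> le d f) -> (forall d, size (s d) = m) ->
  exists2 t, size t = m & forall U d, lev U ->
    exists2 e, le d e & eqs U [set: H] t (s e).
Proof.
move=> iD dD tD sm.
have [y hy] := lev_compact La (I := ('I_m * H)%type)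
  (fun d i => nth w1 (s d) i.1 i.2) iD dD tD.
exists [seq (fun k => y (i, k)) | i <- enum 'I_m].
  by rewrite size_map size_enum_ord.
move=> U d lU; have [e de he] := hy U d lU; exists e => //.
have -> : s e = [seq nth w1 (s e) (val i) | i <- enum 'I_m].
  by rewrite (map_comp (nth w1 (s e)) val) val_enum_ord -(sm e) map_nth_iota0 ?take_size.
apply: (rel2_map (r := eq)); last by apply: rel2_refl.
by move=> i _ <- k _; apply: he (i, k).
Qed.

Lemma cluster_lev m (s : set F -> seq Om) : (forall U, lev U -> size (s U) = m) ->
  exists2 t, size t = m & forall U, lev U ->
    exists V, [/\ lev V, forall x, V x -> U x & eqs U [set: H] t (s V)].
Proof.
move=> sm; pose D := {U : set F | lev U}.
have [U0 lU0] := lev_has La.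
have [|d e|d e f|d|t st ht] := @cluster_seq m D
  (fun d e => forall x, sval e x -> sval d x) (fun d => s (sval d)).
- by constructor; exists U0.
- have [W lW sW] := lev_cap La (svalP d) (svalP e).
  by exists (exist _ W lW) => x /sW [].
- by move=> de ef x /ef /de.
- exact: sm (svalP d).
- exists t => // U lU; have [[V lV] /= VU e] := ht U (exist _ U lU) lU.
  by exists V.
Qed.

(** The approximating lists may cross at different places; by pigeonhole one position [i] serves all
    levels. The limit is then constant before and after [i], and its two values differ by an element
    of [B k] because [B k] is closed. *)
Lemma step_closed k (us : seq F) :
  (forall U, lev U -> exists2 us', step B k us' & rel2 (eqm U) us us') ->
  step B k us.
Proof.
move=> h.
pose P U (i : 'I_(size us).+1) := exists u v, B k (u^-1 * v) /\
  rel2 (eqm U) us (nseq i u ++ nseq (size us - i) v).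
have [|U lU|i Pi] := lev_pigeonhole La (P := P).
- move=> U V i _ _ UV [u [v [b r]]]; exists u, v; split => //.
  by apply: rel2_sub r => x y; apply: eqm_sub.
- have [us' [u [v [b c]]] r] := h U lU; have [i [j eus']] := cutP c.
  have sz : size us = (i + j)%N by rewrite (rel2_size r) eus' size_cat !size_nseq.
  have ii : (i < (size us).+1)%N by rewrite sz ltnS leq_addr.
  by exists (Ordinal ii), u, v; rewrite /= sz addKn -eus'.
have rn U (lU : lev U) : exists u v, B k (u^-1 * v) /\
    (forall j, (j < size us)%N -> eqm U (nth 1 us j) (if (j < i)%N then u else v)).
  have [u [v [b r]]] := Pi U lU; exists u, v; split => // j ju.
  have : nth 1 (nseq i u ++ nseq (size us - i) v) j = if (j < i)%N then u else v.
    rewrite nth_cat size_nseq; case: (ltnP j i) => ji; rewrite nth_nseq ?ji //.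
    by rewrite ltn_sub2r // (leq_ltn_trans ji).
  by move=> <-; apply: rel2_nth.
pose u := nth 1 us 0; pose v := nth 1 us (size us).-1.
have eu j : (j < size us)%N -> nth 1 us j = if (j < i)%N then u else v.
  move=> ju; have s0 : (0 < size us)%N by apply: leq_ltn_trans ju.
  have s1 : ((size us).-1 < size us)%N by rewrite prednK.
  apply: (eqm_sep La) => U lU; have [u' [v' [_ e]]] := rn U lU.
  have := e _ ju; case: ifP => ji e1.
    have := e _ s0; rewrite (leq_ltn_trans _ ji) // => e2.
    exact: eqm_trans La _ lU _ _ _ e1 (eqm_sym La lU e2).
  have := e _ s1; rewrite ltnNge (leq_trans _ (_ : j <= _)%N) /=; last 2 first.
  - by rewrite leqNgt ji.
  - by rewrite -ltnS prednK.
  by move=> e2; apply: eqm_trans La _ lU _ _ _ e1 (eqm_sym La lU e2).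
have eus : us = nseq i u ++ nseq (size us - i) v.
  have si : (i + (size us - i))%N = size us by rewrite subnKC // -ltnS.
  apply: (@eq_from_nth _ 1); first by rewrite size_cat !size_nseq.
  move=> j ju; rewrite eu // nth_cat size_nseq.
  case: (ltnP j i) => ji; rewrite nth_nseq ?ji //.
  by rewrite ltn_sub2r // (leq_ltn_trans ji).
case: (posnP i) => [i0|i0].
  apply: (@step_const _ _ _ _ _ _ TB _ v); rewrite eus i0 /= all_nseq /= eqxx orbT //.
have [si|si] := leqP (size us) i.
  apply: (@step_const _ _ _ _ _ _ TB _ u); rewrite eus.
  by move: si; rewrite -subn_eq0 => /eqP ->; rewrite cats0 all_nseq /= eqxx orbT.
exists u, v; split; last by rewrite eus; apply: cut_nseq2.
apply: (tree_closed TB) => U lU; have [u' [v' [b e]]] := rn U lU.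
exists (u'^-1 * v') => //; apply: (eqmM La lU).
  apply: (eqmV La lU); have := e 0%N; rewrite i0; apply.
  exact: leq_ltn_trans si.
have s0 : (0 < size us)%N by apply: leq_ltn_trans si.
have ni : ((size us).-1 < i)%N = false by apply/negbTE; rewrite -leqNgt -ltnS prednK.
by have := e (size us).-1; rewrite ni; apply; rewrite prednK.
Qed.

Definition sdom J n s := simplex B J s /\ size s = n.

Lemma dom_closed J n s :
  (forall U, lev U -> exists2 t, sdom J n t & eqs U J s t) -> sdom J n s.
Proof.
move=> h; split; last first.
  by have [U lU] := lev_has La; have [t [_ <-] /rel2_size] := h U lU.
move=> k kJ; apply: step_closed => U lU; have [t [X _] e] := h U lU.
exists (map (fun w : Om => w k) t); first exact: X.
by apply: rel2_map e => x y; apply.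
Qed.

Definition ulc (D : seq Om -> Prop) J c :=
  exists2 U, lev U & forall s t, D s -> D t -> eqs U J s t -> c s = c t.

(** If no level were uniform, counterexamples chosen at every level would cluster at a point of [D],
    contradicting local constancy there. *)
Lemma lc_ulc (D : seq Om -> Prop) J n c :
  (forall s, D s -> size s = n) ->
  (forall s, (forall U, lev U -> exists2 t, D t & eqs U J s t) -> D s) ->
  (forall s, D s -> exists2 U, lev U & forall t, D t -> eqs U J s t -> c t = c s) ->
  ulc D J c.
Proof.
move=> sD cD lc; apply: contrapT => no.
have ch U : exists st : seq Om * seq Om, lev U ->
    [/\ D st.1, D st.2, eqs U J st.1 st.2 & c st.1 <> c st.2].
  have [lU|] := pselect (lev U); last by exists ([::], [::]).
  apply: contrapT => hn; apply: no; exists U => // s t Ds Dt e.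
  by apply: contrapT => ne; apply: hn; exists (s, t).
have [st hst] := choice ch.
have [|t szt ht] := @cluster_lev n (fun U => (st U).1).
  by move=> U lU; have [/sD] := hst U lU.
have Dt : D t.
  apply: cD => U lU; have [V [lV _ e]] := ht U lU.
  exists (st V).1; first by have [] := hst V lV.
  by apply: eqs_sub e => //; apply: finset.subsetT.
have [U lU hU] := lc _ Dt; have [V [lV VU e]] := ht U lU.
have [D1 D2 e12 []] := hst V lV.
have e1 : eqs U J t (st V).1 by apply: eqs_sub e => //; apply: finset.subsetT.
rewrite (hU _ D1) // (hU _ D2) //; apply: (eqs_trans La lU) e1 _.
exact: eqs_sub e12.
Qed.

(** [normalized] quantifies over all lists, whereas cochains are controlled only on simplices;
    cutting off to 0 outside [D] reconciles the two. *)
Definition restr0 (D : seq Om -> Prop) c s : R := if `[< D s >] then c s else 0%R.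

Lemma restr0E D c s : D s -> restr0 D c s = c s.
Proof. by move=> Ds; rewrite /restr0; case: asboolP. Qed.

Lemma ulc_restr0 D J c : ulc D J c -> ulc D J (restr0 D c).
Proof. by move=> [U lU h]; exists U => // s t Ds Dt e; rewrite !restr0E //; apply: h. Qed.

Lemma normalized_restr0 D c :
  (forall s1 x s2, D (s1 ++ x :: x :: s2) -> c (s1 ++ x :: x :: s2) = 0%R) ->
  normalized (restr0 D c).
Proof. by move=> h s1 x s2; rewrite /restr0; case: asboolP => // /h. Qed.

End Limits.

(** * Acyclicity *)

Section Prism.
Variables (p : nat) (H : finGroupType) (F : groupType) (a : H -> F -> F).
Variables (lev : set (set F)) (B : H -> set F).
Hypotheses (La : leveled_action a lev) (TB : tree_family p a lev B).
Local Notation Om := (H -> F).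
Local Notation R := ('F_p : comNzRingType).
Implicit Types (J : {set H}) (s t : seq Om) (c : seq Om -> R) (U : set F).
Local Notation w1 := ((fun=> 1) : Om).
Local Notation sdom := (sdom B).

Definition lc1 (g : F -> R) :=
  exists2 U, lev U & forall u u', eqm U u u' -> g u = g u'.

Lemma lc1B g g' : lc1 g -> lc1 g' -> lc1 (fun u => g u - g' u)%R.
Proof.
move=> [U lU h] [V lV h']; have [W lW sW] := lev_cap La lU lV.
by exists W => // u u' e; rewrite (h u u') ?(h' u u') //; apply: eqm_sub e => x /sW [].
Qed.

Lemma lc1_cst x : lc1 (fun=> x).
Proof. by have [U lU] := lev_has La; exists U. Qed.

Lemma lc1_cobd (c : F -> seq Om -> R) s :
  (forall s1 x s2, s = s1 ++ x :: s2 -> lc1 (fun u => c u (s1 ++ s2))) ->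
  lc1 (fun u => cobd (c u) s).
Proof.
elim: s c => [|x s IH] c h /=; first exact: lc1_cst.
apply: lc1B; first exact: (h [::] x s).
by apply: IH => s1 y s2 es; apply: (h (x :: s1) y s2); rewrite es.
Qed.

(** The flag [b] adds invariance under left multiplication by [F], so that one induction serves both
    plain and invariant cochains. *)
Record good (b : bool) J n c : Prop := Good {
  good_ulc : ulc lev (sdom J n) J c;
  good_normalized : normalized c;
  good_inv : b -> forall f s, sdom J n s -> c (map (lmul f) s) = c s
}.

Lemma dom_lmul J n f s : sdom J n s -> sdom J n (map (lmul f) s).
Proof. by move=> [X sz]; split; [apply: simplex_lmul | rewrite size_map]. Qed.

Lemma dom_face J n s1 x s2 : sdom J n.+1 (s1 ++ x :: s2) -> sdom J n (s1 ++ s2).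
Proof.
move=> [X]; rewrite size_cat /= addnS => - [sz].
by split; [apply: simplex_del X | rewrite size_cat].
Qed.

Lemma dom_sub J J' n s : J' \subset J -> sdom J n s -> sdom J' n s.
Proof. by move=> JJ [X sz]; split => //; apply: simplex_sub X. Qed.

Lemma eq_prism_edge k c c' ka ka' u v u' v' (r : Om -> Om -> Prop) : rel2 r ka ka' ->
  (forall s1 w s2 t1 w' t2, ka = s1 ++ w :: s2 -> ka' = t1 ++ w' :: t2 ->
     rel2 r s1 t1 -> r w w' -> rel2 r s2 t2 ->
     c (map (setc k u) s1 ++ setc k u w :: setc k v w :: map (setc k v) s2) =
     c' (map (setc k u') t1 ++ setc k u' w' :: setc k v' w' :: map (setc k v') t2)) ->
  prism (setc k u) c (map (setc k v) ka) = prism (setc k u') c' (map (setc k v') ka').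
Proof.
elim: ka ka' c c' => [|x s IH] [|y t] c c' //= [rxy st] e.
rewrite !setc_setc; congr (_ - _)%R; first exact: (e [::] x s [::] y t).
apply: IH => // s1 x' s2 t1 y' t2 es et r1 r2 rxy'.
by apply: (e (x :: s1) x' s2 (y :: t1) y' t2); rewrite ?es ?et.
Qed.

Lemma step_cons2 k u v us : step B k (u :: v :: us) ->
  v = u \/ all (pred1 v) (v :: us) /\ B k (u^-1 * v).
Proof.
move=> [u' [v' [bx /= [[-> [[-> _]|/andP [/eqP -> al]]]|/and3P [/eqP -> /eqP -> _]]]]].
- by left.
- by right; rewrite eqxx.
- by left.
Qed.

(** * Eliminating one coordinate *)

Section Step.
Variables (b : bool) (J : {set H}) (k k0 : H) (n : nat) (psi : seq Om -> R).
Hypotheses (kJ : k \in J) (k0J : b -> k0 \in J :\ k).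
Hypotheses (Gpsi : good b J n.+2 psi).
Hypothesis Zpsi : forall s, sdom J n.+3 s -> cobd psi s = 0%R.

Let K := J :\ k.

Lemma dom_setc m u s : sdom K m s -> sdom J m (map (setc k u) s).
Proof. by move=> [X sz]; split; [apply: simplex_setc TB _ _ _ _ X | rewrite size_map]. Qed.

Lemma dom_edge m u x s1 w s2 : B k x -> sdom K m.+1 (s1 ++ w :: s2) ->
  sdom J m.+2 (map (setc k u) s1 ++ setc k u w :: setc k (u * x) w ::
              map (setc k (u * x)) s2).
Proof.
move=> bx [X sz]; split; first exact: simplex_edge _ bx X.
by rewrite -sz !size_cat /= !size_map addnS.
Qed.

Lemma eqs_edge U u v u' v' s1 w s2 t1 w' t2 : lev U -> eqm U u u' -> eqm U v v' ->
  eqs U K s1 t1 -> (forall l, l \in K -> eqm U (w l) (w' l)) -> eqs U K s2 t2 ->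
  eqs U J (map (setc k u) s1 ++ setc k u w :: setc k v w :: map (setc k v) s2)
     (map (setc k u') t1 ++ setc k u' w' :: setc k v' w' :: map (setc k v') t2).
Proof.
move=> lU eu ev e1 ew e2.
have S z z' x y : eqm U z z' -> (forall l, l \in K -> eqm U (x l) (y l)) ->
    forall l, l \in J -> eqm U (setc k z x l) (setc k z' y l).
  by move=> ez exy l lJ; rewrite /setc; case: eqP => // /eqP lk; apply: exy; rewrite !inE lk.
apply: rel2_cat; first by apply: rel2_map e1 => x y; apply: S.
split; first exact: S.
split; first exact: S.
by apply: rel2_map e2 => x y; apply: S.
Qed.

(** The value of [psi] on the product of the simplex [ka] in the coordinates of [K] with the edge
    from [u] to [u * x] of the tree [k], triangulated by prisms. *)
Definition edge_cochain (ka : seq Om) (u x : F) : R :=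
  if `[< B k x /\ sdom K n.+1 ka >] then
    prism (setc k u) psi (map (setc k (u * x)) ka) else 0%R.

Lemma edge_cochainE ka u x : B k x -> sdom K n.+1 ka ->
  edge_cochain ka u x = prism (setc k u) psi (map (setc k (u * x)) ka).
Proof. by move=> bx D; rewrite /edge_cochain; case: asboolP => // -[]. Qed.

Lemma edge_cochain_ulc : exists2 U, lev U & forall ka ka' u u' x x',
  sdom K n.+1 ka -> sdom K n.+1 ka' -> eqs U K ka ka' -> eqm U u u' -> eqm U x x' ->
  B k x -> B k x' -> edge_cochain ka u x = edge_cochain ka' u' x'.
Proof.
have [U lU hU] := good_ulc Gpsi; exists U => // ka ka' u u' x x' D D' e eu ex bx bx'.
rewrite !edge_cochainE //; apply: (eq_prism_edge e) => s1 w s2 t1 w' t2 es et e1 ew e2.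
apply: hU; [by apply: dom_edge => //; rewrite -es|by apply: dom_edge => //; rewrite -et|].
by apply: eqs_edge => //; apply: eqmM La _ lU _ _ _ _ eu ex.
Qed.

Lemma edge_cochain_id ka u : edge_cochain ka u 1 = 0%R.
Proof.
rewrite /edge_cochain; case: asboolP => // -[_ _]; rewrite mulg1.
rewrite -[RHS](prism0 _ (setc k u) (map (setc k u) ka)).
by apply: eq_prism_edge (rel2_refl ka (r := eq) _) _ => // *; apply: good_normalized Gpsi _ _ _.
Qed.

Lemma edge_cochain_normalized s1 w s2 u x : edge_cochain (s1 ++ w :: w :: s2) u x = 0%R.
Proof.
rewrite /edge_cochain; case: asboolP => // _; rewrite map_cat.
exact: normalized_prism (good_normalized Gpsi) _ _ _.
Qed.

Lemma edge_cochain_inv f ka u x : b ->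
  edge_cochain (map (lmul f) ka) (f * u) x = edge_cochain ka u x.
Proof.
move=> hb; rewrite /edge_cochain.
have -> : `[< B k x /\ sdom K n.+1 (map (lmul f) ka) >] = `[< B k x /\ sdom K n.+1 ka >].
  apply: asbool_equiv_eq; split=> -[bx D]; split => //; last exact: dom_lmul.
  have := dom_lmul f^-1 D; rewrite -map_comp (@eq_map _ _ _ id) ?map_id // => w.
  by apply/funext => l; rewrite /= /lmul mulKg.
case: asboolP => // -[bx D].
apply: (eq_prism_edge (r := fun x y => x = lmul f y)).
  by elim: (ka) => //= y s IH.
move=> s1 w s2 t1 w' t2 es et r1 -> r2.
have D' : sdom K n.+1 (t1 ++ w' :: t2) by rewrite -et.
rewrite -[RHS](good_inv Gpsi hb f) ?map_cat /=; last exact: dom_edge.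
rewrite -mulgA !setc_lmul; congr (psi (_ ++ _ :: _ :: _)).
  by elim: s1 t1 r1 {es et D'} => [|y s IH] [|z t] //= [-> /IH ->]; rewrite setc_lmul.
by elim: s2 t2 r2 {es et D'} => [|y s IH] [|z t] //= [-> /IH ->]; rewrite setc_lmul.
Qed.

Definition integral (c : F -> F -> R) : F -> R :=
  xget (fun=> 0%R) [set g | [/\ lc1 g, g 1 = 0%R &
    forall u x, B k x -> g (u * x) = (g u + c u x)%R]].

Lemma integralP ka (g := integral (edge_cochain ka)) : sdom K n.+1 ka ->
  [/\ lc1 g, g 1 = 0%R & forall u x, B k x -> g (u * x) = (g u + edge_cochain ka u x)%R].
Proof.
move=> D; have [|u|g' hg] := tree_integral TB (k := k) (c := edge_cochain ka).
- have [U lU hU] := edge_cochain_ulc; exists U => // u u' x x' eu ex bx bx'.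
  by apply: hU => //; exact: (eqs_refl La).
- exact: edge_cochain_id.
by rewrite /g /integral; case: xgetP => [g'' _ //|/(_ g') []].
Qed.

(** An integral is determined up to a constant, fixed here by its value at [base]. In the invariant
    case the base point must move with [F]; a coordinate [k0] other than [k] of the first vertex
    does. *)
Definition base (ka : seq Om) : F := if b then head w1 ka k0 else 1.

Definition potential (ka : seq Om) (u : F) : R :=
  (integral (edge_cochain ka) u - integral (edge_cochain ka) (base ka))%R.

Lemma potential_edge ka u x : sdom K n.+1 ka -> B k x ->
  (potential ka (u * x) - potential ka u = edge_cochain ka u x)%R.
Proof. by move=> /integralP [_ _ h] bx; rewrite /potential h //; ring. Qed.

Lemma potential_lc ka : sdom K n.+1 ka -> lc1 (potential ka).
Proof. by move=> /integralP [h _ _]; apply: lc1B => //; apply: lc1_cst. Qed.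

(** The difference of the two functions does not change along the edges of the tree, hence is
    constant. *)
Lemma integral_unique (g g' : F -> R) : lc1 g -> lc1 g' ->
  (forall u x, B k x -> g (u * x)%g - g u = g' (u * x)%g - g' u)%R ->
  forall u v, (g u - g v = g' u - g' v)%R.
Proof.
move=> lg lg' e u v.
have h := tree_const TB (k := k) (lc1B lg lg') _.
have {}h w : (g w - g' w = g 1%g - g' 1%g)%R.
  apply: h => {}w x bx; have := e w x bx => /eqP; rewrite -subr_eq0 => /eqP ee.
  by apply/eqP; rewrite -subr_eq0 -ee; apply/eqP; ring.
have := h u; rewrite -(h v) => /eqP; rewrite -subr_eq0 => /eqP ee.
by apply/eqP; rewrite -subr_eq0 -ee; apply/eqP; ring.
Qed.

Lemma potential_inv f ka u : b -> sdom K n.+1 ka ->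
  potential (map (lmul f) ka) (f * u) = potential ka u.
Proof.
move=> hb D; have D' := dom_lmul f D.
have -> : potential ka u = (integral (edge_cochain ka) (f^-1 * (f * u)) -
    integral (edge_cochain ka) (f^-1 * (f * base ka)))%R by rewrite !mulKg.
have eb : base (map (lmul f) ka) = f * base ka.
  by rewrite /base hb; case: ka D {D'} => [[]|w s] //=.
rewrite /potential eb; apply: (integral_unique (g' := fun v => integral _ (f^-1 * v))).
- by have [] := integralP D'.
- have [[U lU hU] _ _] := integralP D; exists U => // v v' e.
  by apply: hU; exact: (eqmM La lU (eqm_refl La lU _) e).
- move=> v x bx; have [_ _ h] := integralP D; have [_ _ h'] := integralP D'.
  rewrite mulgA h // h' // -[v in edge_cochain _ v](mulKVg f) edge_cochain_inv //.
  ring.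
Qed.

Lemma potential_lc2 ka : sdom K n.+1 ka -> exists2 U, lev U & forall ka' u u',
  sdom K n.+1 ka' -> eqs U K ka ka' -> eqm U u u' -> potential ka' u' = potential ka u.
Proof.
move=> D; have [U lU hU] := edge_cochain_ulc; have [[V lV hV] _ _] := integralP D.
have [W lW sW] := lev_cap La lU lV; exists W => // ka' u u' D' e eu.
have -> : potential ka' u' =
    (integral (edge_cochain ka) u' - integral (edge_cochain ka) (base ka'))%R.
  suff e' : edge_cochain ka' = edge_cochain ka by rewrite /potential e'.
  apply/funext => v; apply/funext => x.
  have [bx|nb] := pselect (B k x); last by rewrite /edge_cochain !asboolF //; case.
  apply/esym/hU => //; try exact: (eqm_refl La lU).
  by apply: eqs_sub e => // y /sW [].
congr (_ - _)%R; first by apply/esym/hV; apply: eqm_sub eu => x /sW [].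
apply/esym/hV; rewrite /base; case: (boolP b) => hb; last exact: eqm_refl La _ lV _.
case: ka ka' D D' e {hV} => [|w s] [|w' s'] D D' //=; try by case: D D' => [_ ?] [_ ?].
by move=> [h _]; apply: eqm_sub (h k0 (k0J hb)) => x /sW [].
Qed.

Lemma potential_normalized s1 w s2 u : sdom K n.+1 (s1 ++ w :: w :: s2) ->
  potential (s1 ++ w :: w :: s2) u = 0%R.
Proof.
move=> D; rewrite /potential -(subrr (0 : R)%R).
apply: (@integral_unique _ (fun=> 0%R)); [by have [] := integralP D|exact: lc1_cst|].
move=> v x bx; have [_ _ ->] := integralP D => //.
by rewrite edge_cochain_normalized; ring.
Qed.

Definition hd s : F := head w1 s k.

(** The prism retracts the coordinate [k] onto its value at the first vertex. This retraction may
    change when the first vertex is deleted; [potential] compensates for the change. *)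
Definition prim s : R := (prism (setc k (hd s)) psi s + potential s (hd s))%R.

(** What remains of [psi] once the coordinate [k] has been frozen at [u]; by [rest_const] the choice
    of [u] is immaterial. *)
Definition rest s u : R :=
  (psi (map (setc k u) s) - cobd (fun ka => potential ka u) s)%R.

Lemma dom_behead m x s : sdom J m.+1 (x :: s) -> sdom J m s.
Proof. exact: (@dom_face _ _ [::] x s). Qed.

Lemma prism_cocycle s : sdom J n.+2 s -> prism (setc k (hd s)) (cobd psi) s = 0%R.
Proof.
move=> [X sz]; rewrite -[RHS](prism0 _ (setc k (hd s)) s); apply: eq_prism.
move=> s1 x s2 es; apply: Zpsi; split; last first.
  by rewrite -sz es !size_cat /= !size_map addnS.
by rewrite es in X *; apply: (simplex_prism TB) => //; case: (s1).
Qed.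

Definition primu u s : R := (prism (setc k u) psi s + potential s u)%R.

(** Deleting [x] changes the base value of the coordinate [k] only if the crossing occurs at the
    first step. Then [t] is constant in this coordinate, its own prism is degenerate, and
    [potential_edge] supplies the missing prism along the edge. *)
Lemma prim_face x t : sdom J n.+2 (x :: t) -> prim t = primu (x k) t.
Proof.
move=> D; have Dt : sdom K n.+1 t by apply: dom_sub (dom_behead D); rewrite subD1set.
have : hd t = x k \/ all (pred1 (hd t)) (map (fun w : Om => w k) t) /\ B k ((x k)^-1 * hd t).
  case: t D Dt => [[_]//|y t] [X _] _; exact: step_cons2 (X k kJ).
rewrite /prim /primu; case=> [-> //|[al bx]].
have := potential_edge (x k) Dt bx; rewrite mulKVg edge_cochainE // mulKVg.
rewrite (map_setc_id al).
have -> : prism (setc k (hd t)) psi t = 0%R.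
  rewrite -[RHS](prism0 _ (setc k (hd t)) t); apply: eq_prism => s1 z s2 es.
  suff -> : setc k (hd t) z = z by apply: (good_normalized Gpsi).
  have /map_setc_id : all (pred1 (hd t)) (map (fun w : Om => w k) [:: z]).
    by move: al; rewrite {2}es map_cat all_cat /= => /and3P [_ ->].
  by case.
by move=> <-; rewrite add0r subrK.
Qed.

Lemma cobd_prim s : sdom J n.+2 s -> (psi s - cobd prim s)%R = rest s (hd s).
Proof.
move=> D; have z := prism_cocycle D.
have -> : cobd prim s = cobd (primu (hd s)) s.
  by case: s D {z} => [//|x t] D; rewrite !cobd_cons (prim_face D).
rewrite /rest /primu cobdD; have := cobd_prism (setc k (hd s)) psi s.
rewrite z addr0 => ->; ring.
Qed.

(** Along an edge the change of the potential term is the coboundary of a prism, and since [psi] is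
    a cocycle the homotopy formula equates it with the change of the first term. Connectedness of
    the tree concludes. *)
Lemma rest_const s u : sdom K n.+2 s -> rest s u = rest s 1.
Proof.
move=> D; apply: (tree_const TB (k := k)).
  apply: lc1B.
    have [U lU hU] := good_ulc Gpsi; exists U => // v v' e.
    apply: hU; try exact: dom_setc.
    apply: rel2_map (rel2_refl s (r := eq) _) => // x _ <- l _.
    by rewrite /setc; case: eqP => // _; apply: (eqm_refl La).
  apply: lc1_cobd => s1 x s2 es; apply: potential_lc.
  by apply: (@dom_face _ _ s1 x); rewrite -es.
move=> {}u x bx; apply/eqP; rewrite -subr_eq0; apply/eqP.
have : (cobd (fun ka => potential ka (u * x)%g) s - cobd (fun ka => potential ka u) s)%R =
   cobd (prism (setc k u) psi) (map (setc k (u * x)) s).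
  rewrite -cobdB -cobd_map; apply: eq_cobd => s1 y s2 es.
  have Df : sdom K n.+1 (s1 ++ s2) by apply: (@dom_face _ _ s1 y); rewrite -es.
  by rewrite potential_edge // edge_cochainE.
have := cobd_prism (setc k u) psi (map (setc k (u * x)) s).
have -> : prism (setc k u) (cobd psi) (map (setc k (u * x)) s) = 0%R.
  rewrite -[RHS](prism0 _ (setc k u) (map (setc k (u * x)) s)).
  apply: (eq_prism_edge (rel2_refl s (r := eq) _)) => // s1 w s2 _ _ _ es _ _ _ _.
  by apply: Zpsi; apply: dom_edge => //; rewrite -es.
rewrite addr0 map_setc_setc => -> e; rewrite /rest.
rewrite -[RHS](subrr (psi (map (setc k (u * x)) s) - psi (map (setc k u) s))%R) -{2}e.
ring.
Qed.

Lemma potential_ulc : exists2 U, lev U & forall ka ka',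
  sdom K n.+1 ka -> sdom K n.+1 ka' -> eqs U K ka ka' ->
  potential ka 1 = potential ka' 1.
Proof.
apply: (lc_ulc La (n := n.+1)) => [s []//|s h|s D]; first exact: (dom_closed La TB h).
have [U lU hU] := potential_lc2 D; exists U => // t Dt e.
by apply: hU => //; apply: (eqm_refl La).
Qed.

Lemma prim_good : good b J n.+1 (restr0 (sdom J n.+1) prim).
Proof.
have KJ : K \subset J by rewrite subD1set.
split.
- apply: ulc_restr0.
  have [V lV hV] := good_ulc Gpsi.
  apply: (lc_ulc La (n := n.+1)) => [s []//|s h|s D]; first exact: (dom_closed La TB h).
  have [U lU hU] := potential_lc2 (dom_sub KJ D); have [W lW sW] := lev_cap La lU lV.
  exists W => // t Dt e.
  have eh : eqm W (hd s) (hd t).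
    by case: s D Dt e {hU} => [[_]//|x s] _; case: t => [|y t] _ //= [/(_ k kJ)].
  congr (_ + _)%R; last first.
    apply: hU; first exact: dom_sub Dt.
      by apply: eqs_sub e => // x /sW [].
    by apply: eqm_sub eh => x /sW [].
  apply/esym/(eq_prism2 e) => s1 x s2 t1 y t2 es et e1 e2 exy.
  have dp s' s1' x' s2' : sdom J n.+1 s' -> s' = s1' ++ x' :: s2' ->
      sdom J n.+2 (map (setc k (hd s')) s1' ++ setc k (hd s') x' :: x' :: s2').
    move=> [X sz] es'; split; last by rewrite -sz es' !size_cat /= size_map addnS.
    by rewrite es' in X *; apply: (simplex_prism TB) => //; case: (s1').
  apply: hV; [exact: dp|exact: dp|].
  have S x' y' : (forall l, l \in J -> eqm W (x' l) (y' l)) ->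
      forall l, l \in J -> eqm W (setc k (hd s) x' l) (setc k (hd t) y' l).
    by move=> h l lJ; rewrite /setc; case: eqP => // _; apply: h.
  apply: (@eqs_sub H F W V J J); [by move=> z /sW []|by []|].
  apply: rel2_cat; first by apply: rel2_map e1 => x' y'; apply: S.
  by split; [apply: S|split].
- apply: normalized_restr0 => s1 x s2 D; rewrite /prim.
  rewrite (normalized_prism _ (good_normalized Gpsi)) add0r.
  exact: potential_normalized (dom_sub KJ D).
- move=> hb f s D; rewrite !restr0E //; last exact: dom_lmul.
  have eh : hd (map (lmul f) s) = f * hd s by case: s D => [[_]|].
  rewrite /prim eh potential_inv //; last exact: dom_sub D.
  congr (_ + _)%R; apply: (eq_prism2 (r := fun x y => x = lmul f y)).
    by elim: (s) => //= y s' IH.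
  move=> s1 w s2 t1 w' t2 es et r1 r2 ->.
  rewrite -[RHS](good_inv Gpsi hb f); last first.
    have [X sz] := D; split; last by rewrite -sz et !size_cat /= size_map addnS.
    by rewrite et in X *; apply: (simplex_prism TB) => //; case: (t1).
  rewrite map_cat /= setc_lmul; congr (psi (_ ++ _ :: _ :: _)).
    by elim: s1 t1 r1 {es et} => [|y s' IH] [|z t] //= [-> /IH ->]; rewrite setc_lmul.
  by elim: s2 t2 r2 {es et} => [|y s' IH] [|z t] //= [-> /IH ->].
Qed.

Lemma rest_good : good b K n.+2 (restr0 (sdom K n.+2) (fun s => rest s 1)).
Proof.
split.
- apply: ulc_restr0; have [V lV hV] := good_ulc Gpsi.
  have [U lU hU] := potential_ulc; have [W lW sW] := lev_cap La lU lV.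
  exists W => // s t Ds Dt e; congr (_ - _)%R.
    apply: hV; try exact: dom_setc.
    apply: (@eqs_sub H F W V J J); [by move=> z /sW []|by []|].
    apply: rel2_map e => x y h l lJ; rewrite /setc; case: eqP => [_|/eqP lk].
      exact: (eqm_refl La).
    by apply: h; rewrite !inE lk.
  apply: (eq_cobd2 e) => s1 x s2 t1 y t2 es et e1 e2; apply: hU.
  + by apply: (@dom_face _ _ s1 x); rewrite -es.
  + by apply: (@dom_face _ _ t1 y); rewrite -et.
  + by apply: (@eqs_sub H F W U K K); [by move=> z /sW []|by []|apply: rel2_cat].
- apply: normalized_restr0 => s1 x s2 D; rewrite /rest.
  rewrite map_cat /= (good_normalized Gpsi) sub0r.
  have -> : cobd (fun ka => potential ka 1) (s1 ++ x :: x :: s2) =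
      cobd (restr0 (sdom K n.+1) (fun ka => potential ka 1)) (s1 ++ x :: x :: s2).
    apply: eq_cobd => t1 y t2 et; rewrite restr0E //.
    by apply: (@dom_face _ _ t1 y); rewrite -et.
  rewrite (normalized_cobd _) ?oppr0 //; apply: normalized_restr0 => *.
  exact: potential_normalized.
- move=> hb f s D; rewrite !restr0E //; last exact: dom_lmul.
  rewrite -(@rest_const _ (f * 1)); last exact: dom_lmul.
  rewrite /rest; congr (_ - _)%R.
    rewrite -[RHS](good_inv Gpsi hb f); last exact: dom_setc.
    by rewrite -!map_comp; congr psi; apply: eq_map => w /=; rewrite setc_lmul.
  rewrite -cobd_map; apply: eq_cobd => s1 x s2 es; apply: potential_inv => //.
  by apply: (@dom_face _ _ s1 x); rewrite -es.
Qed.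

Lemma prism_step : exists xi psi0,
  [/\ good b J n.+1 xi, good b K n.+2 psi0,
      forall s, sdom K n.+3 s -> cobd psi0 s = 0%R
    & forall s, sdom J n.+2 s -> psi s = (psi0 s + cobd xi s)%R].
Proof.
exists (restr0 (sdom J n.+1) prim), (restr0 (sdom K n.+2) (fun s => rest s 1)).
split; [exact: prim_good|exact: rest_good| |].
- move=> s D.
  have -> : cobd (restr0 (sdom K n.+2) (fun s => rest s 1)) s =
      cobd (fun u => psi (map (setc k 1) u) - cobd (fun ka => potential ka 1) u)%R s.
    apply: eq_cobd => s1 x s2 es; rewrite restr0E //.
    by apply: (@dom_face _ _ s1 x); rewrite -es.
  by rewrite cobdB cobdK subr0 cobd_map Zpsi //; apply: dom_setc.
- move=> s D; have DK : sdom K n.+2 s by apply: dom_sub D; rewrite subD1set.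
  rewrite restr0E // -(rest_const (hd s) DK) -(cobd_prim D).
  rewrite (_ : cobd (restr0 _ _) s = cobd prim s) ?subrK //.
  apply: eq_cobd => s1 x s2 es; rewrite restr0E //.
  by apply: (@dom_face _ _ s1 x); rewrite -es.
Qed.

End Step.
End Prism.

Section Acyclic.
Variables (p : nat) (H : finGroupType) (F : groupType) (a : H -> F -> F).
Variables (lev : set (set F)) (B : H -> set F).
Hypotheses (La : leveled_action a lev) (TB : tree_family p a lev B).
Local Notation Om := (H -> F).
Local Notation R := ('F_p : comNzRingType).
Implicit Types (J : {set H}) (s t : seq Om) (c : seq Om -> R) (U : set F).
Local Notation sdom := (sdom B).
Local Notation good := (good lev B).

Lemma ulcD D J c c' : ulc lev D J c -> ulc lev D J c' ->
  ulc lev D J (fun s => c s + c' s)%R.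
Proof.
move=> [U lU h] [V lV h']; have [W lW sW] := lev_cap La lU lV.
by exists W => // s t Ds Dt e; rewrite (h s t) ?(h' s t) //;
  apply: eqs_sub e => // x /sW [].
Qed.

Lemma good_sub b J J' n c : J' \subset J -> good b J' n c -> good b J n c.
Proof.
move=> JJ [[U lU hU] nc ic]; split => //.
  exists U => // s t Ds Dt e; apply: hU; [exact: dom_sub Ds|exact: dom_sub Dt|].
  exact: eqs_sub e.
by move=> hb f s D; apply: ic => //; apply: dom_sub D.
Qed.

Lemma goodD b J n c c' : good b J n c -> good b J n c' ->
  good b J n (fun s => c s + c' s)%R.
Proof.
move=> [u nc i] [u' nc' i']; split; first exact: ulcD.
  by move=> s1 x s2; rewrite nc nc' addr0.
by move=> hb f s D; rewrite i // i'.
Qed.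

Lemma good0 b J n : good b J n (fun=> 0%R : R).
Proof. by split => //; have [U lU] := lev_has La; exists U. Qed.

(** Vertices that agree in the coordinates of [J] are indistinguishable modulo every level, so the
    simplex may be replaced by a degenerate one. *)
Lemma ulc_dup0 J n c s1 x y s2 : ulc lev (sdom J n) J c -> normalized c ->
  sdom J n (s1 ++ x :: y :: s2) -> (forall k, k \in J -> x k = y k) ->
  c (s1 ++ x :: y :: s2) = 0%R.
Proof.
move=> [U lU hU] nc D e; rewrite -(nc s1 x s2); apply: hU => //.
  have [X sz] := D; split; last by rewrite -sz !size_cat /= !addnS.
  have X' : simplex B J (s1 ++ x :: s2).
    have := X; rewrite -[x :: y :: s2]/([:: x] ++ y :: s2) catA => X1.
    by rewrite -cat1s catA; apply: simplex_del X1.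
  exact: simplex_dup.
apply: rel2_cat; first exact: (eqs_refl La).
split; first by move=> k _; apply: (eqm_refl La).
by split; [move=> k kJ; rewrite e //; apply: (eqm_refl La) | exact: (eqs_refl La)].
Qed.

(** Coordinates are eliminated one at a time until [J] is empty or, in the invariant case, reduced
    to [k0]. The last tree cannot be removed invariantly, since its quotient by [F] may have
    cohomology in degree one; hence the condition [0 < n]. In what is left, simplices of this length
    repeat a vertex. *)
Lemma acyclic (b : bool) k0 J n (psi : seq Om -> R) :
  (b -> k0 \in J) -> (b -> (0 < n)%N) -> good b J n.+2 psi ->
  (forall s, sdom J n.+3 s -> cobd psi s = 0%R) ->
  exists2 xi, good b J n.+1 xi & forall s, sdom J n.+2 s -> psi s = cobd xi s.
Proof.
have [m] := ubnP #|J|; elim: m J psi => // m IH J psi; rewrite ltnS => cJ k0J n0 G Z.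
have [/existsP [k /andP [kJ kb]]|none] :=
    boolP [exists k : H, (k \in J) && (b ==> (k != k0))].
  have k0K : b -> k0 \in J :\ k.
    by move=> hb; move: kb; rewrite hb implyTb !inE eq_sym => ->; rewrite k0J.
  have [xi [psi0 [G1 G2 Z2 e]]] := prism_step La TB kJ k0K G Z.
  have cK : (#|J :\ k| < m)%N.
    by apply: leq_trans cJ; rewrite [X in (_ < X)%N](cardsD1 k) kJ.
  have [xi' G' e'] := IH _ _ cK k0K n0 G2 Z2.
  have KJ : J :\ k \subset J by rewrite subD1set.
  exists (fun s => xi s + xi' s)%R; first exact/goodD/(good_sub KJ).
  by move=> s D; rewrite e // e' ?cobdD 1?addrC //; apply: dom_sub D.
exists (fun=> 0%R); first exact: good0.
move=> s D; rewrite cobd0; case: G => uc nc _.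
have Jk0 k : k \in J -> b /\ k = k0.
  move=> kJ; have := none; rewrite negb_exists => /forallP /(_ k).
  by rewrite kJ /= negb_imply negbK => /andP [-> /eqP].
case: s D => [|x [|y s]] [X] //= sz.
have [e|ne] := pselect (forall k, k \in J -> x k = y k).
  exact: (@ulc_dup0 J n.+2 psi [::]).
have [k nk] : exists k, ~ (k \in J -> x k = y k) by apply/existsNP.
have kJ : k \in J by apply/negPn/negP => nkJ; apply: nk; rewrite (negPf nkJ).
(* One tree is left: after the crossing from [x] to [y] the third vertex agrees with [y] there, and
   [0 < n] provides that vertex. *)
have [hb ek] := Jk0 k kJ.
have [yx|[al _]] := step_cons2 (X k kJ); first by case: nk.
case: s sz X al => [|z s] sz X al; first by move: sz (n0 hb) => [<-].
apply: (@ulc_dup0 J n.+2 psi [:: x]) => // l lJ.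
have [_ ->] := Jk0 l lJ; rewrite -ek.
by move: al => /and3P [_ /eqP ->].
Qed.

(* Each coordinate changes at most once along a simplex. *)
Lemma simplex_dup_exists s : simplex B [set: H] s -> (#|H|.+1 < size s)%N ->
  exists s1 x s2, s = s1 ++ x :: x :: s2.
Proof.
move=> X sz; apply: contrapT => no.
pose w i := nth (fun=> 1 : F) s i.
have ch (i : 'I_(size s).-1) : {k : H | w i k != w i.+1 k}.
  apply: cid; apply: contrapT => nk.
  have ii : (i.+1 < size s)%N by rewrite -ltn_predRL.
  have e : w i = w i.+1.
    by apply/funext => k; apply/eqP/negPn/negP => nk'; apply: nk; exists k.
  apply: no; exists (take i s), (w i), (drop i.+2 s).
  rewrite {2}e -(drop_nth _ ii) -(drop_nth _ (ltnW ii)).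
  by rewrite cat_take_drop.
pose f i := sval (ch i).
have : injective f.
  move=> i j fij; apply: val_inj => /=; wlog ij : i j fij / (i < j)%N.
    move=> h; case: (ltngtP i j) => // ij; first exact: h.
    by apply/esym/h.
  have := svalP (ch i); have := svalP (ch j); rewrite -/(f i) -/(f j) fij.
  set k := f j.
  have [u [v [_ /cutP [l [m es]]]]] := X k (finset.in_setT _).
  have jj : (j.+1 < size s)%N by rewrite -ltn_predRL.
  have wE q : (q < size s)%N -> w q k = if (q < l)%N then u else v.
    move=> qs; rewrite /w -(nth_map _ 1 (fun w : Om => w k)) // es nth_cat size_nseq.
    have szs : size s = (l + m)%N by rewrite -(size_map (fun w : Om => w k)) es size_cat !size_nseq.
    case: ltnP => ql; rewrite nth_nseq ?ql // ltn_subLR // -szs qs //.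
  have is' : (i.+1 < size s)%N by apply: leq_ltn_trans (ltnW jj).
  rewrite !wE ?(ltnW jj) ?(ltnW is') //.
  case: (ltnP j l) => jl; last first.
    have -> : (j.+1 < l)%N = false by apply/negbTE; rewrite -leqNgt leqW.
    by rewrite eqxx.
  by rewrite (ltn_trans ij jl) (leq_ltn_trans ij jl) eqxx.
move=> /leq_card; rewrite card_ord leqNgt => /negP; apply.
by rewrite -ltnS prednK // (leq_trans _ sz).
Qed.

End Acyclic.

(** * Stabilizers *)

Section Stabilizers.
Variables (p : nat) (H : finGroupType) (F : groupType) (a : H -> F -> F).
Variables (lev : set (set F)) (B : H -> set F).
Hypotheses (La : leveled_action a lev) (TB : tree_family p a lev B).
Local Notation Om := (H -> F).
Local Notation R := ('F_p : comNzRingType).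
Implicit Types (S K : {group H}) (s t : seq Om) (c : seq Om -> R) (U : set F).
Local Notation w1 := ((fun=> 1) : Om).
Local Notation sdom := (sdom B).
Local Notation good := (good lev B).

Definition fs (f : F) s : seq Om := map (lmul f) s.
Definition hs (h : H) s : seq Om := map (hact a h) s.

Lemma hact1 w : hact a 1 w = w.
Proof. by apply/funext => k; rewrite /hact (lact1 La) invg1 mul1g. Qed.

Lemma hactM h k w : hact a (h * k) w = hact a h (hact a k w).
Proof. by apply/funext => l; rewrite /hact (lactM La) invgM mulgA. Qed.

Lemma hact_lmul h f w : hact a h (lmul f w) = lmul (a h f) (hact a h w).
Proof. by apply/funext => l; rewrite /hact /lmul (lactD La). Qed.

Lemma hs1 s : hs 1 s = s.
Proof. by rewrite /hs (eq_map hact1) map_id. Qed.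

Lemma hsM h k s : hs (h * k) s = hs h (hs k s).
Proof. by rewrite /hs -map_comp; apply: eq_map => w; rewrite /= hactM. Qed.

Lemma hsK h s : hs h^-1 (hs h s) = s.
Proof. by rewrite -hsM mulVg hs1. Qed.

Lemma fs1 s : fs 1 s = s.
Proof.
rewrite /fs (@eq_map _ _ _ id) ?map_id // => w; apply/funext => k.
by rewrite /lmul mul1g.
Qed.

Lemma fsM f g s : fs (f * g) s = fs f (fs g s).
Proof.
rewrite /fs -map_comp; apply: eq_map => w; apply/funext => k.
by rewrite /lmul /= mulgA.
Qed.

Lemma fsK f s : fs f^-1 (fs f s) = s.
Proof. by rewrite -fsM mulVg fs1. Qed.

Lemma hs_fs h f s : hs h (fs f s) = fs (a h f) (hs h s).
Proof. by rewrite /hs /fs -!map_comp; apply: eq_map => w; rewrite /= hact_lmul. Qed.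

Lemma eqs_hs U h s t : lev U -> eqs U [set: H] s t -> eqs U [set: H] (hs h s) (hs h t).
Proof.
move=> lU; apply: rel2_map => x y e k _; apply: (eqm_act La lU).
by apply: e; apply: finset.in_setT.
Qed.

Lemma eqs_fs U f s t : lev U -> eqs U [set: H] s t -> eqs U [set: H] (fs f s) (fs f t).
Proof.
move=> lU; apply: rel2_map => x y e k _.
by apply: (eqmM La lU) (eqm_refl La lU _) _; apply: e; apply: finset.in_setT.
Qed.

Lemma eqs_fs2 U f g s : lev U -> eqm U f g -> eqs U [set: H] (fs f s) (fs g s).
Proof.
move=> lU e; apply: rel2_map (rel2_refl s (r := eq) _) => // x _ <- k _.
exact: (eqmM La lU e (eqm_refl La lU _)).
Qed.

Lemma eqs_sep s t : (forall U, lev U -> eqs U [set: H] s t) -> s = t.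
Proof.
have [U0 lU0] := lev_has La.
elim: s t => [|x s IH] t e; have := rel2_size (e U0 lU0); case: t e => [|y t] //= e _.
have -> : s = t by apply: IH => V lV; case: (e V lV).
suff -> : x = y by [].
apply/funext => k; apply: (eqm_sep La) => V lV; have [h _] := e V lV.
by apply: h; apply: finset.in_setT.
Qed.

Lemma dom_hs n h s : sdom [set: H] n s -> sdom [set: H] n (hs h s).
Proof. by move=> [X sz]; split; [apply: (simplex_hact La TB) | rewrite size_map]. Qed.

(** The image in [H] of the stabilizer of [s] in the semidirect product of [F] and [H]; on nonempty
    tuples this projection is injective because [F] acts freely. *)
Definition stab s : {set H} := [set h | `[< exists f, hs h s = fs f s >]].

Lemma stabP h s : reflect (exists f, hs h s = fs f s) (h \in stab s).
Proof. by rewrite inE; apply: asboolP. Qed.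

Lemma stab_group_set s : group_set (stab s).
Proof.
apply/group_setP; split; first by apply/stabP; exists 1; rewrite hs1 fs1.
move=> h k /stabP [f hf] /stabP [g kg]; apply/stabP; exists (a h g * f).
by rewrite hsM kg hs_fs hf -fsM.
Qed.
Canonical stab_group s := Group (stab_group_set s).

Lemma stab_fs f s : stab (fs f s) = stab s.
Proof.
apply/setP => h; apply/stabP/stabP => -[g e].
  exists ((a h f)^-1 * g * f).
  by rewrite !fsM -e hs_fs fsK.
by exists (a h f * g * f^-1); rewrite hs_fs e !fsM fsK.
Qed.

Lemma mem_stab_hs h k s : (k \in stab (hs h s)) = (k ^ h \in stab s).
Proof.
have e : hs k (hs h s) = hs h (hs (k ^ h) s).
  by rewrite -!hsM conjgE !mulgA mulgV mul1g.
apply/stabP/stabP => -[f]; rewrite ?e => ef.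
  exists (a h^-1 f); rewrite -[LHS](hsK h) ef hs_fs hsK //.
by exists (a h f); rewrite ef hs_fs.
Qed.

Lemma stab_face s1 x s2 : stab (s1 ++ x :: s2) \subset stab (s1 ++ s2).
Proof.
apply/fintype.subsetP => h /stabP [f e]; apply/stabP; exists f.
elim: s1 e => [|y s1 IH] /=; first by case.
by case=> -> /IH ->.
Qed.

(* [stab_witness h s] is the only possible [f] in [hs h s = fs f s]. *)
Definition stab_witness h s t : F := hact a h (head w1 s) 1 * (head w1 t 1)^-1.

(** Compactness separates [hs h s] from the [F]-orbit of [t] at one level. Although [f] is
    arbitrary, near a cluster point it is forced to approach [stab_witness], so that clustering [s]
    and [t] is enough. *)
Lemma near_stab n (Q : seq Om -> seq Om -> Prop) h :
  (forall s t, Q s t -> size s = n /\ size t = n) ->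
  (forall s t, (forall U, lev U -> exists s' t',
     [/\ Q s' t', eqs U [set: H] s s' & eqs U [set: H] t t']) -> Q s t) ->
  (forall s t f, Q s t -> hs h s <> fs f t) ->
  exists2 U, lev U & forall s t f, Q s t -> ~ eqs U [set: H] (hs h s) (fs f t).
Proof.
move=> sQ cQ nQ; apply: contrapT => no.
have ch U : exists z : seq Om * seq Om * F, lev U ->
    Q z.1.1 z.1.2 /\ eqs U [set: H] (hs h z.1.1) (fs z.2 z.1.2).
  have [lU|] := pselect (lev U); last by exists ([::], [::], 1).
  apply: contrapT => hn; apply: no; exists U => // s t f Qst e.
  by apply: hn; exists (s, t, f).
have [z hz] := choice ch.
(* The two tuples are concatenated so that one cluster point serves both. *)
have [|u su hu] := cluster_lev La (m := (n + n)%N) (s := fun U => (z U).1.1 ++ (z U).1.2).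
  by move=> U lU; have [/sQ [s1 s2] _] := hz U lU; rewrite size_cat s1 s2.
pose s := take n u; pose t := drop n u.
have hst U : lev U -> exists V, [/\ lev V, forall x, V x -> U x,
    eqs U [set: H] s (z V).1.1 & eqs U [set: H] t (z V).1.2].
  move=> lU; have [V [lV VU e]] := hu U lU; exists V; split => //.
    have [/sQ [s1 s2] _] := hz V lV.
    move: e; rewrite -{1}(cat_take_drop n u) -/s -/t.
    have ss : size s = size (z V).1.1 by rewrite s1 size_takel // su leq_addr.
    by move: (s) ss => s'; elim: s' (z V).1.1 => [|x s' IH] [|y t'] //= [ss] [? /(IH _ ss)].
  have [/sQ [s1 s2] _] := hz V lV.
  move: e; rewrite -{1}(cat_take_drop n u) -/s -/t.
  have ss : size s = size (z V).1.1 by rewrite s1 size_takel // su leq_addr.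
  by move: (s) ss => s'; elim: s' (z V).1.1 => [|x s' IH] [|y t'] //= [ss] [? /(IH _ ss)].
have Qst : Q s t.
  apply: cQ => U lU; have [V [lV _ e1 e2]] := hst U lU.
  by exists (z V).1.1, (z V).1.2; have [] := hz V lV.
apply: (nQ s t (stab_witness h s t) Qst); apply: eqs_sep => U lU.
have [V [lV VU e1 e2]] := hst U lU; have [QV eV] := hz V lV.
apply: (eqs_trans La lU (eqs_hs h lU e1)).
apply: (@eqs_trans _ _ _ _ La _ _ _ (fs (z V).2 (z V).1.2) _ lU).
  exact: eqs_sub eV.
apply: (@eqs_trans _ _ _ _ La _ _ _ (fs (z V).2 t) _ lU).
  by apply: eqs_fs => //; apply: (eqs_sym La).
have [s0 t0] := sQ _ _ QV; have [s0' t0'] := sQ _ _ Qst.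
have [n0|n0] := posnP n; first by rewrite (size0nil (etrans t0' n0)).
apply: eqs_fs2 => //; rewrite /stab_witness.
move: n0 (n0) (n0) (n0) e1 e2 eV; rewrite -{1}s0' -{1}t0' -{1}s0 -{1}t0.
case: s t (z V).1.1 (z V).1.2 {s0 t0 s0' t0' QV Qst hst} => [//|x s] [//|y t] [//|x' s'] [//|y' t'] /= _ _ _ _.
move=> [ex _] [ey _] [exy _].
have e0 : eqm U ((z V).2 * y' 1) (hact a h x 1).
  apply: (eqm_trans La lU (y := hact a h x' 1)).
    apply: (eqm_sym La lU); apply: eqm_sub VU _; apply: exy; exact: finset.in_setT.
  apply: (eqm_act La lU); apply: (eqm_sym La lU); apply: ex; exact: finset.in_setT.
rewrite -[(z V).2](mulgK (y' 1)).
apply: (eqmM La lU e0); apply: (eqmV La lU); apply: (eqm_sym La lU).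
by apply: ey; apply: finset.in_setT.
Qed.

End Stabilizers.

(** * Smith theory *)

Lemma Fp_nat_eq p (pp : prime p) i j :
  (i%:R == j%:R :> 'F_p)%R = (i == j %[mod p]).
Proof. by rewrite -val_eqE /= !val_Fp_nat. Qed.

(** The character is the discrete logarithm with respect to a generator of the cyclic quotient of
    order [p]. *)
Lemma Fp_character (gT : finGroupType) (K N : {group gT}) p :
  prime p -> N <| K -> #|K : N| = p ->
  exists chi : gT -> 'F_p,
    [/\ {in K &, forall g h, chi (g * h)%g = chi g + chi h}%R,
        {in K, forall g, (chi g == 0%R) = (g \in N)}
      & exists2 g, g \in K & chi g = 1%R].
Proof.
move=> pp nNK iNK; have cKN : #|K / N| = p by rewrite card_quotient ?normal_norm.
have /cyclicP [x xE] : cyclic (K / N) by rewrite prime_cyclic // cKN.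
have ox : #[x] = p by rewrite orderE -xE.
have ex g : g \in K -> exists i : nat, coset N g == x ^+ i.
  move=> gK; have : coset N g \in <[x]> by rewrite -xE mem_quotient.
  by case/cycleP => i ->; exists i.
pose ind g := if pselect (exists i : nat, coset N g == x ^+ i) is left e
  then xchoose e else 0%N.
have indP g : g \in K -> coset N g = x ^+ ind g.
  by rewrite /ind => /ex e; case: pselect => // e'; apply/eqP/(xchooseP e').
have NK := fintype.subsetP (normal_norm nNK).
exists (fun g => (ind g)%:R%R); split.
- move=> g h gK hK; apply/eqP; rewrite -natrD Fp_nat_eq // -ox -eq_expg_mod_order.
  by rewrite -indP ?groupM // expgD -!indP // morphM ?NK.
- move=> g gK; rewrite -[0%R]/(0%:R)%R Fp_nat_eq // -ox -eq_expg_mod_order -indP //.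
  by rewrite expg0; apply/eqP/idP => [/coset_idr -> //|/coset_id //]; apply: NK.
have /morphimP [g gN gK xg] : x \in K / N by rewrite xE cycle_id.
exists g => //; apply/eqP; rewrite -[1%R]/(1%:R)%R Fp_nat_eq // -ox -eq_expg_mod_order.
by rewrite -indP // expg1 xg.
Qed.

Section Cochains.
Variables (p : nat) (H : finGroupType) (F : groupType) (a : H -> F -> F).
Variables (lev : set (set F)) (B : H -> set F).
Hypotheses (La : leveled_action a lev) (TB : tree_family p a lev B).
Hypothesis pp : prime p.
Local Notation Om := (H -> F).
Local Notation R := ('F_p : comNzRingType).
Implicit Types (S K : {group H}) (s t : seq Om) (c : seq Om -> R) (U : set F).
Local Notation sdom := (sdom B).
Local Notation hs := (hs a).
Local Notation stab := (stab a).
Local Notation setH := [set: H].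

Definition ZS S n s := sdom setH n s /\ S \subset stab s.

(* [K]-invariant cochains on the fixed complex of [S], relative to the
   simplices on which [K / S] does not act freely. *)
Record zc S K n c : Prop := Zc {
  zc_ulc : ulc lev (ZS S n) setH c;
  zc_normalized : normalized c;
  zc_fs : forall f s, ZS S n s -> c (fs f s) = c s;
  zc_hs : forall k s, k \in K -> ZS S n s -> c (hs k s) = c s;
  zc_sing : forall s, ZS S n s -> ~~ (K :&: stab s \subset S) -> c s = 0%R
}.

(** Lists of length [n.+3] have degree at least two; because of the quotient by [F] nothing is
    claimed in degree one. *)
Definition acyclic_zc S K := forall n c, zc S K n.+3 c ->
  (forall s, ZS S n.+4 s -> cobd c s = 0%R) ->
  exists2 e, zc S K n.+2 e & forall s, ZS S n.+3 s -> c s = cobd e s.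

Lemma ZS_face S n s1 x s2 : ZS S n.+1 (s1 ++ x :: s2) -> ZS S n (s1 ++ s2).
Proof.
by move=> [D st]; split; [apply: dom_face D | apply: fintype.subset_trans st (stab_face _ _ _ _)].
Qed.

Lemma ZS_fs S n f s : ZS S n s -> ZS S n (fs f s).
Proof. by move=> [D st]; split; [apply: dom_lmul | rewrite (stab_fs La)]. Qed.

Lemma ZS_hs S n k s : k \in 'N(S) -> ZS S n s -> ZS S n (hs k s).
Proof.
move=> kN [D st]; split; first exact: (dom_hs La TB).
apply/fintype.subsetP => h hS; rewrite (mem_stab_hs La) (fintype.subsetP st) //.
by rewrite memJ_norm.
Qed.

Lemma stab_closed n h s :
  (forall U, lev U -> exists2 t, size t = n /\ h \in stab t & eqs U setH s t) ->
  h \in stab s.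
Proof.
move=> e; apply: contrapT => ns.
have [|s' t' e'|s' t' f [st hst]|U lU nU] := @near_stab _ _ _ _ La n
    (fun s' t' => s' = s /\ t' = s) h.
- by move=> s' t' [-> ->]; have [U lU] := lev_has La; have [t [<- _] /rel2_size ->] := e U lU.
- split; apply: eqs_sep La _ _ _ => U lU; have [x [y [[-> ->] ex ey]]] := e' U lU => //.
- by move=> e2; apply: ns; apply/stabP; exists f; rewrite -{1}st -hst.
have [t [_ /stabP [f ef]] es] := e U lU.
apply: (nU s s f) => //; apply: (eqs_trans La lU (eqs_hs La h lU es)).
by rewrite ef; apply: (eqs_sym La lU); apply: (eqs_fs La).
Qed.

Lemma ZS_closed S n s :
  (forall U, lev U -> exists2 t, ZS S n t & eqs U setH s t) -> ZS S n s.
Proof.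
move=> e; split.
  by apply: (dom_closed La TB) => U lU; have [t [D _] et] := e U lU; exists t.
apply/fintype.subsetP => h hS; apply: (@stab_closed n) => U lU.
have [t [[_ szt] st] et] := e U lU; exists t => //; split => //.
exact: (fintype.subsetP st).
Qed.

Lemma ulc_closed S n c : ulc lev (ZS S n) setH c ->
  forall s, (forall U, lev U -> exists2 t, ZS S n t /\ c t <> 0%R & eqs U setH s t) ->
  ZS S n s /\ c s <> 0%R.
Proof.
move=> [V lV hV] s e.
have D : ZS S n s.
  by apply: ZS_closed => U lU; have [t [D _] et] := e U lU; exists t.
by split => //; have [t [Dt nt] et] := e V lV; rewrite (hV s t).
Qed.

(** The second hypothesis says that stabilizers in [K] of tuples in the support lie in [S]. Since
    the support is closed, [near_stab] extends this to approximate stabilizers at one level. *)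
Lemma zc_free S K n c : ulc lev (ZS S n) setH c ->
  (forall s, ZS S n s -> ~~ (K :&: stab s \subset S) -> c s = 0%R) ->
  exists2 U, lev U & forall s k f, ZS S n s -> c s <> 0%R -> k \in K ->
    eqs U setH (hs k s) (fs f s) -> k \in S.
Proof.
move=> uc sc.
suff h (l : seq H) : exists2 U, lev U & forall s k f, k \in l -> ZS S n s -> c s <> 0%R ->
    k \in K -> eqs U setH (hs k s) (fs f s) -> k \in S.
  have [U lU hU] := h (enum H); exists U => // s k f D nc kK.
  by apply: (hU s k f) => //; rewrite mem_enum.
elim: l => [|k l [U lU hU]]; first by have [U lU] := lev_has La; exists U.
have [kKS|nk] := boolP ((k \in K) && (k \notin S)); last first.
  exists U => // s h f; rewrite in_cons => /orP [/eqP ->|hl]; last exact: hU.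
  by move=> _ _ kK _; move: nk; rewrite kK negbK.
have [kK kS] := andP kKS.
have [|s t e|s t f [[D nc] <-] e|V lV hV] := @near_stab _ _ _ _ La n
    (fun s t => (ZS S n s /\ c s <> 0%R) /\ s = t) k.
- by move=> s t [[[[_ sz] _] _] <-].
- have st : s = t.
    apply: (eqs_sep La) => W lW; have [x [_ [[_ <-] ex ey]]] := e W lW.
    exact: (eqs_trans La lW ex (eqs_sym La lW ey)).
  split => //; apply: (ulc_closed uc) => W lW.
  by have [x [_ [[Dx <-] ex ey]]] := e W lW; exists x.
- apply: nc; apply: sc => //; apply/subsetPn; exists k => //.
  by rewrite inE kK; apply/stabP; exists f.
have [W lW sW] := lev_cap La lU lV; exists W => // s h f.
rewrite in_cons => /orP [/eqP ->|hl] D nc hK e.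
  by case: (hV s s f) => //; apply: eqs_sub e => // x /sW [].
by apply: (hU s h f) => //; apply: eqs_sub e => // x /sW [].
Qed.

End Cochains.

Section Smith.
Variables (p : nat) (H : finGroupType) (F : groupType) (a : H -> F -> F).
Variables (lev : set (set F)) (B : H -> set F).
Hypotheses (La : leveled_action a lev) (TB : tree_family p a lev B).
Hypothesis pp : prime p.
Local Notation Om := (H -> F).
Local Notation R := ('F_p : comNzRingType).
Implicit Types (s t : seq Om) (c : seq Om -> R) (U : set F).
Local Notation sdom := (sdom B).
Local Notation hs := (hs a).
Local Notation stab := (stab a).
Local Notation setH := [set: H].
Local Notation ZS := (ZS a B).
Local Notation zc := (zc a lev B).

Section Relative.
Variables (S K : {group H}).
Hypothesis nSK : K \subset 'N(S).

Lemma ZS_act n k s : k \in K -> ZS S n s -> ZS S n (hs k s).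
Proof. by move=> kK; apply: (ZS_hs La TB); apply: (fintype.subsetP nSK). Qed.

Lemma zcD n c c' : zc S K n c -> zc S K n c' -> zc S K n (fun s => c s + c' s)%R.
Proof.
case=> u1 n1 f1 h1 s1 [u2 n2 f2 h2 s2]; split.
- exact: (ulcD La).
- by move=> *; rewrite n1 n2 addr0.
- by move=> *; rewrite f1 // f2.
- by move=> *; rewrite h1 // h2.
- by move=> *; rewrite s1 // s2 // addr0.
Qed.

Lemma zcN n c : zc S K n c -> zc S K n (fun s => - c s)%R.
Proof.
case=> [[U lU hU]] n1 f1 h1 s1; split.
- by exists U => // s t Ds Dt e; rewrite (hU s t).
- by move=> *; rewrite n1 oppr0.
- by move=> *; rewrite f1.
- by move=> *; rewrite h1.
- by move=> *; rewrite s1 // oppr0.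
Qed.

Lemma zc0 n : zc S K n (fun=> 0%R : R).
Proof. by split => //; have [U lU] := lev_has La; exists U. Qed.

Lemma zc_sum n (I : Type) (r : seq I) (c : I -> seq Om -> R) :
  (forall i, zc S K n (c i)) -> zc S K n (fun s => \sum_(i <- r) c i s)%R.
Proof.
move=> h; elim: r => [|i r IH].
  by have := zc0 n; congr zc; apply/funext => s; rewrite big_nil.
by have := zcD (h i) IH; congr zc; apply/funext => s; rewrite big_cons.
Qed.

Lemma sing_face s1 x s2 : ~~ (K :&: stab (s1 ++ x :: s2) \subset S) ->
  ~~ (K :&: stab (s1 ++ s2) \subset S).
Proof.
apply: contra; apply: fintype.subset_trans; exact: finset.setIS (stab_face _ _ _ _).
Qed.

Lemma zc_cobd n c : zc S K n c -> zc S K n.+1 (cobd c).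
Proof.
case=> [[U lU hU]] n1 f1 h1 s1; split.
- exists U => // s t Ds Dt e; apply: (eq_cobd2 e) => u1 x u2 t1 y t2 es et e1 e2.
  apply: hU; last exact: rel2_cat.
    by apply: (ZS_face (s1 := u1) (x := x)); rewrite -es.
  by apply: (ZS_face (s1 := t1) (x := y)); rewrite -et.
- exact: normalized_cobd.
- move=> f s D; rewrite -cobd_map; apply: eq_cobd => u1 x u2 es.
  by apply: f1; apply: (ZS_face (s1 := u1) (x := x)); rewrite -es.
- move=> f s fK D; rewrite -cobd_map; apply: eq_cobd => u1 x u2 es.
  by apply: h1 => //; apply: (ZS_face (s1 := u1) (x := x)); rewrite -es.
- move=> s D sg; rewrite -[RHS](cobd0 _ s); apply: eq_cobd => u1 x u2 es.
  apply: s1; first by apply: (ZS_face (s1 := u1) (x := x)); rewrite -es.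
  by apply: (sing_face (s1 := u1) (x := x)); rewrite -es.
Qed.

End Relative.

(** * One extension of index p: the operators [sigma - 1] and norm *)

Section Step.
Variables (S N K : {group H}) (chi : H -> 'F_p) (sigma : H).
Hypotheses (SN : S \subset N) (NK : N <| K) (nSK : K \subset 'N(S)).
Hypothesis chiM : {in K &, forall g h, chi (g * h)%g = chi g + chi h}%R.
Hypothesis chi0 : {in K, forall g, (chi g == 0%R) = (g \in N)}.
Hypotheses (sK : sigma \in K) (chis : chi sigma = 1%R).

Let sNK : N \subset K := normal_sub NK.
Let sSK : S \subset K := fintype.subset_trans SN sNK.
Let nSN : N \subset 'N(S) := fintype.subset_trans sNK nSK.

Lemma chi1 : chi 1 = 0%R.
Proof. by apply/eqP; rewrite chi0 ?group1. Qed.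

Lemma chiV g : g \in K -> chi g^-1 = (- chi g)%R.
Proof.
move=> gK; apply/eqP; rewrite -addr_eq0 -chiM ?groupV // mulVg chi1 //.
Qed.

Lemma chiX g n : g \in K -> chi (g ^+ n) = (chi g *+ n)%R.
Proof.
move=> gK; elim: n => [|n IH]; first by rewrite expg0 chi1 mulr0n.
by rewrite expgS chiM ?groupX // IH mulrS.
Qed.

Lemma chi_sigma (x : 'F_p) : chi (sigma ^+ x) = x.
Proof. by rewrite chiX // chis natr_Zp. Qed.

(** Since [N] has index [p] in [K], a stabilizer in [K] not contained in [N] maps onto [K / N]:
    these tuples play the role of the fixed points of [K / N]. *)
Definition fx s := ~~ (K :&: stab s \subset N).

Lemma singE s : ~~ (K :&: stab s \subset S) = ~~ (N :&: stab s \subset S) || fx s.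
Proof.
rewrite /fx -negb_and; congr negb; apply/idP/andP => [h|[h1 h2]].
  split; last exact: fintype.subset_trans SN.
  exact: fintype.subset_trans (finset.setSI _ sNK) h.
apply: fintype.subset_trans h1; rewrite finset.subsetI h2; exact: finset.subsetIr.
Qed.

Lemma fx_face s1 x s2 : fx (s1 ++ x :: s2) -> fx (s1 ++ s2).
Proof. exact: sing_face. Qed.

Lemma fx_hs k s : k \in K -> fx s -> fx (hs k s).
Proof.
move=> kK /subsetPn [g]; rewrite inE => /andP [gK gs] gN.
apply/subsetPn; exists (g ^ k^-1).
  by rewrite inE (mem_stab_hs La) conjgKV gs groupJ ?groupV.
by rewrite memJ_norm // (fintype.subsetP (normal_norm NK)) ?groupV.
Qed.

Lemma sing_hs k s : k \in K -> ~~ (N :&: stab s \subset S) ->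
  ~~ (N :&: stab (hs k s) \subset S).
Proof.
move=> kK /subsetPn [g]; rewrite inE => /andP [gN gs] gS.
apply/subsetPn; exists (g ^ k^-1).
  rewrite inE (mem_stab_hs La) conjgKV gs memJ_norm ?gN //.
  by rewrite (fintype.subsetP (normal_norm NK)) ?groupV.
by rewrite memJ_norm // (fintype.subsetP nSK) ?groupV.
Qed.

Section Degree.
Variable n : nat.

Lemma hs_chi c g h s : zc S N n c -> g \in K -> h \in K -> chi g = chi h ->
  ZS S n s -> c (hs g s) = c (hs h s).
Proof.
move=> zcc gK hK e D; rewrite -[g](mulgKV h) (hsM La) (zc_hs zcc) //.
  by rewrite -chi0 ?groupM ?groupV // chiM ?groupV // chiV // e subrr.
exact: (ZS_act nSK).
Qed.

Lemma zc_shift c g : zc S N n c -> g \in K -> zc S N n (fun s => c (hs g s)).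
Proof.
case=> [[U lU hU]] n1 f1 h1 s1 gK; split.
- exists U => // s t Ds Dt e; apply: hU; try exact: (ZS_act nSK).
  exact: (eqs_hs La).
- by move=> u1 x u2; rewrite /hs map_cat; apply: n1.
- by move=> f s D; rewrite (hs_fs La) f1 //; apply: (ZS_act nSK).
- move=> k s kN D; rewrite -(hsM La) conjgCV (hsM La) h1 //; last exact: (ZS_act nSK).
  by rewrite memJ_norm // (fintype.subsetP (normal_norm NK)) ?groupV.
- by move=> s D sg; rewrite s1 //; [apply: (ZS_act nSK) | apply: sing_hs].
Qed.

(** Some power of a stabilizing element outside [N] has the same character as [g], and by [hs_chi]
    the cochain [c] sees only this character. *)
Lemma fx_inv c s g : zc S N n c -> ZS S n s -> fx s -> g \in K -> c (hs g s) = c s.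
Proof.
move=> zcc D /subsetPn [k]; rewrite inE => /andP [kK ks] kN gK.
have k0 : chi k != 0%R by rewrite chi0.
pose j : 'F_p := (chi g / chi k)%R.
rewrite (@hs_chi _ _ (k ^+ j)) ?groupX //; last first.
  by rewrite chiX // -mulr_natr natr_Zp mulrC divfK.
have /stabP [f ->] : k ^+ j \in stab s by apply: (groupX (G := stab_group La s)).
exact: (zc_fs zcc).
Qed.

(** [tau] is the action of [sigma - 1] and [tr] that of the norm element of the group ring of
    [K / N]. *)
Definition tau c s := (c (hs sigma s) - c s)%R.
Definition tr c s := (\sum_(x : 'F_p) c (hs (sigma ^+ x) s))%R.

Lemma tau_zc c : zc S N n c -> zc S N n (tau c).
Proof. by move=> zcc; apply: zcD (zc_shift zcc sK) (zcN zcc). Qed.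

Lemma tau_fx c s : zc S N n c -> ZS S n s -> fx s -> tau c s = 0%R.
Proof. by move=> zcc D f; rewrite /tau fx_inv // subrr. Qed.

Lemma tr_hs c g s : zc S N n c -> g \in K -> ZS S n s -> tr c (hs g s) = tr c s.
Proof.
move=> zcc gK D; rewrite /tr (reindex_inj (addIr (- chi g)%R)).
apply: eq_bigr => x _; rewrite -(hsM La); apply: hs_chi; rewrite ?groupM ?groupX //.
by rewrite chiM ?groupX // !chi_sigma subrK.
Qed.

Lemma tr_fx c s : zc S N n c -> ZS S n s -> fx s -> tr c s = 0%R.
Proof.
move=> zcc D f; rewrite /tr (eq_bigr (fun=> c s)).
  by rewrite sumr_const card_Fp // -mulr_natr pchar_Fp_0 // mulr0.
by move=> x _; apply: fx_inv; rewrite ?groupX.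
Qed.

Lemma tr_zc c : zc S N n c -> zc S K n (tr c).
Proof.
move=> zcc; have [u1 n1 f1 _ s1] : zc S N n (tr c).
  by apply: zc_sum => x; apply: zc_shift; rewrite ?groupX.
split => //; first by move=> k s kK D; apply: tr_hs.
by move=> s D; rewrite singE => /orP [|]; [apply: s1 | apply: tr_fx].
Qed.

Lemma zc_sub c : zc S K n c -> zc S N n c.
Proof.
case=> u1 n1 f1 h1 s1; split => //.
  by move=> k s /(fintype.subsetP sNK); apply: h1.
by move=> s D sg; apply: s1 => //; rewrite singE sg.
Qed.

Lemma zc_fx c s : zc S K n c -> ZS S n s -> fx s -> c s = 0%R.
Proof. by move=> zcc D f; apply: (zc_sing zcc) => //; rewrite singE f orbT. Qed.

(** Cut [c] off to the tuples where it already is [K]-invariant: this locus is decided modulo a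
    level, stable under [K], and contains [fx] by [fx_inv]. *)
Lemma inv_lift c : zc S N n c -> exists d, [/\ zc S N n d,
  forall s, ZS S n s -> fx s -> d s = c s &
  forall g s, g \in K -> ZS S n s -> d (hs g s) = d s].
Proof.
move=> zcc; pose P s := [forall g in K, c (hs g s) == c s].
have PK g s : g \in K -> P s -> P (hs g s).
  move=> gK /forall_inP h; apply/forall_inP => k kK.
  by rewrite -(hsM La) (eqP (h _ _)) ?groupM // (eqP (h _ _)).
have PK' g s : g \in K -> P (hs g s) = P s.
  move=> gK; apply/idP/idP; last exact: PK.
  by move/(PK g^-1); rewrite groupV (hsK La); apply.
pose d s := if P s then c s else 0%R.
have dK g s : g \in K -> ZS S n s -> d (hs g s) = d s.
  move=> gK D; rewrite /d PK' //; case: ifP => // /forall_inP h.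
  by rewrite (eqP (h _ _)).
exists d; split => //.
- have [[U lU hU] n1 f1 h1 s1] := zcc; split.
  + exists U => // s t Ds Dt e; rewrite /d (hU s t) //; congr (if _ then _ else _).
    apply: eq_forallb_in => g gK; rewrite (hU s t) // (hU (hs g s) (hs g t)) //;
      by [apply: (ZS_act nSK) | apply: (eqs_hs La)].
  + by move=> *; rewrite /d n1 if_same.
  + move=> f s D; rewrite /d f1 //; congr (if _ then _ else _).
    apply: eq_forallb_in => g gK; rewrite (hs_fs La) !f1 //; exact: (ZS_act nSK).
  + by move=> k s /(fintype.subsetP sNK) kK; apply: dK.
  + by move=> s D sg; rewrite /d s1 // if_same.
- move=> s D f; rewrite /d ifT //; apply/forall_inP => g gK; apply/eqP.
  exact: fx_inv.
Qed.

Definition supp c s := ZS S n s /\ exists2 g, g \in K & c (hs g s) <> 0%R.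

Lemma supp_hs c g s : g \in K -> supp c s -> supp c (hs g s).
Proof.
move=> gK [D [k kK nk]]; split; first exact: (ZS_act nSK).
by exists (k * g^-1); rewrite ?groupM ?groupV // (hsM La) (hsK La).
Qed.

(* A locally constant choice of a representative in each [K]-orbit in the
   support of [c]; [idx s] is the class of the group element leading to it. *)
Lemma orbit_index c : zc S N n c ->
  (forall s, ZS S n s -> fx s -> c s = 0%R) ->
  exists idx : seq Om -> 'F_p,
   [/\ exists2 U, lev U & forall s t, supp c s -> ZS S n t -> eqs U setH s t ->
         supp c t /\ idx s = idx t,
       forall s f, supp c s -> idx (fs f s) = idx s
     & forall s g, g \in K -> supp c s -> idx (hs g s) = (idx s - chi g)%R].
Proof.
move=> zcc cfx.
have [V lV hV] := zc_ulc zcc.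
have [|W lW hW] := zc_free La TB (K := K) (zc_ulc zcc).
  by move=> s D; rewrite singE => /orP [|]; [apply: (zc_sing zcc) | apply: cfx].
have [U lU sU] := lev_cap La lV lW.
pose near g f s t := eqs U setH (hs g (fs f s)) t.
pose O s : set (seq Om) := fun t => exists g f, g \in K /\ near g f s t.
have O_hs g s : g \in K -> O (hs g s) = O s.
  move=> gK; apply/seteqP; split=> t [k [f [kK e]]].
    exists (k * g), (a g^-1 f); split; first exact: groupM.
    by rewrite /near (hsM La) (hs_fs La g) (lactKV La).
  exists (k * g^-1), (a g f); split; first by rewrite groupM ?groupV.
  by rewrite /near (hsM La) (hs_fs La g^-1) (lactK La) (hsK La).
have O_fs f s : O (fs f s) = O s.
  apply/seteqP; split=> t [k [f' [kK e]]].
    by exists k, (f' * f); split => //; rewrite /near (fsM f').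
  by exists k, (f' * f^-1); split => //; rewrite /near (fsM f') fsK.
have O_near s t : eqs U setH s t -> O s = O t.
  move=> e; apply/seteqP; split=> u [k [f [kK e']]]; exists k, f; split => //.
    apply: (eqs_trans La lU _ e'); apply: (eqs_hs La) => //; apply: (eqs_fs La) => //.
    exact: (eqs_sym La).
  by apply: (eqs_trans La lU _ e'); apply: (eqs_hs La) => //; apply: (eqs_fs La).
(* The choice depends on [s] only through the set [O s], so it is the same along an orbit of [K] and
   [F] and for tuples equal modulo [U]. *)
pose r s := xget [::] (O s).
have rP s : O s (r s).
  rewrite /r; case: xgetP => [t _ //|no]; case: (no s).
  by exists 1, 1; split => //; rewrite /near fs1 (hs1 La); apply: (eqs_refl La).
pose G s : set H := fun g => g \in K /\ exists f, near g f s (r s).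
pose idx s := chi (xget 1 (G s)).
have idxE s g f : supp c s -> g \in K -> near g f s (r s) -> idx s = chi g.
  move=> [D [k kK nk]] gK e; rewrite /idx; case: xgetP => [h _ [hK [f' e']]|no]; last first.
    by case: (no g); split => //; exists f.
  have e2 : eqs U setH (hs h (fs f' s)) (hs g (fs f s)).
    exact: (eqs_trans La lU e' (eqs_sym La lU e)).
  have := eqs_hs La (k * g^-1) lU e2; rewrite -(hsM La) (hs_fs La (k * g^-1 * h)).
  rewrite -(hsM La) mulgVK (hs_fs La k).
  move/(eqs_fs La (a (k * g^-1 * h) f')^-1 lU); rewrite fsK -fsM.
  rewrite -[s in eqs _ _ (hs _ s)](hsK La k) -(hsM La) => e3.
  (* Two elements leading from [s] to the representative differ, after translation by [k] into the
     support of [c], by an approximate stabilizer; by [zc_free] it lies in [S], where [chi]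
     vanishes. *)
  have qS : k * g^-1 * h * k^-1 \in S.
    apply: (hW (hs k s)) => //; first exact: (ZS_act nSK).
      by rewrite !groupM ?groupV.
    by apply: eqs_sub e3 => // x /sU [].
  have /eqP : chi (k * g^-1 * h * k^-1) == 0%R.
    by rewrite chi0 ?(fintype.subsetP SN) // !groupM ?groupV.
  rewrite !chiM ?groupM ?groupV // !chiV // => e4.
  by apply/eqP; rewrite -subr_eq0 -[X in _ == X]e4; apply/eqP; ring.
exists idx; split.
- exists U => // s t [D [k kK nk]] Dt e.
  have st : supp c t.
    split => //; exists k => // z; apply: nk; rewrite -z; apply: hV.
    + exact: (ZS_act nSK).
    + exact: (ZS_act nSK).
    + by apply: (eqs_hs La) => //; apply: eqs_sub e => // x /sU [].
  split => //; have [g [f [gK e']]] := rP t.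
  rewrite (idxE t g f) // (idxE s g f) //; first by split => //; exists k.
  rewrite /r (O_near _ _ e) -/(r t) /near.
  by apply: (eqs_trans La lU _ e'); apply: (eqs_hs La) => //; apply: (eqs_fs La).
- move=> s f st; have [g [f' [gK e']]] := rP s.
  have st' : supp c (fs f s).
    have [D [k kK nk]] := st; split; first exact: (ZS_fs La).
    exists k => //; rewrite (hs_fs La) (zc_fs zcc) //; exact: (ZS_act nSK).
  rewrite (idxE s g f') // (idxE _ g (f' * f^-1)) //.
  by rewrite /near /r O_fs fsM fsK.
- move=> s g gK st; have [k [f [kK e]]] := rP s.
  rewrite (idxE s k f) // (idxE _ (k * g^-1) (a g f)) ?groupM ?groupV //.
  + by rewrite chiM ?groupV // chiV.
  + exact: supp_hs.
  + by rewrite /near /r O_hs // (hsM La) (hs_fs La g^-1) (lactK La) (hsK La).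
Qed.

Lemma supp_out c s g : ZS S n s -> ~ supp c s -> g \in K -> c (hs g s) = 0%R.
Proof. by move=> D ns gK; apply: contrapT => ng; apply: ns; split => //; exists g. Qed.

Lemma supp_in c s : ZS S n s -> c s <> 0%R -> supp c s.
Proof. by move=> D nc; split => //; exists 1 => //; rewrite (hs1 La). Qed.

(** Restrict [c] to the fundamental domain where the index is zero: among the translates of [s] by
    powers of [sigma] exactly one lies there, the one with exponent [idx s]. *)
Lemma trace_lift c : zc S K n c -> exists d, [/\ zc S N n d,
  forall s, ZS S n s -> fx s -> d s = 0%R & forall s, ZS S n s -> tr d s = c s].
Proof.
move=> zcK; have zcc := zc_sub zcK.
have [|idx [[V lV hV] ifs ihs]] := orbit_index zcc.
  by move=> s; apply: (zc_fx zcK).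
have [u1 n1 f1 h1 s1] := zcc; have [U lU hU] := u1.
have [W lW sW] := lev_cap La lU lV.
pose d s := if idx s == 0%R then c s else 0%R.
exists d; split.
- split.
  + exists W => // s t Ds Dt e; rewrite /d.
    have <- : c s = c t by apply: hU => //; apply: eqs_sub e => // x /sW [].
    have [->|nc] := eqVneq (c s) 0%R; first by rewrite !if_same.
    have eV : eqs V setH s t by apply: eqs_sub e => // x /sW [].
    by have [_ ->] := hV s t (supp_in Ds (elimN eqP nc)) Dt eV.
  + by move=> *; rewrite /d n1 if_same.
  + move=> f s D; rewrite /d f1 //.
    have [->|nc] := eqVneq (c s) 0%R; first by rewrite !if_same.
    by rewrite ifs //; apply: supp_in => //; apply/eqP.
  + move=> k s kN D; have kK := fintype.subsetP sNK _ kN; rewrite /d h1 //.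
    have [->|nc] := eqVneq (c s) 0%R; first by rewrite !if_same.
    rewrite ihs //; last by apply: supp_in => //; apply/eqP.
    suff -> : chi k = 0%R by rewrite subr0.
    by apply/eqP; rewrite chi0.
  + by move=> s D sg; rewrite /d s1 // if_same.
- by move=> s D f; rewrite /d (zc_fx zcK) // if_same.
- move=> s D; rewrite /tr /d.
  have [c0|nc] := eqVneq (c s) 0%R.
    rewrite c0 big1 // => x _; rewrite (zc_hs zcK) ?groupX //.
    by rewrite c0 if_same.
  have st : supp c s by apply: supp_in => //; apply/eqP.
  rewrite (bigD1 (idx s)) //= big1 ?addr0.
    by rewrite ihs ?groupX // chi_sigma subrr eqxx (zc_hs zcK) ?groupX.
  move=> x nx; rewrite ihs ?groupX // chi_sigma subr_eq0 eq_sym (negPf nx) //.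
Qed.

(** An additive Hilbert 90: up to sign, [d] is the partial sum of [c] along the orbit up to the
    representative, so that [tau] telescopes; the vanishing trace closes the cycle where the index
    jumps from 0 to [p - 1]. *)
Lemma tau_lift c : zc S N n c -> (forall s, ZS S n s -> fx s -> c s = 0%R) ->
  (forall s, ZS S n s -> tr c s = 0%R) ->
  exists d, [/\ zc S N n d, forall s, ZS S n s -> fx s -> d s = 0%R
    & forall s, ZS S n s -> tau d s = c s].
Proof.
move=> zcc cfx tr0; have [idx [[V lV hV] ifs ihs]] := orbit_index zcc cfx.
have [u1 n1 f1 h1 s1] := zcc; have [U lU hU] := u1.
have [W lW sW] := lev_cap La lU lV.
pose d s := (- \sum_(j < (idx s : nat)) c (hs (sigma ^+ j) s))%R.
have d0 s : ZS S n s -> ~ supp c s -> d s = 0%R.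
  by move=> D ns; rewrite /d big1 ?oppr0 // => j _; apply: supp_out; rewrite ?groupX.
exists d; split.
- split.
  + exists W => // s t Ds Dt e.
    have eU : eqs U setH s t by apply: eqs_sub e => // x /sW [].
    have eV : eqs V setH s t by apply: eqs_sub e => // x /sW [].
    have [st|ns] := pselect (supp c s); last first.
      rewrite !d0 // => st; apply: ns.
      by have [] := hV t s st Ds (eqs_sym La lV eV).
    have [_ ei] := hV s t st Dt eV; rewrite /d ei; congr (- _)%R.
    apply: eq_bigr => j _; apply: hU; try by apply: (ZS_act nSK); rewrite ?groupX.
    exact: (eqs_hs La).
  + move=> u1' x u2; rewrite /d big1 ?oppr0 // => j _.
    by rewrite /hs map_cat; apply: n1.
  + move=> f s D; have [st|ns] := pselect (supp c s); last first.
      rewrite !d0 //; first exact: (ZS_fs La).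
      move=> [_ [g gK ng]]; apply: ns; split => //; exists g => //.
      by move=> z; apply: ng; rewrite (hs_fs La) f1 //; apply: (ZS_act nSK).
    rewrite /d ifs //; congr (- _)%R; apply: eq_bigr => j _.
    by rewrite (hs_fs La) f1 //; apply: (ZS_act nSK); rewrite ?groupX.
  + move=> k s kN D; have kK := fintype.subsetP sNK _ kN.
    have [st|ns] := pselect (supp c s); last first.
      rewrite !d0 //; first exact: (ZS_act nSK).
      by move=> /(supp_hs (groupVr kK)); rewrite (hsK La).
    have k0 : chi k = 0%R by apply/eqP; rewrite chi0.
    rewrite /d ihs // k0 subr0; congr (- _)%R; apply: eq_bigr => j _.
    rewrite -(hsM La); apply: hs_chi; rewrite ?groupM ?groupX //.
    by rewrite chiM ?groupX // k0 addr0.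
  + move=> s D sg; rewrite /d big1 ?oppr0 // => j _.
    by rewrite s1 //; [apply: (ZS_act nSK) | apply: sing_hs]; rewrite ?groupX.
- move=> s D f; rewrite /d big1 ?oppr0 // => j _.
  by apply: cfx; [apply: (ZS_act nSK) | apply: fx_hs]; rewrite ?groupX.
- move=> s D; rewrite /tau.
  have [st|ns] := pselect (supp c s); last first.
    rewrite !d0 ?subrr //; last by move=> /(supp_hs (groupVr sK)); rewrite (hsK La).
      by rewrite -[s in RHS](hs1 La) supp_out ?subrr.
    exact: (ZS_act nSK).
  rewrite /d ihs // chis.
  have e (j : nat) : c (hs (sigma ^+ j) (hs sigma s)) = c (hs (sigma ^+ j.+1) s).
    by rewrite -(hsM La) expgSr.
  under eq_bigr => j _ do rewrite e.
  have pE : (Zp_trunc (pdiv p)).+2 = p by apply: Fp_cast.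
  move: (idx s) => x; have [x0|x0] := posnP (x : nat); last first.
    have xi : (x : nat) = (x : nat).-1.+1 by rewrite prednK.
    have ip : ((x : nat).-1 < p)%N by rewrite -[X in (_ < X)%N]pE (leq_ltn_trans (leq_pred _)).
    have -> : (x - 1)%R = ((x : nat).-1)%:R%R :> 'F_p.
      by rewrite -[x in LHS]natr_Zp {1}xi -natr1 addrK.
    rewrite val_Fp_nat // modn_small // [in X in (_ - X)%R]xi big_ord_recl expg0 (hs1 La).
    by rewrite opprK addrCA addNr addr0.
  have -> : (x - 1)%R = (p.-1)%:R%R :> 'F_p.
    have -> : x = 0%R by apply: val_inj.
    by apply/eqP; rewrite subr_eq natr1 prednK ?prime_gt0 // pchar_Fp_0.
  rewrite val_Fp_nat // modn_small ?prednK ?prime_gt0 // x0 big_ord0 oppr0 subr0.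
  have := tr0 s D; rewrite /tr.
  have -> : (\sum_(x : 'F_p) c (hs (sigma ^+ x) s) =
      \sum_(j < p.-1.+1) c (hs (sigma ^+ j) s))%R.
    have gen m : m = p.-1.+1 -> (\sum_(x < m) c (hs (sigma ^+ x) s) =
        \sum_(j < p.-1.+1) c (hs (sigma ^+ j) s))%R by move->.
    by apply: gen; rewrite pE prednK // prime_gt0.
  by rewrite big_ord_recl expg0 (hs1 La) => /eqP; rewrite addr_eq0 => /eqP ->.
Qed.

End Degree.
(** Above the dimension [#|H|] of the product of trees every simplex is degenerate. *)
Lemma zc_large T n c s : zc S T n c -> (#|H|.+1 < n)%N -> ZS S n s -> c s = 0%R.
Proof.
move=> zcc hn [[X sz] _].
have [|s1 [x [s2 ->]]] := simplex_dup_exists X; first by rewrite sz.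
exact: (zc_normalized zcc).
Qed.

Lemma cobd_shift c g s : cobd (fun u => c (hs g u)) s = cobd c (hs g s).
Proof. exact: cobd_map. Qed.

Lemma cobd_tau c s : cobd (tau c) s = tau (cobd c) s.
Proof. by rewrite /tau cobdB cobd_shift. Qed.

Lemma cobd_tr c s : cobd (tr c) s = tr (cobd c) s.
Proof. by rewrite /tr cobd_sum; apply: eq_bigr => x _; rewrite cobd_shift. Qed.

Lemma eq_cobd_ZS n c c' s : (forall u, ZS S n u -> c u = c' u) -> ZS S n.+1 s ->
  cobd c s = cobd c' s.
Proof.
move=> e D; apply: eq_cobd => s1 x s2 es; apply: e.
by apply: (ZS_face (s1 := s1) (x := x)); rewrite -es.
Qed.

Lemma eq_cobd_fx n c c' s : (forall u, ZS S n u -> fx u -> c u = c' u) ->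
  ZS S n.+1 s -> fx s -> cobd c s = cobd c' s.
Proof.
move=> e D f; apply: eq_cobd => s1 x s2 es; apply: e.
  by apply: (ZS_face (s1 := s1) (x := x)); rewrite -es.
by apply: (fx_face (s1 := s1) (x := x)); rewrite -es.
Qed.

Hypothesis VN : acyclic_zc p a lev B S N.

(* Smith theory: the exact sequences
   [0 -> Ker tr -> C -> Im tr + C|fx -> 0] and
   [0 -> Im tr -> C -> Ker tr + C|fx -> 0] propagate vanishing of cohomology
   downwards from the degrees above the dimension. *)
Lemma smith d m : (#|H|.+1 < m.+3 + d)%N ->
  (forall i f : seq Om -> R, zc S K m.+3 i -> (forall s, ZS S m.+4 s -> cobd i s = 0%R) ->
     zc S N m.+3 f -> (forall s, ZS S m.+4 s -> fx s -> cobd f s = 0%R) ->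
     exists i' f', [/\ zc S K m.+2 i', zc S N m.+2 f',
       forall s, ZS S m.+3 s -> i s = cobd i' s
     & forall s, ZS S m.+3 s -> fx s -> f s = cobd f' s]) /\
  (forall j : seq Om -> R, zc S N m.+3 j -> (forall s, ZS S m.+3 s -> fx s -> j s = 0%R) ->
     (forall s, ZS S m.+3 s -> tr j s = 0%R) ->
     (forall s, ZS S m.+4 s -> cobd j s = 0%R) ->
     exists j', [/\ zc S N m.+2 j', forall s, ZS S m.+2 s -> fx s -> j' s = 0%R,
       forall s, ZS S m.+2 s -> tr j' s = 0%R
     & forall s, ZS S m.+3 s -> j s = cobd j' s]).
Proof.
(* [d] measures the descent from above the dimension: for [d = 0] lists of length [m.+3] are longer
   than [#|H|.+1], and all cochains vanish. *)
elim: d m => [|d IH] m hd.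
  rewrite addn0 in hd; split.
    move=> i f zi _ zf _; exists (fun=> 0%R), (fun=> 0%R); split.
    - exact: zc0.
    - exact: zc0.
    - by move=> s D; rewrite cobd0 (zc_large zi).
    - by move=> s D _; rewrite cobd0 (zc_large zf).
  move=> j zj _ _ _; exists (fun=> 0%R); split => //.
  - exact: zc0.
  - by move=> s _; rewrite /tr big1.
  - by move=> s D; rewrite cobd0 (zc_large zj).
have [IHA IHB] : _ /\ _ := IH m.+1 (ltac:(by rewrite addSnnS)).
split.
- move=> i f zi di zf df.
  have [c1 [zc1 c1f c1K]] := inv_lift zf.
  have [c2 [zc2 c2f c2t]] := trace_lift zi.
  (* [c] has trace [i] and restricts to [f] on the fixed part, so its coboundary vanishes there and
     has trace zero: the second half applies to it one degree higher. *)
  pose c s := (c1 s + c2 s)%R.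
  have zcc : zc S N m.+3 c by apply: zcD.
  have trc s : ZS S m.+3 s -> tr c s = i s.
    move=> D; rewrite /tr /c big_split /=; rewrite -/(tr c2 s) c2t //.
    rewrite (eq_bigr (fun=> c1 s)); last by move=> x _; rewrite c1K ?groupX.
    by rewrite sumr_const card_Fp // -mulr_natr pchar_Fp_0 // mulr0 add0r.
  have cf s : ZS S m.+3 s -> fx s -> c s = f s.
    by move=> D fs; rewrite /c c1f // c2f // addr0.
  have [|s D fs|s D|s D|j [zj jf jt dj]] := IHB (cobd c).
  + exact: zc_cobd.
  + by rewrite (eq_cobd_fx cf D fs) df.
  + by rewrite -cobd_tr (eq_cobd_ZS trc D) di.
  + exact: cobdK.
  have zcj : zc S N m.+3 (fun s => c s - j s)%R by apply: zcD => //; apply: zcN.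
  have [|e ze de] := VN zcj.
    by move=> s D; rewrite cobdB dj // subrr.
  exists (tr e), e; split => //.
  + exact: (tr_zc ze).
  + move=> s D; rewrite cobd_tr -trc // -[LHS]subr0 -(jt s D) /tr -sumrB.
    by apply: eq_bigr => x _; rewrite de //; apply: (ZS_act nSK); rewrite ?groupX.
  + by move=> s D f'; rewrite -de // jf // subr0 cf.
- move=> j zj jf jt dj.
  have [c [zcc cfx tc]] := tau_lift zj jf jt.
  (* [tau (cobd c)] is [cobd j], which vanishes; thus [cobd c] is invariant under [sigma], hence
     under [K], and the first half applies to it one degree higher. *)
  have zdc : zc S K m.+4 (cobd c).
    have [u1 n1 f1 _ s1] := zc_cobd zcc; split => //.
      suff hsig s : ZS S m.+4 s -> cobd c (hs sigma s) = cobd c s.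
        have hX s n : ZS S m.+4 s -> cobd c (hs (sigma ^+ n) s) = cobd c s.
          move=> D; elim: n => [|n IHn]; first by rewrite expg0 (hs1 La).
          by rewrite expgS (hsM La) hsig //; apply: (ZS_act nSK); rewrite ?groupX.
        move=> k s kK D; rewrite (hs_chi (h := sigma ^+ chi k) (zc_cobd zcc)) ?groupX //.
          exact: hX.
        by rewrite chi_sigma.
      move=> D; apply/eqP; rewrite -subr_eq0; apply/eqP.
      by rewrite -[LHS]/(tau (cobd c) s) -cobd_tau (eq_cobd_ZS tc D) dj.
    move=> s D; rewrite singE => /orP [|f]; first exact: s1.
    by rewrite (eq_cobd_fx cfx D f) cobd0.
  have [|||i' [_ [zi _ di _]]] := IHA _ (fun=> 0%R) zdc.
  + by move=> s D; apply: cobdK.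
  + exact: zc0.
  + by move=> s _ _; rewrite cobd0.
  have zci : zc S N m.+3 (fun s => c s - i' s)%R.
    by apply: zcD => //; apply: zcN; apply: zc_sub.
  have [|e ze de] := VN zci.
    by move=> s D; rewrite cobdB di // subrr.
  exists (tau e); split.
  + exact: (tau_zc ze).
  + by move=> s D f; exact: (tau_fx ze D f).
  + move=> s D; rewrite /tr /tau.
    rewrite (eq_bigr (fun x : 'F_p => e (hs (sigma ^+ x) (hs sigma s)) - e (hs (sigma ^+ x) s)))%R.
      by rewrite sumrB -!/(tr e _) (tr_hs ze) // subrr.
    by move=> x _; rewrite -!(hsM La) -expgS -expgSr.
  + move=> s D; rewrite cobd_tau /tau -!de //; last exact: (ZS_act nSK).
    by rewrite (zc_hs zi) // -tc // /tau; ring.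
Qed.

Lemma acyclic_quotient : acyclic_zc p a lev B S K.
Proof.
move=> m c zcc dc; have [|A _] := @smith #|H|.+2 m; first by rewrite !addnS !ltnS leq_addl.
have [|s|i' [_ [zi _ di _]]] := A c (fun=> 0%R) zcc dc.
- exact: zc0.
- by rewrite cobd0.
by exists i'.
Qed.

End Step.
End Smith.

(** * Extension from fixed complexes and induction along p-groups *)

Section Extension.
Variables (p : nat) (H : finGroupType) (F : groupType) (a : H -> F -> F).
Variables (lev : set (set F)) (B : H -> set F).
Hypotheses (La : leveled_action a lev) (TB : tree_family p a lev B).
Hypothesis pp : prime p.
Local Notation Om := (H -> F).
Local Notation R := ('F_p : comNzRingType).
Implicit Types (s t : seq Om) (c q : seq Om -> R) (U : set F) (S K L : {group H}).
Local Notation sdom := (sdom B).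
Local Notation hs := (hs a).
Local Notation stab := (stab a).
Local Notation setH := [set: H].
Local Notation ZS := (ZS a B).
Local Notation zc := (zc a lev B).

Lemma lev_all (I : finType) (P : set F -> I -> Prop) :
  (forall U V i, lev U -> lev V -> (forall x, U x -> V x) -> P V i -> P U i) ->
  (forall i, exists2 U, lev U & P U i) ->
  exists2 U, lev U & forall i, P U i.
Proof.
move=> mono ex.
suff [W lW hW] : exists2 W, lev W & forall i, i \in enum I -> P W i.
  by exists W => // i; apply: hW; rewrite mem_enum.
elim: (enum I) => [|i s [W lW IH]]; first by have [U lU] := lev_has La; exists U.
have [U lU hU] := ex i; have [V lV sV] := lev_cap La lU lW.
exists V => // j; rewrite in_cons => /orP [/eqP ->|/IH h].
  by apply: (mono V U) hU => // x /sV [].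
by apply: (mono V W) h => // x /sV [].
Qed.

Lemma ZS_dup S n s1 x s2 : ZS S n (s1 ++ x :: s2) -> ZS S n.+1 (s1 ++ x :: x :: s2).
Proof.
move=> [[X sz] st]; split; first split; first exact: simplex_dup.
  by rewrite -sz !size_cat /= !addnS.
apply: fintype.subset_trans st _; apply/fintype.subsetP => h /stabP [f e].
apply/stabP; exists f; move: e; rewrite /hs /fs.
elim: s1 {X sz} => [|y s1 IH] /=; first by case=> -> ->.
by case=> -> /IH ->.
Qed.

(** A tuple receives the value of [q] at any tuple of the fixed complex that approximates one of its
    translates, and 0 if there is none. The hypothesis on [q] is the independence of the choice. *)
Lemma extension S L n q U : lev U ->
  (forall t t' g f, ZS S n t -> ZS S n t' -> g \in L ->
     eqs U setH (hs g t) (fs f t') -> q t = q t') ->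
  normalized q ->
  exists e, [/\ ulc lev (sdom setH n) setH e, normalized e,
    forall g f s, sdom setH n s -> g \in L -> e (fs f (hs g s)) = e s,
    forall s, ZS S n s -> e s = q s
  & forall s, sdom setH n s -> e s <> 0%R -> exists t g f,
      [/\ ZS S n t, g \in L, q t <> 0%R & eqs U setH (hs g s) (fs f t)]].
Proof.
move=> lU hq nq.
pose rl s t := ZS S n t /\ exists g f, g \in L /\ eqs U setH (hs g s) (fs f t).
pose e s := if pselect (exists t, rl s t) is left h then q (sval (cid h)) else 0%R.
have eE s t : rl s t -> e s = q t.
  rewrite /e => st; case: pselect => [h|[]]; last by exists t.
  case: cid => t' /= [D' [g' [f' [gL' e']]]]; case: st => D [g [f [gL et]]].
  apply: (hq _ _ (g * g'^-1) (a (g * g'^-1) f'^-1 * f)) => //.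
    by rewrite groupM ?groupV.
  rewrite -[t' in hs _ t'](fsK f') (hs_fs La) fsM.
  apply: (eqs_fs La) => //; apply: (eqs_trans La lU) et.
  rewrite -[X in eqs _ _ _ (hs _ X)](hsK La g') -(hsM La g).
  by apply: (eqs_hs La) => //; apply: (eqs_sym La).
have eN s : ~ (exists t, rl s t) -> e s = 0%R by rewrite /e; case: pselect.
have rl_act g f s t : g \in L -> rl s t -> rl (fs f (hs g s)) t.
  move=> gL [D [h [f' [hL et]]]]; split => //; exists (h * g^-1), (a (h * g^-1) f * f').
  rewrite groupM ?groupV //; split => //.
  by rewrite (hs_fs La) fsM -(hsM La _ g) mulgVK; apply: (eqs_fs La).
have rl_act' g f s t : g \in L -> rl (fs f (hs g s)) t -> rl s t.
  move=> gL /(@rl_act g^-1 (a g^-1 f^-1) _ _ (groupVr gL)).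
  by rewrite (hs_fs La) (hsK La) -fsM -(lactD La) mulVg (lact1r La) fs1.
have rl_near s s' t : eqs U setH s s' -> rl s t -> rl s' t.
  move=> es [D [g [f [gL et]]]]; split => //; exists g, f; split => //.
  by apply: (eqs_trans La lU) et; apply: (eqs_hs La) => //; apply: (eqs_sym La).
have eeq s s' : (forall t, rl s t <-> rl s' t) -> e s = e s'.
  move=> h; have [[t st]|no] := pselect (exists t, rl s t).
    by rewrite (eE s t) // (eE s' t) //; apply/h.
  by rewrite !eN // => -[t /h st]; apply: no; exists t.
exists (restr0 (sdom setH n) e); split.
- apply: ulc_restr0; exists U => // s t _ _ es; apply: eeq => u; split.
    exact: rl_near.
  by apply: rl_near; apply: (eqs_sym La).
- apply: normalized_restr0 => s1 x s2 D.
  have [[t st]|no] := pselect (exists t, rl (s1 ++ x :: x :: s2) t); last exact: eN.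
  rewrite (eE _ _ st); have [Dt [g [f [gL et]]]] := st.
  rewrite /hs map_cat /= in et; have [t1 [y [t2' [ht r1 ry]]]] := rel2_split et.
  case: t2' ht => [|y' t2] ht; first by case.
  move=> /= [ry' r2].
  have [u1 [z [u2' [tE t1E yE t2E]]]] := map_split ht.
  case: u2' tE t2E => [|z' u2] tE //= [y'E t2E].
  (* The approximating tuple [t] need not be degenerate, but its entries [z] and [z'] agree modulo
     [U]; replacing [z'] by [z] gives a degenerate tuple of the fixed complex with the same value of
     [q]. *)
  have Dz : ZS S n (u1 ++ z :: z :: u2).
    have : ZS S n.-1 (u1 ++ z :: u2).
      have n0 : n = n.-1.+1 by case: Dt => -[_ <-] _; rewrite tE size_cat /= addnS.
      have := Dt; rewrite tE {1}n0 -[z :: z' :: u2]/([:: z] ++ z' :: u2) catA.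
      by move/ZS_face; rewrite -catA.
    move/ZS_dup; rewrite prednK //.
    by case: Dt => -[_ <-] _; rewrite tE size_cat /= addnS.
  rewrite -(hq (u1 ++ z :: z :: u2) t 1 1) ?nq // (hs1 La) fs1 tE.
  apply: rel2_cat; first exact: (eqs_refl La).
  split; first by move=> k _; apply: (eqm_refl La).
  split; last exact: (eqs_refl La).
  move=> k kH; have := ry k kH; have := ry' k kH; rewrite y'E yE /lmul => e1 e2.
  have := eqm_trans La lU (eqm_sym La lU e2) e1.
  by rewrite /eqm invgM mulgA mulgVK.
- move=> g f s D gL; rewrite !restr0E //; last exact/dom_lmul/(dom_hs La TB).
  by apply: eeq => t; split; [apply: rl_act' | apply: rl_act].
- move=> s D; rewrite restr0E; last by case: D.
  apply: eE; split => //; exists 1, 1; split => //.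
  by rewrite (hs1 La) fs1; apply: (eqs_refl La).
- move=> s D; rewrite restr0E //.
  have [[t st]|no] := pselect (exists t, rl s t); last by rewrite eN.
  rewrite (eE _ _ st) => nq0; have [Dt [g [f [gL et]]]] := st.
  by exists t, g, f.
Qed.

Lemma zc_extend S K n c : S \subset K -> zc K K n c ->
  exists2 e, zc S S n e & forall s, ZS K n s -> e s = c s.
Proof.
move=> SK [[U lU hU] n1 f1 h1 s1].
have [|e [eu en ei ec _]] := @extension K 1%G n c U lU _ n1.
  move=> t t' g f D D' /set1P -> et; rewrite -(f1 f t') //; apply: hU => //.
    exact: (ZS_fs La).
  by rewrite (hs1 La) in et.
exists e => //; split => //.
- by case: eu => V lV hV; exists V => // s t [Ds _] [Dt _]; apply: hV.
- by move=> f s [D _]; have := ei 1 f s D (group1 _); rewrite (hs1 La).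
- move=> k s kS [D st]; have /stabP [f ->] := fintype.subsetP st _ kS.
  by have := ei 1 f s D (group1 _); rewrite (hs1 La).
- by move=> s _; rewrite finset.subsetIl.
Qed.

(** Take [N = S] in the Smith argument: the fixed part is then the fixed complex of [K], and a
    cocycle on it, extended to the fixed complex of [S], enters as [f] with [i = 0]. *)
Lemma acyclic_fixed S K : S \subset K -> S <| K -> #|K : S| = p ->
  acyclic_zc p a lev B S S -> acyclic_zc p a lev B K K.
Proof.
move=> SK nSK iSK VS m c zcc dc.
have [chi [chiM chi0 [sigma sK chis]]] := Fp_character pp nSK iSK.
have SN : K \subset 'N(S) := normal_norm nSK.
have [e ze ec] := zc_extend SK zcc.
have fxE s : ZS S m.+3 s \/ ZS S m.+4 s -> fx a S K s -> K \subset stab s.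
  move=> D; have St : S \subset stab s by case: D => -[].
  rewrite /fx => nst; have SI : S \subset K :&: stab s by rewrite finset.subsetI SK.
  have SL : S \subset K :&: stab_group La s by [].
  have ie := Lagrange_index (finset.subsetIl K (stab_group La s)) SL.
  have n1 : #|K :&: stab_group La s : S| != 1%N by rewrite indexg_eq1.
  have /eqP ip : #|K :&: stab_group La s : S| == p.
    by apply/eqP/(prime_nt_dvdP pp n1); rewrite -iSK -ie dvdn_mull.
  have : #|K : K :&: stab_group La s| == 1%N.
    by move: ie; rewrite ip iSK -[X in _ = X]mul1n => /eqP; rewrite eqn_pmul2r ?prime_gt0.
  by rewrite indexg_eq1 finset.subsetI => /andP [].
have [|A _] := @smith _ _ _ _ _ _ La TB pp S S K chi sigma (fintype.subxx _) nSK SN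
    chiM chi0 sK chis VS #|H|.+2 m; first by rewrite !addnS !ltnS leq_addl.
have fxK n s : ZS K n s -> ZS S n s /\ fx a S K s.
  move=> [D st]; split; first by split => //; apply: fintype.subset_trans st.
  rewrite /fx; apply/negP => h.
  have : #|K : S| == 1%N.
    by rewrite indexg_eq1; apply: fintype.subset_trans h; rewrite finset.subsetI fintype.subxx.
  by rewrite iSK => /eqP p1; have := pp; rewrite p1.
have [|s|s D f|_ [g [_ zg _ dg]]] := A (fun=> 0%R) e _ _ ze.
- exact: zc0.
- by rewrite cobd0.
- have Ks : K \subset stab s by apply: fxE f; right.
  have [D1 _] := D; rewrite -(dc s) //.
  apply: eq_cobd => s1 x s2 es; apply: ec.
  by apply: (ZS_face (s1 := s1) (x := x)); rewrite -es.
exists g; last first.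
  by move=> s D; have [D' f] := fxK _ _ D; rewrite -dg // ec.
case: zg => [[U lU hU] n1 f1 _ _]; split => //.
- exists U => // s t /fxK [Ds _] /fxK [Dt _]; exact: hU.
- by move=> f s /fxK [Ds _]; apply: f1.
- move=> k s kK Ds; have [D' _] := fxK _ _ Ds.
  by have /stabP [f ->] := fintype.subsetP Ds.2 _ kK; apply: f1.
- by move=> s _; rewrite finset.subsetIl.
Qed.

Lemma acyclic_trivial : acyclic_zc p a lev B 1 1.
Proof.
have ZS1 n s : ZS 1 n s <-> sdom setH n s.
  by split=> [[]|D] //; split => //; apply: (sub1G (stab_group La s)).
move=> m c [[U lU hU] n1 f1 h1 s1] dc.
have G : good lev B true setH m.+3 c.
  split => //; first by exists U => // s t Ds Dt; apply: hU; apply/ZS1.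
  by move=> _ f s D; apply: f1; apply/ZS1.
have [xi [[V lV hV] nx ix] e] : exists2 xi, good lev B true setH m.+2 xi &
    forall s, sdom setH m.+3 s -> c s = cobd xi s.
  by apply: (acyclic La TB (k0 := 1)) G _ => // s D; apply: dc; apply/ZS1.
exists xi; last by move=> s /ZS1; apply: e.
split => //.
- by exists V => // s t /ZS1 Ds /ZS1 Dt; apply: hV.
- by move=> f s /ZS1; apply: ix.
- by move=> k s /set1P -> _; rewrite (hs1 La).
- by move=> s _; rewrite finset.subsetIl.
Qed.

Hypothesis pH : p.-group setH.

(** A [p]-group is reached from the trivial group through maximal subgroups, each normal of index
    [p] in the next. *)
Lemma acyclic_diag S : acyclic_zc p a lev B S S.
Proof.
have [m] := ubnP #|S|; elim: m S => // m IH S; rewrite ltnS => cS.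
have pS : p.-group S by apply: pgroupS pH; apply: finset.subsetT.
have [S1|ntS] := eqVneq (S : {set H}) 1.
  have -> : S = 1%G by apply/val_inj.
  exact: acyclic_trivial.
have [e|[M maxM _]] := maximal_exists (sub1G S).
  by move: ntS; rewrite -e eqxx.
have MS := maxgroupp maxM; have sMS := proper_sub MS.
apply: (acyclic_fixed sMS (p_maximal_normal pS maxM) (p_maximal_index pS maxM)).
by apply: IH; apply: leq_trans cS; apply: proper_card.
Qed.

Lemma acyclic_pair S K : S \subset K -> K \subset 'N(S) -> acyclic_zc p a lev B S K.
Proof.
have [m] := ubnP #|K|; elim: m K => // m IH K; rewrite ltnS => cK SK nSK.
have pK : p.-group K by apply: pgroupS pH; apply: finset.subsetT.
have [e|[M maxM SM]] := maximal_exists SK.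
  have -> : K = S by apply/val_inj; rewrite /= e.
  exact: acyclic_diag.
have MK := maxgroupp maxM; have sMK := proper_sub MK.
have nMK := p_maximal_normal pK maxM.
have [chi [chiM chi0 [sigma sK chis]]] := Fp_character pp nMK (p_maximal_index pK maxM).
apply: (acyclic_quotient La TB pp SM nMK nSK chiM chi0 sK chis).
apply: IH => //; first by apply: leq_trans cK; apply: proper_card.
exact: fintype.subset_trans nSK.
Qed.

End Extension.

(** * Cohomology relative to a family of stabilizers *)

Section Relative.
Variables (p : nat) (H : finGroupType) (F : groupType) (a : H -> F -> F).
Variables (lev : set (set F)) (B : H -> set F).
Hypotheses (La : leveled_action a lev) (TB : tree_family p a lev B).
Hypotheses (pp : prime p) (pH : p.-group [set: H]).
Local Notation Om := (H -> F).
Local Notation R := ('F_p : comNzRingType).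
Implicit Types (s t : seq Om) (c q : seq Om -> R) (U : set F) (S K : {group H}).
Local Notation sdom := (sdom B).
Local Notation hs := (hs a).
Local Notation stab := (stab a).
Local Notation setH := [set: H].
Local Notation ZS := (ZS a B).
Local Notation zc := (zc a lev B).

Record uc (UU : {group H} -> bool) n c : Prop := Uc {
  uc_ulc : ulc lev (sdom setH n) setH c;
  uc_normalized : normalized c;
  uc_fs : forall f s, sdom setH n s -> c (fs f s) = c s;
  uc_hs : forall h s, sdom setH n s -> c (hs h s) = c s;
  uc_sing : forall s, sdom setH n s -> UU (stab_group La s) -> c s = 0%R
}.

Definition family (UU : {group H} -> bool) :=
  (forall S K, S \subset K -> UU S -> UU K) /\ (forall S h, UU (S :^ h)%G = UU S).

Lemma stab_hs h s : stab (hs h s) = stab s :^ h^-1.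
Proof.
by apply/setP => k; rewrite (mem_stab_hs La) mem_conjg invgK.
Qed.

Lemma sdom_face n s1 x s2 : sdom setH n.+1 (s1 ++ x :: s2) -> sdom setH n (s1 ++ s2).
Proof. exact: dom_face. Qed.

Lemma uc_cobd UU n c : family UU -> uc UU n c -> uc UU n.+1 (cobd c).
Proof.
move=> [up cj] [[U lU hU] n1 f1 h1 s1]; split.
- exists U => // s t Ds Dt e; apply: (eq_cobd2 e) => u1 x u2 t1 y t2 es et e1 e2.
  apply: hU; last exact: rel2_cat.
    by apply: (sdom_face (s1 := u1) (x := x)); rewrite -es.
  by apply: (sdom_face (s1 := t1) (x := y)); rewrite -et.
- exact: normalized_cobd.
- move=> f s D; rewrite -cobd_map; apply: eq_cobd => u1 x u2 es.
  by apply: f1; apply: (sdom_face (s1 := u1) (x := x)); rewrite -es.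
- move=> f s D; rewrite -cobd_map; apply: eq_cobd => u1 x u2 es.
  by apply: h1 => //; apply: (sdom_face (s1 := u1) (x := x)); rewrite -es.
- move=> s D us; rewrite -[RHS](cobd0 _ s); apply: eq_cobd => u1 x u2 es.
  apply: s1; first by apply: (sdom_face (s1 := u1) (x := x)); rewrite -es.
  by apply: up us; rewrite es; apply: (stab_face a u1 x u2).
Qed.

Lemma ucB UU n c c' : uc UU n c -> uc UU n c' -> uc UU n (fun s => c s - c' s)%R.
Proof.
case=> [[U lU hU] n1 f1 h1 s1] [[V lV hV] n2 f2 h2 s2]; split.
- have [W lW sW] := lev_cap La lU lV; exists W => // s t Ds Dt e.
  by rewrite (hU s t) ?(hV s t) //; apply: eqs_sub e => // x /sW [].
- by move=> *; rewrite n1 n2 subrr.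
- by move=> *; rewrite f1 // f2.
- by move=> *; rewrite h1 // h2.
- by move=> *; rewrite s1 // s2 // subrr.
Qed.

Lemma ucD UU n c c' : uc UU n c -> uc UU n c' -> uc UU n (fun s => c s + c' s)%R.
Proof.
case=> [[U lU hU] n1 f1 h1 s1] [[V lV hV] n2 f2 h2 s2]; split.
- have [W lW sW] := lev_cap La lU lV; exists W => // s t Ds Dt e.
  by rewrite (hU s t) ?(hV s t) //; apply: eqs_sub e => // x /sW [].
- by move=> *; rewrite n1 n2 addr0.
- by move=> *; rewrite f1 // f2.
- by move=> *; rewrite h1 // h2.
- by move=> *; rewrite s1 // s2 // addr0.
Qed.

(* In a [p]-group normalizers grow, so non-free points of [N(S)/S] on the
   fixed complex of [S] are the points with stabilizer larger than [S]. *)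
Lemma sing_norm S s : S \subset stab s -> stab s != S ->
  ~~ ('N(S) :&: stab s \subset S).
Proof.
move=> Ss ns; have pS : p.-group (stab_group La s) by apply: pgroupS pH; apply: finset.subsetT.
have := @nilpotent_proper_norm _ (stab_group La s) S (pgroup_nil pS).
rewrite properE Ss /= => /(_ _).
have nS : ~~ (stab s \subset S).
  by apply: contra ns => h; rewrite finset.eqEsubset h Ss.
by move=> /(_ nS); rewrite properE => /andP [_]; rewrite finset.setIC.
Qed.

(** The support of [q] consists of tuples with stabilizer exactly [S]. Compactness keeps its
    translates by elements outside ['N(S)] apart from the fixed complex, at the level [V], and keeps
    tuples with stabilizer in [UU] apart from its orbit, at the level [W]; [extension] then applies
    with [L] the whole of [H]. *)
Lemma uc_extend UU S n q : family UU -> ~~ UU S -> zc S 'N(S) n q ->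
  exists2 e, uc UU n e & forall s, ZS S n s -> e s = q s.
Proof.
move=> [up cj] nUS zq; have [[U lU hU] nq fq hq sq] := zq.
have q0 s : ZS S n s -> stab s != S -> q s = 0%R.
  by move=> D ns; apply: sq => //; apply: sing_norm => //; case: D.
have nz s : ZS S n s -> q s <> 0%R -> stab s = S.
  by move=> D nq0; apply/eqP/negPn/negP => /(q0 s D).
have cS : forall s, (forall W, lev W -> exists2 t, ZS S n t & eqs W setH s t) -> ZS S n s.
  exact: (ZS_closed La TB).
have cq : forall s, (forall W, lev W -> exists2 t, ZS S n t /\ q t <> 0%R & eqs W setH s t) ->
    ZS S n s /\ q s <> 0%R by apply: (ulc_closed La TB); exists U.
have [V lV hV] : exists2 V, lev V & forall h, h \notin 'N(S) -> forall t t' f,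
    (ZS S n t /\ q t <> 0%R) /\ ZS S n t' -> ~ eqs V setH (hs h t) (fs f t').
  apply: (lev_all La).
    by move=> V W h lV lW VW hW hN t t' f D e; apply: (hW hN t t' f D); apply: eqs_sub e.
  move=> h; have [hN|nN] := boolP (h \in 'N(S)).
    by have [V lV] := lev_has La; exists V.
  have [|t t' e|t t' f [[D nt] D'] e|V lV hV] := @near_stab _ _ _ _ La n
      (fun t t' => (ZS S n t /\ q t <> 0%R) /\ ZS S n t') h.
  - by move=> t t' [[[[_ ?] _] _] [[_ ?] _]].
  - split.
      by apply: cq => W lW; have [t1 [t2 [[? _] ? _]]] := e W lW; exists t1.
    by apply: cS => W lW; have [t1 [t2 [[_ ?] _ ?]]] := e W lW; exists t2.
  - case/negP: nN; have := stab_hs h t; rewrite e (stab_fs La) (nz t D nt) => st.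
    have [_] := D'; rewrite st => SS.
    rewrite -groupV; apply/normP/esym/eqP; rewrite eqEcard SS.
    by rewrite /= (cardJg S h^-1) leqnn.
  by exists V => // _ t t' f; apply: hV.
have [W lW hW] : exists2 W, lev W & forall h s t f, sdom setH n s /\ UU (stab_group La s) ->
    ZS S n t /\ q t <> 0%R -> ~ eqs W setH (hs h s) (fs f t).
  apply: (lev_all La).
    by move=> V1 W h lV1 lW VW hW s t f Ds D e; apply: (hW s t f Ds D); apply: eqs_sub e.
  move=> h.
  have [|s t e|s t f [[Ds us] [D nt]] e|W lW hW] := @near_stab _ _ _ _ La n
      (fun s t => (sdom setH n s /\ UU (stab_group La s)) /\ (ZS S n t /\ q t <> 0%R)) h.
  - by move=> s t [[[_ ?] _] [[[_ ?] _] _]].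
  - split; last by apply: cq => W lW; have [t1 [t2 [[_ ?] _ ?]]] := e W lW; exists t2.
    split.
      by apply: (dom_closed La TB) => W lW; have [t1 [t2 [[[? _] _] ? _]]] := e W lW; exists t1.
    (* The stabilizers of the approximating tuples vary with the level; by pigeonhole one subgroup
       [K] in [UU] stabilizes approximations at all levels, so it stabilizes the limit, and [UU] is
       closed upwards. *)
    have [||K hK] := lev_pigeonhole La (I := {group H})
        (P := fun W K => UU K /\ exists2 t, size t = n /\ K \subset stab t & eqs W setH s t).
    + by move=> W1 W2 K _ _ W12 [uK [t3 ? et]]; split => //; exists t3 => //; apply: eqs_sub et.
    + move=> W lW; have [t1 [t2 [[[[_ ?] ?] _] ? _]]] := e W lW.
      by exists (stab_group La t1); split => //; exists t1.
    have [W0 lW0] := lev_has La; have [uK _] := hK W0 lW0.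
    apply: up uK; apply/fintype.subsetP => k kK; apply: (stab_closed La (n := n)) => W lW.
    have [_ [t1 [? st] et]] := hK W lW; exists t1 => //; split => //.
    exact: (fintype.subsetP st).
  - have st := nz t D nt; case/negP: nUS.
    have := stab_hs h s; rewrite e (stab_fs La) st => sS.
    have -> : S = (stab_group La s :^ h^-1)%G by apply: val_inj.
    by rewrite cj.
  by exists W => // s t f Ds D; apply: hW.
have [V1 lV1 sV1] := lev_cap La lU lV; have [V2 lV2 sV2] := lev_cap La lV1 lW.
have s1 x : V2 x -> U x by move=> /sV2 [] /sV1 [].
have s2 x : V2 x -> V x by move=> /sV2 [] /sV1 [].
have s3 x : V2 x -> W x by move=> /sV2 [].
have [|e [eu en ei eq enz]] := extension La TB (S := S) (L := [set: H]%G) (q := q)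
    (n := n) lV2 _ nq.
  move=> t t' g f D D' _ et.
  have [gN|gN] := boolP (g \in 'N(S)).
    rewrite -(hq g t gN D) -(fq f t' D'); apply: hU; last exact: eqs_sub et.
      exact: (ZS_hs La TB).
    exact: (ZS_fs La).
  have [t0|nt0] := pselect (q t = 0%R).
    have [t0'|nt0'] := pselect (q t' = 0%R); first by rewrite t0 t0'.
    case: (hV g^-1 _ t' t (a g^-1 f^-1)) => //; first by rewrite groupV.
    have := eqs_hs La g^-1 lV2 et; rewrite (hsK La) (hs_fs La) => /(eqs_fs La (a g^-1 f)^-1 lV2).
    rewrite fsK -(lactV La) => e1; apply: eqs_sub (eqs_sym La lV2 e1) => //.
  by case: (hV g gN t t' f) => //; apply: eqs_sub et.
exists e; last by move=> s D; apply: eq.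
split => //.
- by move=> f s D; have := ei 1 f s D (finset.in_setT _); rewrite (hs1 La).
- by move=> h s D; have := ei h 1 s D (finset.in_setT _); rewrite fs1.
- move=> s D us; apply: contrapT => /(enz s D) [t [g [f [Dt _ nt et]]]].
  by case: (hW g s t f) => //; apply: eqs_sub et.
Qed.

(** Induction on the number of subgroups outside [UU]. For a maximal such [S] the restriction of [c]
    to the fixed complex of [S] satisfies the conditions of [zc S 'N(S)], hence is a coboundary
    there. Subtracting the coboundary of an extended primitive leaves a cocycle that vanishes on all
    tuples with stabilizer conjugate to [S], so these conjugates may join the family. *)
Theorem relative_acyclic UU m c : family UU -> uc UU m.+3 c ->
  (forall s, sdom setH m.+4 s -> cobd c s = 0%R) ->
  exists2 e, uc UU m.+2 e & forall s, sdom setH m.+3 s -> c s = cobd e s.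
Proof.
have [N] := ubnP #|[set S : {group H} | ~~ UU S]|.
elim: N UU c => // N IH UU c; rewrite ltnS => cN fUU ucc dc.
have [S0 nS0|all] := pickP (fun S : {group H} => ~~ UU S); last first.
  exists (fun=> 0%R); last first.
    move=> s D; rewrite cobd0 (uc_sing ucc) //.
    by have := all (stab_group La s) => /negbFE.
  by split => //; have [U lU] := lev_has La; exists U.
have [S nS maxS] := @arg_maxnP _ S0 (fun S : {group H} => ~~ UU S) (fun S => #|S|) nS0.
have up S' : S \proper S' -> UU S'.
  move=> SS'; apply/negPn/negP => nS'; have := maxS S' nS'.
  by rewrite /= leqNgt proper_card.
have [upU cjU] := fUU.
have bigU s : S \subset stab s -> stab s != S -> UU (stab_group La s).
  by move=> Ss ns; apply: up; rewrite finset.properEneq eq_sym ns.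
have [U lU hU] := uc_ulc ucc.
have zcc : zc S 'N(S) m.+3 c.
  split.
  - by exists U => // s t [Ds _] [Dt _]; apply: hU.
  - exact: (uc_normalized ucc).
  - by move=> f s [D _]; apply: (uc_fs ucc).
  - by move=> k s _ [D _]; apply: (uc_hs ucc).
  - move=> s [D Ss] sg; apply: (uc_sing ucc) => //; apply: bigU => //.
    by apply: contra sg => /eqP ->; apply: finset.subsetIr.
have [|q zq dq] := acyclic_pair La TB pp pH (normG S) (fintype.subxx _) zcc.
  by move=> s [D _]; apply: dc.
have [e0 ue0 eq0] := uc_extend fUU nS zq.
pose UU' T := UU T || [exists h : H, T == (S :^ h)%G].
have fUU' : family UU'.
  split=> [T K TK|T h].
    case/orP => [/upU h|/existsP [h /eqP TE]]; first by rewrite /UU' h.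
    have [TKe|TKn] := eqVneq (T : {set H}) K.
      by rewrite /UU'; apply/orP; right; apply/existsP; exists h; rewrite -TE; apply/eqP/val_inj.
    rewrite /UU' -(cjU K h^-1) up // finset.properEneq.
    apply/andP; split.
      apply: contra TKn => /eqP SE; rewrite TE /= SE /= conjsgKV //.
    by rewrite -sub_conjg; move: TK; rewrite TE.
  rewrite /UU' cjU; congr orb; apply/existsP/existsP => -[k /eqP TE].
    exists (k * h^-1); apply/eqP/val_inj; have /= TE' := congr1 val TE.
    by rewrite /= conjsgM -TE' conjsgK.
  by exists (k * h); rewrite TE; apply/eqP/val_inj; rewrite /= conjsgM.
have e0Z s : ZS S m.+3 s -> (c s - cobd e0 s)%R = 0%R.
  move=> D; rewrite dq // [X in (_ - X)%R](_ : _ = cobd q s) ?subrr //.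
  apply: eq_cobd => s1 x s2 es; apply: eq0.
  by apply: (ZS_face (s1 := s1) (x := x)); rewrite -es.
have uc1 : uc UU m.+3 (fun s => c s - cobd e0 s)%R by apply: ucB => //; apply: uc_cobd.
have uc2 : uc UU' m.+3 (fun s => c s - cobd e0 s)%R.
  case: uc1 => u1 n1 f1 h1 s1; split => // s D /orP [|/existsP [h /eqP sE]]; first exact: s1.
  rewrite -(h1 h s D); apply: e0Z; split; first exact: (dom_hs La TB).
  have := congr1 val sE; rewrite stab_hs /= => ->; by rewrite conjsgK.
have cN' : (#|[set S : {group H} | ~~ UU' S]| < N)%N.
  apply: leq_trans cN; apply: proper_card; apply/properP; split.
    by apply/fintype.subsetP => T; rewrite !inE negb_or => /andP [].
  exists S; rewrite !inE ?nS // negbK; apply/orP; right; apply/existsP; exists 1.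
  by apply/eqP/val_inj; rewrite /= conjsg1.
have [|e1 ue1 de1] := IH UU' _ cN' fUU' uc2.
  by move=> s D; rewrite cobdB dc // cobdK subrr.
exists (fun s => e0 s + e1 s)%R.
  apply: ucD => //; case: ue1 => u1 n1 f1 h1 s1; split => // s D us.
  by apply: s1 => //; rewrite /UU' us.
by move=> s D; rewrite cobdD -de1 // addrC subrK.
Qed.

End Relative.

(** * Equivariant lifting *)

(** The character lives on the product [N M] rather than on [N], and is trivial on the level [M],
    because it will be evaluated at elements only close to [N]. Its invariance under [E] and [H]
    makes the obstruction an invariant cochain with constant coefficients. *)
Definition has_characters (p : nat) (H : finGroupType) (E : groupType)
    (b : H -> E -> E) (lev : set (set E)) : Prop :=
  forall N : set E, N 1 -> (forall x y, N x -> N y -> N (x * y^-1)) ->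
    (forall x y, N x -> N (x ^ y)) -> (forall h x, N x -> N (b h x)) ->
    (exists2 n, N n & n <> 1) ->
    exists (M : set E) (chi : E -> 'F_p),
      let NM := fun x => exists n m, [/\ N n, M m & x = n * m] in
      [/\ lev M, exists2 n, N n & chi n = 1%R,
          forall x y, NM x -> NM y -> chi (x * y) = (chi x + chi y)%R,
          forall x, M x -> chi x = 0%R
        & forall x, NM x -> (forall y, chi (x ^ y) = chi x) /\
                            (forall h, chi (b h x) = chi x)].

Section Lifting.
Variables (p : nat) (H : finGroupType) (F E : groupType).
Variables (a : H -> F -> F) (b : H -> E -> E).
Variables (lev : set (set F)) (lve : set (set E)) (B : H -> set F).
Hypotheses (La : leveled_action a lev) (TB : tree_family p a lev B).
Hypotheses (Lb : leveled_action b lve) (chE : has_characters p b lve).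
Hypotheses (pp : prime p) (pH : p.-group [set: H]).
Local Notation Om := (H -> F).
Local Notation R := ('F_p : comNzRingType).
Implicit Types (s t e c : seq Om) (U : set F) (M : set E).
Implicit Types (S K : {group H}) (w : Om) (x y z n m : E).
Local Notation w1 := ((fun=> 1) : Om).
Local Notation sdom := (sdom B).
Local Notation hs := (hs a).
Local Notation hact := (hact a).
Local Notation stab := (stab a).
Local Notation setH := [set: H].

Variables (rho : E -> Om) (sec : Om -> E).
Hypothesis rhoM : forall x y k, rho (x * y) k = rho x k * rho y k.
Hypothesis rho_act : forall h x, rho (b h x) = hact h (rho x).
Hypothesis rho_cont : forall U, lev U -> exists2 M, lve M &
  forall x y, eqm M x y -> forall k, eqm U (rho x k) (rho y k).
Hypothesis secK : forall w, rho (sec w) = w.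
Hypothesis sec_act : forall h w, sec (hact h w) = b h (sec w).

Definition eqw U w w' := forall k, eqm U (w k) (w' k).

(* A multivalued section of [rho], each value being a coset of the normal
   subgroup [Ga w1]; [adm_fix] says that over an edge the
   values differ by an element of [E] fixed by the stabilizer of the edge. *)
Record admissible (Ga : Om -> E -> Prop) : Prop := Admissible {
  adm_closed : forall w x, (forall U M, lev U -> lve M ->
    exists w' x', [/\ Ga w' x', eqw U w w' & eqm M x x']) -> Ga w x;
  adm_total : forall w, exists x, Ga w x;
  adm_quot : forall w x y, Ga w x -> Ga w y -> Ga w1 (y * x^-1);
  adm_1 : Ga w1 1;
  adm_lin : forall f x w y, Ga (fun=> f) x -> Ga w y -> Ga (lmul f w) (x * y);
  adm_act : forall h w x, Ga w x -> Ga (hact h w) (b h x);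
  adm_conj : forall n x, Ga w1 n -> Ga w1 (n ^ x);
  adm_fix : forall w w' S x, simplex B setH [:: w; w'] -> S \subset stab [:: w; w'] ->
    Ga w x -> exists z, (forall h, h \in S -> b h z = z) /\ Ga w' (x * z);
  adm_rho : forall w x, Ga w x -> rho x = w
}.

Lemma rho1 : rho 1 = w1.
Proof. by apply/funext => k; apply: (mulgI (rho 1 k)); rewrite -rhoM !mulg1. Qed.

Lemma rhoV x k : rho x^-1 k = (rho x k)^-1.
Proof. by apply: (mulgI (rho x k)); rewrite -rhoM !mulgV rho1. Qed.

(** The starting point of the descent. [adm_fix] is where the equivariance of [sec] enters: the
    coordinatewise quotient of the ends of an edge is invariant under the stabilizer of the edge,
    and so is its image under [sec]. *)
Lemma admissible_graph : admissible (fun w x => rho x = w).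
Proof.
split.
- move=> w x h; apply/funext => k; apply: (eqm_sep La) => U lU.
  have [M lM hM] := rho_cont lU; have [w' [x' [e1 e2 e3]]] := h U M lU lM.
  apply: (eqm_trans La lU (hM _ _ e3 k)); rewrite e1.
  exact: (eqm_sym La lU).
- by move=> w; exists (sec w).
- by move=> w x y xw yw; apply/funext => k; rewrite rhoM rhoV xw yw mulgV.
- exact: rho1.
- by move=> f x w y xf yw; apply/funext => k; rewrite rhoM xf yw.
- by move=> h w x <-; rewrite rho_act.
- by move=> n x n1; apply/funext => k; rewrite conjgE !rhoM rhoV n1 mul1g mulVg.
- move=> w w' S x _ Sst xw; exists (sec (fun k => (w k)^-1 * w' k)); split.
    move=> h /(fintype.subsetP Sst) /stabP [f [e1 e2]].
    rewrite -sec_act; congr sec; apply/funext => k.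
    have := congr1 (fun w => w k) e1; have := congr1 (fun w => w k) e2.
    rewrite /hact (lactD La) (lactV La) => -> ->.
    by rewrite /lmul invgM mulgA mulgVK.
  by apply/funext => k; rewrite rhoM secK xw mulKVg.
- by [].
Qed.

Section Admissible.
Variable Ga : Om -> E -> Prop.
Hypothesis AG : admissible Ga.
Let N : set E := Ga w1.

Lemma lmul1 w : lmul 1 w = w.
Proof. by apply/funext => k; rewrite /lmul mul1g. Qed.

Lemma adm_mulN w x n : Ga w x -> N n -> Ga w (x * n).
Proof.
move=> xw /(adm_conj AG x^-1) nN; rewrite -[w]lmul1.
have -> : x * n = (n ^ x^-1) * x by rewrite conjgE invgK mulgA mulgVK.
exact: (adm_lin AG nN xw).
Qed.

Lemma adm_div w x y : Ga w x -> Ga w y -> N (x^-1 * y).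
Proof.
move=> xw yw; have := adm_conj AG x (adm_quot AG xw yw).
by rewrite conjgE mulgVK.
Qed.

Lemma N_1 : N 1. Proof. exact: adm_1 AG. Qed.

Lemma N_div x y : N x -> N y -> N (x * y^-1).
Proof.
move=> xN yN; apply: (adm_mulN xN); have := adm_quot AG yN N_1.
by rewrite mul1g.
Qed.

Lemma N_V x : N x -> N x^-1.
Proof. by move=> xN; rewrite -[_^-1]mul1g; apply: N_div N_1 xN. Qed.

Lemma N_M x y : N x -> N y -> N (x * y).
Proof. by move=> xN yN; rewrite -[y]invgK; apply: N_div => //; apply: N_V. Qed.

Lemma N_act h x : N x -> N (b h x).
Proof.
move=> xN; have := adm_act AG h xN; congr Ga.
by apply/funext => k; rewrite hactE (lact1r La).
Qed.

Lemma N_closed x : (forall M, lve M -> exists2 y, N y & eqm M x y) -> N x.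
Proof.
move=> h; apply: (adm_closed AG) => U M lU lM; have [y yN e] := h M lM.
by exists w1, y; split => // k; apply: (eqm_refl La).
Qed.

(** Suppose that values over [w] have no partner over nearby points. Limits of these values and of
    arbitrary values over the nearby points both lie over [w], hence differ by an element of [N],
    and multiplying by it produces the missing partner. *)
Lemma adm_near w M : lve M -> exists2 U, lev U & forall w', eqw U w w' ->
  forall x, Ga w x -> exists2 x', Ga w' x' & eqm M x x'.
Proof.
move=> lM; apply: contrapT => no.
have ch U : exists v : Om * E, lev U -> [/\ eqw U w v.1, Ga w v.2 &
    forall x', Ga v.1 x' -> ~ eqm M v.2 x'].
  have [lU|] := pselect (lev U); last by exists (w1, 1).
  apply: contrapT => hn; apply: no; exists U => // w' ew x xw.
  apply: contrapT => h; apply: hn; exists (w', x) => _; split => // x' xw' e.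
  by apply: h; exists x'.
have [v hv] := choice ch.
have [u hu] := choice (fun U => adm_total AG (v U).1).
have [U0 lU0] := lev_has La.
pose D := {U : set F | lev U}.
have [|||y hy] := lev_compact Lb (D := D) (le := fun d d' => forall f : F, sval d' f -> sval d f)
    (fun (d : D) (i : bool) => if i then (v (sval d)).2 else u (sval d)).
- by constructor; exists U0.
- move=> d d'; have [W lW sW] := lev_cap La (svalP d) (svalP d').
  by exists (exist _ W lW) => x /sW [].
- by move=> d d' d'' h1 h2 x /h2 /h1.
have yw : Ga w (y true).
  apply: (adm_closed AG) => U M' lU lM'; have [[V lV] /= VU e] := hy M' (exist _ U lU) lM'.
  exists w, (v V).2; have [_ h _] := hv V lV; split => //.
  by move=> k; apply: (eqm_refl La).
have yw' : Ga w (y false).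
  apply: (adm_closed AG) => U M' lU lM'; have [[V lV] /= VU e] := hy M' (exist _ U lU) lM'.
  exists (v V).1, (u V); have [h _ _] := hv V lV; split => //.
  by move=> k; apply: eqm_sub VU _; apply: h.
have [[V lV] /= VU e] := hy M (exist _ U0 lU0) lM; have [_ _ h] := hv V lV.
apply: (h (u V * ((y false)^-1 * y true))).
  by apply: adm_mulN; [apply: hu | apply: adm_div yw' yw].
apply: (eqm_trans Lb lM (eqm_sym Lb lM (e true))).
rewrite -{1}[y true](mulKVg (y false)); apply: (eqmM Lb lM) (e false) _.
exact: (eqm_refl Lb).
Qed.

Lemma adm_near_sym w w' M : lve M ->
  (forall x, Ga w x -> exists2 x', Ga w' x' & eqm M x x') ->
  (forall x', Ga w' x' -> exists2 x, Ga w x & eqm M x' x).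
Proof.
move=> lM h x' xw'; have [x xw] := adm_total AG w; have [y yw' e] := h x xw.
exists (x * (y^-1 * x')); first by apply: adm_mulN => //; apply: adm_div yw' xw'.
rewrite -{1}[x'](mulKVg y); apply: (eqmM Lb lM); first exact: (eqm_sym Lb lM).
exact: (eqm_refl Lb).
Qed.

Lemma eqw_eqs U w w' : eqw U w w' <-> eqs U setH [:: w] [:: w'].
Proof.
split=> [h|[h _] k]; last by apply: h; apply: finset.in_setT.
by split => // k _; apply: h.
Qed.

Lemma adm_uniform M : lve M -> exists2 U, lev U & forall w w', eqw U w w' ->
  forall x, Ga w x -> exists2 x', Ga w' x' & eqm M x x'.
Proof.
move=> lM; apply: contrapT => no.
have ch U : exists v : Om * Om, lev U -> eqw U v.1 v.2 /\
    ~ (forall x, Ga v.1 x -> exists2 x', Ga v.2 x' & eqm M x x').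
  have [lU|] := pselect (lev U); last by exists (w1, w1).
  apply: contrapT => hn; apply: no; exists U => // w w' ew; apply: contrapT => h.
  by apply: hn; exists (w, w').
have [v hv] := choice ch.
have [//|t szt ht] := cluster_lev La (m := 1) (s := fun U => [:: (v U).1]).
case: t szt ht => [|w [|]] //= _ ht.
have [U lU hU] := adm_near w lM.
have [V [lV VU /eqw_eqs ew]] := ht U lU; have [ev nv] := hv V lV.
apply: nv => x xv.
have ew' : eqw U w (v V).2.
  by move=> k; apply: (eqm_trans La lU (ew k)); apply: eqm_sub VU _; apply: ev.
have [y yw e] := adm_near_sym lM (hU _ ew) xv.
have [x' xv' e'] := hU _ ew' _ yw; exists x' => //.
exact: (eqm_trans Lb lM e e').
Qed.

(** The differences between values over the two ends of an edge, a coset of [N]; by [edge_cosetP]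
    any value over the first end may be used. *)
Definition edge_coset e z :=
  if e is [:: w; w'] then exists x, Ga w x /\ Ga w' (x * z) else False.

Lemma edge_cosetP w w' x z : edge_coset [:: w; w'] z -> Ga w x -> Ga w' (x * z).
Proof.
move=> [y [yw yzw]] xw; have nN := adm_div xw yw.
have -> : x * z = (y * z) * (((x^-1 * y)^-1) ^ z).
  by rewrite conjgE invgM invgK !mulgA mulgK mulgV mul1g.
by apply: adm_mulN => //; apply: (adm_conj AG); apply: N_V.
Qed.

Lemma edge_coset_fs f e z : edge_coset e z -> edge_coset (fs f e) z.
Proof.
case: e => [|w [|w' []]] //= [x [xw xzw]]; have [g gf] := adm_total AG (fun=> f).
exists (g * x); split; first exact: (adm_lin AG).
by rewrite -mulgA; apply: (adm_lin AG).
Qed.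

Lemma edge_coset_hs h e z : edge_coset e z -> edge_coset (hs h e) (b h z).
Proof.
case: e => [|w [|w' []]] //= [x [xw xzw]].
exists (b h x); split; first exact: (adm_act AG).
by rewrite -(lactD Lb); apply: (adm_act AG).
Qed.

Lemma sdom_dup2 w : sdom setH 2 [:: w; w].
Proof.
split => // k _ /=; apply: (@step_const _ _ _ _ _ _ TB _ (w k)).
by rewrite /= eqxx.
Qed.

(** [adm_fix] gives [y], and [U] is taken so small that only stabilizers bring the edge back near
    its [F]-orbit, and that degenerate edges come near only if [y = 1]. These are the conditions for
    transporting [y] along orbits. *)
Lemma edge_local M e : lve M -> sdom setH 2 e -> exists (y : E) U,
  [/\ lev U, forall h, h \in stab e -> b h y = y,
      forall h f, eqs U setH (hs h e) (fs f e) -> h \in stab e,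
      forall w f h, eqs U setH [:: w; w] (fs f (hs h e)) -> y = 1
    & forall t, eqs U setH e t -> exists2 z, edge_coset t z & eqm M y z].
Proof.
move=> lM D; have [U1 lU1 hU1] := adm_uniform lM.
have [U2 lU2 hU2] : exists2 U, lev U & forall h f, eqs U setH (hs h e) (fs f e) -> h \in stab e.
  suff [U lU hU] : exists2 U, lev U & forall h, forall f, eqs U setH (hs h e) (fs f e) ->
      h \in stab e by exists U.
  apply: (lev_all La).
    by move=> U V h lU lV UV hV f e'; apply: (hV f); apply: eqs_sub e'.
  move=> h; have [he|nh] := boolP (h \in stab e).
    by have [U lU] := lev_has La; exists U.
  have [||s t f [-> ->] e'|U lU hU] := @near_stab _ _ _ _ La 2 (fun s t => s = e /\ t = e) h.
  - by case: D => _ sz s t [-> ->].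
  - move=> s t e'; split; apply: (eqs_sep La) => U lU;
      by have [s' [t' [[-> ->] ? ?]]] := e' U lU.
  - by case/negP: nh; apply/stabP; exists f.
  by exists U => // f e'; case: (hU e e f).
have [y [U3 [lU3 hy y1 cy]]] : exists y U3, [/\ lev U3,
    forall h, h \in stab e -> b h y = y,
    forall w f h, eqs U3 setH [:: w; w] (fs f (hs h e)) -> y = 1 & edge_coset e y].
  case: e D {hU2} => [|w [|w' [|w'' e']]] D; try by case: D.
  have [X _] := D; have [<-|ne] := pselect (w = w').
    have [U lU] := lev_has La; exists 1, U; split => //.
      by move=> h _; apply: (lact1r Lb).
    by have [x xw] := adm_total AG w; exists x; rewrite mulg1.
  have [x xw] := adm_total AG w.
  have [z [hz xz]] := adm_fix AG (S := stab_group La [:: w; w']) X (fintype.subxx _) xw.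
  have [k nk] : exists k, w k <> w' k.
    by apply/existsNP => h; apply: ne; apply/funext.
  have [U lU nU] : exists2 U, lev U & ~ eqm U (w k) (w' k).
    apply: contrapT => h; apply: nk; apply: (eqm_sep La) => U lU.
    by apply: contrapT => h'; apply: h; exists U.
  exists z, U; split => //; last by exists x.
  move=> v f h /= [e1 [e2 _]]; case: nU.
  have := e1 (h * k) (finset.in_setT _); have := e2 (h * k) (finset.in_setT _).
  rewrite /lmul !hactE mulKg => e2' e1'.
  have := eqm_trans La lU (eqm_sym La lU e1') e2'.
  rewrite {1}/eqm invgM mulgA mulgVK -(lactV La) -(lactD La).
  by move=> /(lev_act La h^-1 lU); rewrite (lactK La).
have [V lV sV] := lev_cap La lU1 lU2; have [U lU sU] := lev_cap La lV lU3.
exists y, U; split => //.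
- by move=> h f e'; apply: (hU2 h f); apply: eqs_sub e' => // x /sU [] /sV [].
- by move=> w f h e'; apply: (y1 w f h); apply: eqs_sub e' => // x /sU [].
- move=> t et; have st := rel2_size et.
  case: e D st et cy {hU2 hy y1} => [|w [|w' [|w'' e']]] D; try by case: D.
  case: t => [|v [|v' [|v'' t']]] // _ [e1 [e2 _]] [x [xw xyw]].
  have ew : eqw U1 w v by move=> k; have /sU [/sV []] := e1 k (finset.in_setT k).
  have ew' : eqw U1 w' v' by move=> k; have /sU [/sV []] := e2 k (finset.in_setT k).
  have [x' xv exx] := hU1 _ _ ew _ xw; have [z zv' ez] := hU1 _ _ ew' _ xyw.
  exists (x'^-1 * z); first by exists x'; rewrite mulKVg.
  rewrite -[y](mulKg x); apply: (eqmM Lb lM) ez; exact: (eqmV Lb lM).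
Qed.

(** Finitely many local choices suffice. An edge uses the first centre in the list whose orbit comes
    close to it and transports the value there by [H]; two transporting elements differ by a
    stabilizer of the centre, which fixes the value. Membership in the edge coset survives only
    modulo [M]. *)
Lemma edge_section M : lve M -> exists beta : seq Om -> E,
  [/\ exists2 U, lev U & forall e e', sdom setH 2 e -> sdom setH 2 e' ->
        eqs U setH e e' -> beta e = beta e',
      forall f e, sdom setH 2 e -> beta (fs f e) = beta e,
      forall h e, sdom setH 2 e -> beta (hs h e) = b h (beta e),
      forall w, beta [:: w; w] = 1
    & forall e, sdom setH 2 e -> exists2 z, edge_coset e z & eqm M (beta e) z].
Proof.
move=> lM.
have ch e : exists yU : E * set F, sdom setH 2 e -> 
  [/\ lev yU.2, forall h, h \in stab e -> b h yU.1 = yU.1,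
      forall h f, eqs yU.2 setH (hs h e) (fs f e) -> h \in stab e,
      forall w f h, eqs yU.2 setH [:: w; w] (fs f (hs h e)) -> yU.1 = 1
    & forall t, eqs yU.2 setH e t -> exists2 z, edge_coset t z & eqm M yU.1 z].
  have [D|nD] := pselect (sdom setH 2 e); last by exists (1, setT).
  by have [y [U h]] := edge_local lM D; exists (y, U).
have [yU hyU] := choice ch.
pose rl c e h := exists f, eqs (yU c).2 setH e (fs f (hs h c)).
pose P e c := `[< sdom setH 2 c /\ exists h, rl c e h >].
(* Were no finite list of centres sufficient, uncovered edges, indexed by the directed family of
   lists, would cluster at an edge [t]; but [t] is itself a centre covering its neighbourhood. *)
have [l cov] : exists l, forall e, sdom setH 2 e -> has (P e) l.
  apply: contrapT => no.
  have ch' (l : seq (seq Om)) : exists e, sdom setH 2 e /\ ~~ has (P e) l.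
    apply: contrapT => h; apply: no; exists l => e D; apply/negPn/negP => nh.
    by apply: h; exists e.
  have [e he] := choice ch'.
  have [||||t szt ht] := @cluster_seq _ _ _ _ La 2 (seq (seq Om))
    (fun l l' => forall Q : pred (seq Om), has Q l -> has Q l') e.
  - by constructor; exact: [::].
  - by move=> l l'; exists (l ++ l') => Q; rewrite has_cat => ->; rewrite ?orbT.
  - by move=> l l' l'' h1 h2 Q /h1 /h2.
  - by move=> l; have [[]] := he l.
  have Dt : sdom setH 2 t.
    apply: (dom_closed La TB) => U lU; have [l _ el] := ht U [::] lU.
    by exists (e l) => //; have [] := he l.
  have [lt _ _ _ _] := hyU t Dt.
  have [l hl el] := ht _ [:: t] lt; have [_ /negP] := he l; apply; apply: hl.
  rewrite /= orbF; apply/asboolP; split => //; exists 1, 1.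
  by rewrite fs1 (hs1 La); apply: (eqs_sym La).
pose cen e := nth [::] l (find (P e) l).
have cenP e : sdom setH 2 e -> sdom setH 2 (cen e) /\ exists h, rl (cen e) e h.
  by move=> /cov /(nth_find [::]) /asboolP.
pose beta e := if pselect (exists h, rl (cen e) e h) is left ex
  then b (sval (cid ex)) (yU (cen e)).1 else 1.
have betaE e h : sdom setH 2 e -> rl (cen e) e h -> beta e = b h (yU (cen e)).1.
  move=> D [f ef]; have [Dc _] := cenP e D; have [lU hs1' hU _ _] := hyU _ Dc.
  rewrite /beta; case: pselect => [ex|[]]; last by exists h, f.
  case: cid => h' /= [f' ef'].
  have e1 := eqs_trans La lU (eqs_sym La lU ef) ef'.
  have := eqs_hs La h^-1 lU e1; rewrite !(hs_fs La) (hsK La) -(hsM La).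
  move=> /(eqs_fs La (a h^-1 f')^-1 lU); rewrite fsK -fsM => /(eqs_sym La lU) e2.
  have := hs1' _ (hU _ _ e2); rewrite (lactM Lb) => e3.
  by rewrite -{2}e3 (lactKV Lb).
have rl_fs c e f h : rl c e h -> rl c (fs f e) h.
  move=> [g eg]; exists (f * g); rewrite fsM.
  have [D|nD] := pselect (lev (yU c).2); last first.
    by move: eg; rewrite /fs; apply: rel2_map => x y exy k kH; rewrite /lmul /eqm invgM mulgA mulgVK; apply: exy.
  exact: (eqs_fs La).
have cen_eq e e' : (forall c, c = c -> P e c = P e' c) -> cen e = cen e'.
  by move=> h; rewrite /cen (eq_find (a2 := P e')) // => c; apply: h.
have P_fs f e : sdom setH 2 e -> forall c, P (fs f e) c = P e c.
  move=> D c; apply: asbool_equiv_eq; split=> -[Dc [h hc]]; split => //; exists h.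
    by have := rl_fs _ _ f^-1 _ hc; rewrite fsK.
  exact: rl_fs.
have rl_hs c e h k : sdom setH 2 c -> rl c e h -> rl c (hs k e) (k * h).
  move=> Dc [g eg]; have [lU _ _ _ _] := hyU _ Dc; exists (a k g).
  by rewrite (hsM La) -(hs_fs La); apply: (eqs_hs La).
have P_hs k e c : P (hs k e) c = P e c.
  apply: asbool_equiv_eq; split=> -[Dc [h hc]]; split => //.
    by have := rl_hs _ _ _ k^-1 Dc hc; rewrite (hsK La) => hc'; exists (k^-1 * h).
  by exists (k * h); apply: rl_hs.
exists beta; split.
- have [U lU hU] : exists2 U, lev U & forall i, (i < size l)%N ->
      sdom setH 2 (nth [::] l i) -> forall f, U f -> (yU (nth [::] l i)).2 f.
    elim: (l) => [|c l' [U lU IH]]; first by have [U lU] := lev_has La; exists U.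
    have [Dc|nD] := pselect (sdom setH 2 c); last first.
      by exists U => // -[|i] //= il Di; apply: IH.
    have [lc _ _ _ _] := hyU c Dc; have [V lV sV] := lev_cap La lU lc.
    exists V => // -[|i] /= il Di x Vx; first by case: (sV x Vx).
    by apply: (IH i) => //; case: (sV x Vx).
  exists U => // e e' D D' ee.
  have Pn i : (i < size l)%N -> P e (nth [::] l i) = P e' (nth [::] l i).
    move=> il; apply: asbool_equiv_eq; split=> -[Dc [h [f ef]]]; split => //; exists h, f;
      have [lc _ _ _ _] := hyU _ Dc; apply: (eqs_trans La lc _ ef).
      by apply: (eqs_sym La lc); apply: eqs_sub ee => // x; apply: hU.
    by apply: eqs_sub ee => // x; apply: hU.
  have ce : cen e = cen e'.
    rewrite /cen; congr nth; elim: (l) Pn => //= c l' IH Pn; rewrite (Pn 0%N) //.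
    by rewrite IH // => i il; apply: (Pn i.+1).
  have [Dc [h rh]] := cenP e D; rewrite (betaE e h) // (betaE e' h) ?ce //.
  rewrite -ce; have [f ef] := rh; exists f; have [lc _ _ _ _] := hyU _ Dc.
  apply: (eqs_trans La lc _ ef); apply: (eqs_sym La lc); apply: eqs_sub ee => // x.
  by apply: hU => //; rewrite -has_find; apply: cov.
- move=> f e D; have Df : sdom setH 2 (fs f e) by apply: dom_lmul.
  have ce : cen (fs f e) = cen e by apply: cen_eq => c _; apply: P_fs.
  have [Dc [h rh]] := cenP e D; rewrite (betaE e h) // (betaE _ h) ?ce //.
  exact: rl_fs.
- move=> k e D; have Df : sdom setH 2 (hs k e) by apply: (dom_hs La TB).
  have ce : cen (hs k e) = cen e by apply: cen_eq => c _; apply: P_hs.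
  have [Dc [h rh]] := cenP e D; rewrite (betaE e h) // (betaE _ (k * h)) ?ce ?(lactM Lb) //.
  exact: rl_hs.
- move=> w; have D := sdom_dup2 w; have [Dc [h rh]] := cenP _ D.
  rewrite (betaE _ h) //; have [_ _ _ y1 _] := hyU _ Dc; have [f ef] := rh.
  by rewrite (y1 w f h) // (lact1r Lb).
- move=> e D; have [Dc [h [f ef]]] := cenP _ D; have [lU _ _ _ cy] := hyU _ Dc.
  rewrite (betaE _ h) //; last by exists f.
  have e1 : eqs (yU (cen e)).2 setH (cen e) (hs h^-1 (fs f^-1 e)).
    have := eqs_hs La h^-1 lU (eqs_fs La f^-1 lU (eqs_sym La lU ef)).
    by rewrite fsK (hsK La).
  have [z cz ez] := cy _ e1; exists (b h z); last exact: (eqm_act Lb lM).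
  have := edge_coset_fs f (edge_coset_hs h cz).
  by rewrite -{1}[h]invgK (hsK La) -{1}[f]invgK fsK.
Qed.

End Admissible.
End Lifting.

Section EdgeConstant.
Variables (p : nat) (H : finGroupType) (F : groupType).
Variables (a : H -> F -> F) (lev : set (set F)) (B : H -> set F).
Hypotheses (La : leveled_action a lev) (TB : tree_family p a lev B).
Local Notation Om := (H -> F).
Local Notation R := ('F_p : comNzRingType).

(** Two points are joined by changing one coordinate at a time, and in each coordinate the tree is
    connected. *)
Lemma edge_constant (g : Om -> R) :
  (exists2 U, lev U & forall w w', eqw U w w' -> g w = g w') ->
  (forall w w', sdom B [set: H] 2 [:: w; w'] -> g w = g w') ->
  forall w, g w = g (fun=> 1).
Proof.
move=> [U lU hU] ed w.
have hk k v : g v = g (setc k 1 v).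
  have -> : v = setc k (v k) v by apply/funext => l; rewrite /setc; case: eqP => [->|].
  rewrite setc_setc; apply: (tree_const TB (k := k) (g := fun u => g (setc k u v))) (v k).
    exists U => // u u' e; apply: hU => l; rewrite /setc; case: eqP => // _.
    exact: (eqm_refl La).
  move=> u x bx; apply/esym/ed; split => // l _; rewrite /= /setc.
  case: eqP => [->|_]; last by apply: (@step_const _ _ _ _ _ _ TB _ (v l)); rewrite /= eqxx.
  by exists u, (u * x); rewrite mulKg; split => //=; left; split => //; right; rewrite eqxx.
have hs (s : seq H) v : g v = g (foldr (fun k => setc k 1) v s).
  by elim: s => //= k s ->; apply: hk.
rewrite (hs (enum H) w); congr g; apply/funext => k.
have: k \in enum H by rewrite mem_enum.
elim: (enum H) => //= l s IH; rewrite in_cons /setc.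
by case: eqP => //= _ /IH.
Qed.

End EdgeConstant.

(** * Shrinking a multivalued section by one character *)

Section Shrinking.
Variables (p : nat) (H : finGroupType) (F E : groupType).
Variables (a : H -> F -> F) (b : H -> E -> E).
Variables (lev : set (set F)) (lve : set (set E)) (B : H -> set F).
Hypotheses (La : leveled_action a lev) (TB : tree_family p a lev B).
Hypotheses (Lb : leveled_action b lve).
Hypotheses (pp : prime p) (pH : p.-group [set: H]).
Local Notation Om := (H -> F).
Local Notation R := ('F_p : comNzRingType).
Implicit Types (s t e : seq Om) (U : set F) (M : set E).
Implicit Types (S K : {group H}) (w : Om) (x y z n m : E).
Local Notation w1 := ((fun=> 1) : Om).
Local Notation sdom := (sdom B).
Local Notation hs := (hs a).
Local Notation hact := (hact a).
Local Notation stab := (stab a).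
Local Notation setH := [set: H].
Variables (rho : E -> Om) (Ga : Om -> E -> Prop).
Hypothesis AG : admissible a b lev lve B rho Ga.
Let N : set E := Ga w1.
Variables (M0 : set E) (chi : E -> R).
(** The group [N M0], on which [chi] is a character. *)
Definition near_N x := exists2 n, N n & eqm M0 n x.
Hypothesis lM0 : lve M0.
Hypothesis chiM : forall x y, near_N x -> near_N y -> chi (x * y) = (chi x + chi y)%R.
Hypothesis chi0 : forall x, M0 x -> chi x = 0%R.
Hypothesis chiJ : forall x y, near_N x -> chi (x ^ y) = chi x.
Hypothesis chiA : forall x h, near_N x -> chi (b h x) = chi x.

Lemma near_N_N n : N n -> near_N n.
Proof. by move=> nN; exists n => //; apply: (eqm_refl Lb). Qed.

Lemma near_N_M0 x : M0 x -> near_N x.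
Proof. by exists 1; [apply: (N_1 AG) | rewrite /eqm invg1 mul1g]. Qed.

Lemma near_NM x y : near_N x -> near_N y -> near_N (x * y).
Proof.
move=> [n nN nx] [m mN my]; exists (n * m); first exact: (N_M AG).
exact: (eqmM Lb).
Qed.

Lemma near_NV x : near_N x -> near_N x^-1.
Proof. by move=> [n nN nx]; exists n^-1; [apply: (N_V AG) | apply: (eqmV Lb)]. Qed.

Lemma near_NJ x y : near_N x -> near_N (x ^ y).
Proof.
move=> [n nN nx]; exists (n ^ y); first exact: (adm_conj AG).
by rewrite /eqm -conjVg -conjMg; apply: (lev_conj Lb).
Qed.

Lemma chi_one : chi 1 = 0%R. Proof. by apply: chi0; apply: (lev_1 Lb). Qed.

Lemma chi_inv x : near_N x -> chi x^-1 = (- chi x)%R.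
Proof.
move=> hx; apply/esym/eqP; rewrite eq_sym -addr_eq0 -chiM //; last exact: near_NV.
by rewrite mulVg chi_one.
Qed.

Lemma chi_eqm x y : near_N x -> eqm M0 x y -> chi x = chi y.
Proof.
move=> hx xy; rewrite -[y](mulKVg x) chiM ?(chi0 xy) ?addr0 //.
exact: near_N_M0.
Qed.

(** [S]-fixed elements approaching [N] with nonzero character would cluster at an [S]-fixed element
    of [N] with nonzero character. This lets [chi] be tested on elements built from [beta], which
    lie only near [N]. *)
Lemma chi_fixed_level : exists M, [/\ lve M, forall x, M x -> M0 x &
  forall S, (forall n, N n -> (forall h, h \in S -> b h n = n) -> chi n = 0%R) ->
  forall n y, N n -> eqm M n y -> (forall h, h \in S -> b h y = y) -> chi y = 0%R].
Proof.
pose P M S := (forall x, M x -> M0 x) /\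
  ((forall n, N n -> (forall h, h \in S -> b h n = n) -> chi n = 0%R) ->
  forall n y, N n -> eqm M n y -> (forall h, h \in S -> b h y = y) -> chi y = 0%R).
suff [M lM hM] : exists2 M, lve M & forall S, P M S.
  by exists M; split => //; [case: (hM 1%G) | move=> S; case: (hM S)].
apply: (lev_all Lb).
  move=> M M' S lM lM' s [s0 h]; split => [x /s /s0 //|hS n y nN e]; apply: h hS _ _ nN _.
  exact: eqm_sub e.
move=> S; apply: contrapT => no.
have [hS|nS] := pselect (forall n, N n -> (forall h, h \in S -> b h n = n) -> chi n = 0%R); last first.
  by apply: no; exists M0 => //; split => // /nS.
pose D := {M : set E | lve M /\ forall x, M x -> M0 x}.
have ch (d : D) : exists ny : E * E, [/\ N ny.1, eqm (sval d) ny.1 ny.2,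
    forall h, h \in S -> b h ny.2 = ny.2 & chi ny.2 <> 0%R].
  apply: contrapT => nh; apply: no; exists (sval d); first by case: (svalP d).
  split; first by case: (svalP d).
  by move=> _ n y nN e fy; apply: contrapT => c; apply: nh; exists (n, y).
have [ny hny] := choice ch.
have [|||y hy] := lev_compact Lb (D := D) (le := fun d d' => forall x, sval d' x -> sval d x)
    (fun (d : D) (i : 'I_1) => (ny d).1).
- by constructor; exists M0.
- move=> d d'; have [[ld sd] [ld' sd']] := (svalP d, svalP d').
  have [W lW sW] := lev_cap Lb ld ld'.
  have sW0 x : W x -> M0 x by move=> /sW [/sd].
  by exists (exist _ W (conj lW sW0)) => x /sW [].
- by move=> d d' d'' h1 h2 x /h2 /h1.
have d0 : D by exists M0.
have nearM M (lM : lve M) : exists d, eqm M (y ord0) (ny d).2.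
  have [W lW sW] := lev_cap Lb lM lM0.
  have sW0 x : W x -> M0 x by move=> /sW [].
  have [d' /= dd' e] := hy M (exist _ W (conj lW sW0)) lM.
  have [_ e' _ _] := hny d'; exists d'; apply: (eqm_trans Lb lM (e ord0)).
  by apply: eqm_sub e' => x /dd' /sW [].
have yN : N (y ord0).
  apply: (N_closed La AG) => M lM; have [d _ e] := hy M d0 lM.
  by exists (ny d).1; [case: (hny d) | exact: (e ord0)].
have yS h : h \in S -> b h (y ord0) = y ord0.
  move=> hS'; apply: (eqm_sep Lb) => M lM; have [d e] := nearM M lM.
  have [_ _ f _] := hny d; have := eqm_act Lb lM h e; rewrite f // => e2.
  exact: (eqm_trans Lb lM e2 (eqm_sym Lb lM e)).
have [d e] := nearM M0 lM0; have [_ _ _ c] := hny d; apply: c.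
by rewrite -(chi_eqm (near_N_N yN) e); apply: hS.
Qed.

(** Over a simplex with such a stabilizer no correction by a fixed element of [N] changes the
    character, so the cochains have to vanish there; over the other simplices there is room. *)
Definition UU S : bool :=
  `[< forall n, N n -> (forall h, h \in S -> b h n = n) -> chi n = 0%R >].

Lemma family_UU : family UU.
Proof.
have UJ S h : UU S -> UU (S :^ h)%G.
  move=> /asboolP hS; apply/asboolP => n nN fn.
  rewrite -(chiA h (near_N_N nN)); apply: hS; first exact: (N_act La AG).
  move=> k kS; apply: (can_inj (lactK Lb h^-1)).
  rewrite (lactK Lb) -!(lactM Lb) -{2}[n](fn (k ^ h)) ?memJ_conjg //.
  by rewrite conjgE mulgA.
split=> [S K /fintype.subsetP SK /asboolP hS|S h].
  by apply/asboolP => n nN fn; apply: hS => // k /SK /fn.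
apply/idP/idP; last exact: UJ.
move=> /(UJ _ h^-1); congr UU; apply/val_inj => /=; exact: conjsgK.
Qed.

Section WithEdgeSection.
Variables (M : set E) (beta : seq Om -> E).
Hypothesis lM : lve M.
Hypothesis sM : forall x, M x -> M0 x.
Hypothesis M2 : forall S, (forall n, N n -> (forall h, h \in S -> b h n = n) -> chi n = 0%R) ->
  forall n y, N n -> eqm M n y -> (forall h, h \in S -> b h y = y) -> chi y = 0%R.
Hypothesis beta_ulc : exists2 U, lev U & forall e e', sdom setH 2 e -> sdom setH 2 e' ->
        eqs U setH e e' -> beta e = beta e'.
Hypothesis beta_fs : forall f e, sdom setH 2 e -> beta (fs f e) = beta e.
Hypothesis beta_hs : forall h e, sdom setH 2 e -> beta (hs h e) = b h (beta e).
Hypothesis beta_dup : forall w, beta [:: w; w] = 1.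
Hypothesis beta_coset : forall e, sdom setH 2 e ->
  exists2 z, edge_coset Ga e z & eqm M (beta e) z.

Definition tri (w w' w'' : Om) : E :=
  beta [:: w; w'] * beta [:: w'; w''] * (beta [:: w; w''])^-1.

Lemma sdom3 w w' w'' : sdom setH 3 [:: w; w'; w''] ->
  [/\ sdom setH 2 [:: w; w'], sdom setH 2 [:: w'; w''] & sdom setH 2 [:: w; w'']].
Proof.
move=> D; split.
- exact: (@sdom_face _ _ B 2 [:: w; w'] w'' [::] D).
- exact: (@sdom_face _ _ B 2 [::] w [:: w'; w''] D).
- exact: (@sdom_face _ _ B 2 [:: w] w' [:: w''] D).
Qed.

Lemma near_tri w w' w'' : sdom setH 3 [:: w; w'; w''] ->
  exists2 n, N n & eqm M n (tri w w' w'').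
Proof.
move=> /sdom3 [D1 D2 D3]; have [x xw] := adm_total AG w.
have [z1 c1 e1] := beta_coset D1; have [z2 c2 e2] := beta_coset D2.
have [z3 c3 e3] := beta_coset D3.
have h1 := edge_cosetP AG c1 xw; have h2 := edge_cosetP AG c2 h1.
have h3 := edge_cosetP AG c3 xw.
exists (z1 * z2 * z3^-1).
  have := adm_conj AG x (adm_quot AG h3 h2); congr N.
  by rewrite conjgE invgM !mulgA mulVg mul1g mulgVK.
apply: (eqm_sym Lb lM); apply: (eqmM Lb lM); last exact: (eqmV Lb).
exact: (eqmM Lb lM).
Qed.

Lemma near_N_tri w w' w'' : sdom setH 3 [:: w; w'; w''] -> near_N (tri w w' w'').
Proof. by move=> /near_tri [n nN e]; exists n => //; apply: eqm_sub e. Qed.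

(* The character of the failure of [beta] to be a cocycle. *)
Definition obstruction : seq Om -> R :=
  restr0 (sdom setH 3) (fun s => if s is [:: w; w'; w''] then chi (tri w w' w'') else 0%R).

Lemma obstructionE w w' w'' : sdom setH 3 [:: w; w'; w''] ->
  obstruction [:: w; w'; w''] = chi (tri w w' w'').
Proof. by move=> D; rewrite /obstruction restr0E. Qed.

Lemma sdom3P s : sdom setH 3 s -> exists w w' w'', s = [:: w; w'; w''].
Proof.
move=> D; case: s D => [|w [|w' [|w'' [|? ?]]]] D; try by case: D.
by exists w, w', w''.
Qed.

Lemma sdom2P s : sdom setH 2 s -> exists w w', s = [:: w; w'].
Proof.
move=> D; case: s D => [|w [|w' [|w'' ?]]] D; try by case: D.
by exists w, w'.
Qed.

Lemma uc_obstruction : uc B La UU 3 obstruction.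
Proof.
split.
- have [U lU hU] := beta_ulc; exists U => // s t D D'.
  have [x [y [z s3]]] := sdom3P D; have [x' [y' [z' t3]]] := sdom3P D'.
  move: D D'; rewrite {}s3 {}t3 => D D' [e1 [e2 [e3 _]]].
  rewrite !obstructionE // /tri; have [? ? ?] := sdom3 D; have [? ? ?] := sdom3 D'.
  by rewrite (hU [:: x; y] [:: x'; y']) ?(hU [:: x; z] [:: x'; z'])
    ?(hU [:: y; z] [:: y'; z']).
- apply: normalized_restr0 => s1 x s2 D.
  case: s1 D => [|y s1] D.
    case: s2 D => [|y [|? ?]] D; try by case: D.
    by rewrite /= /tri beta_dup mul1g mulgV chi_one.
  case: s1 D => [|y' s1] D; last by case: D => _ /=; rewrite size_cat /= !addnS.
  case: s2 D => [|? ?] D; last by case: D.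
  by rewrite /= /tri beta_dup mulg1 mulgV chi_one.
- move=> f s D; have [x [y [z s3]]] := sdom3P D; move: D; rewrite {}s3 => D; have [? ? ?] := sdom3 D.
  have D' := dom_lmul f D; rewrite !obstructionE //; congr chi; rewrite /tri.
  by rewrite -(beta_fs f (e := [:: x; y])) // -(beta_fs f (e := [:: x; z])) //
    -(beta_fs f (e := [:: y; z])).
- move=> h s D; have [x [y [z s3]]] := sdom3P D; move: D; rewrite {}s3 => D; have [? ? ?] := sdom3 D.
  have D' := dom_hs La TB h D; rewrite !obstructionE //.
  rewrite -[RHS](chiA h (near_N_tri D)); congr chi.
  by rewrite /tri !(lactD Lb) (lactV Lb) -!beta_hs.
(* The stabilizer fixes the three values of [beta], hence [tri], which is close to [N]; its
   character vanishes by the choice of [M]. *)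
- move=> s D; have [x [y [z s3]]] := sdom3P D; move: D; rewrite {}s3 => D; have [? ? ?] := sdom3 D; move=> /asboolP hS.
  rewrite obstructionE //; have [n nN e] := near_tri D; apply: (M2 hS nN e).
  move=> h /stabP [f [e1 e2 e3]]; have bf u v : sdom setH 2 [:: u; v] ->
    hact h u = lmul f u -> hact h v = lmul f v -> b h (beta [:: u; v]) = beta [:: u; v].
    by move=> Duv eu ev; rewrite -beta_hs // -[RHS](beta_fs f) //= eu ev.
  by rewrite /tri !(lactD Lb) (lactV Lb) !bf.
Qed.

Lemma obstruction_cocycle s : sdom setH 4 s -> cobd obstruction s = 0%R.
Proof.
case: s => [|x [|y [|z [|t [|? ?]]]]] D; try by case: D.
have D1 := @sdom_face _ _ B 3 [::] x [:: y; z; t] D.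
have D2 := @sdom_face _ _ B 3 [:: x] y [:: z; t] D.
have D3 := @sdom_face _ _ B 3 [:: x; y] z [:: t] D.
have D4 := @sdom_face _ _ B 3 [:: x; y; z] t [::] D.
rewrite /= !obstructionE //.
(* The nonabelian cocycle identity in [E]; the invariance of [chi] under conjugation makes it
   additive. *)
have e : (tri x y z * tri x z t)%g = ((tri y z t) ^ (beta [:: x; y])^-1 * tri x y t)%g.
  by rewrite /tri conjgE invgK !mulgA !mulgVK.
have := congr1 chi e.
rewrite (chiM (near_N_tri D4) (near_N_tri D2)).
rewrite (chiM (near_NJ _ (near_N_tri D1)) (near_N_tri D3)) (chiJ _ (near_N_tri D1)).
move=> /eqP; rewrite -subr_eq => /eqP <-; ring.
Qed.

Section Correct.
Variables (eta : seq Om -> R) (gam : Om -> E).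
Hypothesis uc_eta : uc B La UU 2 eta.
Hypothesis d_eta : forall s, sdom setH 3 s -> obstruction s = cobd eta s.
Hypothesis gam_lc : exists2 U, lev U & forall w w', eqw U w w' -> gam w = gam w'.
Hypothesis gam_near : forall w, exists2 x, Ga w x & eqm M x (gam w).

(** The failure of [gam], a locally constant approximate choice of values, to be transported by
    [beta] along an edge. *)
Definition gap w w' : E := (gam w')^-1 * gam w * beta [:: w; w'].

Lemma near_N_gap w w' : sdom setH 2 [:: w; w'] -> near_N (gap w w').
Proof.
move=> D; have [x xw ex] := gam_near w; have [y yw ey] := gam_near w'.
have [z cz ez] := beta_coset D; exists (y^-1 * (x * z)).
  exact: (adm_div AG yw (edge_cosetP AG cz xw)).
rewrite /gap -mulgA; apply: (eqmM Lb lM0); first by apply: (eqmV Lb lM0); apply: eqm_sub ey.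
apply: (eqmM Lb lM0); first exact: eqm_sub ex.
by apply: (eqm_sym Lb lM0); apply: eqm_sub ez.
Qed.

Lemma gap_triangle w w' w'' : sdom setH 3 [:: w; w'; w''] ->
  (chi (gap w' w'') + chi (gap w w') = chi (gap w w'') + chi (tri w w' w''))%R.
Proof.
move=> D; have [D1 D2 D3] := sdom3 D.
have n1 := near_N_gap D1; have n2 := near_N_gap D2; have n3 := near_N_gap D3.
have n4 := near_N_tri D.
rewrite -(chiJ (beta [:: w'; w'']) n1) -(chiJ (beta [:: w; w'']) n4).
rewrite -!chiM //; try exact: near_NJ.
by congr chi; rewrite /gap /tri !conjgE !mulgA !(mulgVK, mulgK).
Qed.

Definition defect : seq Om -> R := restr0 (sdom setH 2)
  (fun s => if s is [:: w; w'] then (chi (gap w w') - eta s)%R else 0%R).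

Lemma eta_dup w : eta [:: w; w] = 0%R.
Proof. exact: (uc_normalized uc_eta [::] w [::]). Qed.

(** By [gap_triangle] and [d_eta] the characters of the gaps and [eta] have the same coboundary, so
    their difference is a cocycle of degree one. Since [gam] is not equivariant, plain acyclicity is
    used, for which degree one is allowed. *)
Lemma defect_potential : exists2 xi : Om -> R,
  (exists2 U, lev U & forall w w', eqw U w w' -> xi w = xi w') &
  forall w w', sdom setH 2 [:: w; w'] -> eta [:: w; w'] = (chi (gap w w') + xi w - xi w')%R.
Proof.
have [||||xi [[U lU hU] _ _] hxi] := @acyclic p _ _ _ _ _ La TB false 1 setH 0 defect.
- by [].
- by [].
- split => //.
    have [U lU hU] := beta_ulc; have [V lV hV] := gam_lc.
    have [W lW hW] := uc_ulc uc_eta.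
    have [U1 lU1 sU1] := lev_cap La lU lV; have [U2 lU2 sU2] := lev_cap La lU1 lW.
    exists U2 => // s t D D' e; rewrite /defect !restr0E //.
    have e1 : eqs U setH s t by apply: eqs_sub e => // x /sU2 [] /sU1 [].
    have e2 : eqs V setH s t by apply: eqs_sub e => // x /sU2 [] /sU1 [].
    have e3 : eqs W setH s t by apply: eqs_sub e => // x /sU2 [].
    rewrite (hW _ _ D D' e3).
    have [x [y s2]] := sdom2P D; have [x' [y' t2]] := sdom2P D'.
    move: D D' e1 e2 {e3 e}; rewrite {}s2 {}t2 => D D' e1 [e2 [e3 _]].
    rewrite /gap (hU _ _ D D' e1) (hV x x') ?(hV y y') // => k;
      by [apply: e2; apply: finset.in_setT | apply: e3; apply: finset.in_setT].
  apply: normalized_restr0 => s1 x s2 D.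
  case: s1 D => [|y s1] D; last by case: D => _ /=; rewrite size_cat /= !addnS.
  case: s2 D => [|? ?] D; last by case: D.
  by rewrite /= /gap beta_dup mulg1 mulVg chi_one eta_dup subrr.
- move=> s D; have [x [y [z s3]]] := sdom3P D; move: D; rewrite {}s3 => D.
  have [D1 D2 D3] := sdom3 D; rewrite /= /defect !restr0E //.
  have := gap_triangle D; rewrite -(obstructionE D) (d_eta D) /= => e.
  have -> : chi (gap y z) = (chi (gap x z) +
    (eta [:: y; z] - (eta [:: x; z] - (eta [:: x; y] - 0))) - chi (gap x y))%R.
    by rewrite -e addrK.
  by ring.
exists (fun w => xi [:: w]).
  exists U => // w w' e; apply: hU; last by split => // k _; apply: e.
    by split => // k _; apply: (@step_const _ _ _ _ _ _ TB _ (w k)); rewrite /= eqxx.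
  by split => // k _; apply: (@step_const _ _ _ _ _ _ TB _ (w' k)); rewrite /= eqxx.
move=> w w' D; have := hxi _ D; rewrite /defect restr0E //= => e.
have -> : eta [:: w; w'] = (chi (gap w w') - (chi (gap w w') - eta [:: w; w']))%R by ring.
by rewrite e; ring.
Qed.

Section WithPotential.
Variable xi : Om -> R.
Hypothesis xi_lc : exists2 U, lev U & forall w w', eqw U w w' -> xi w = xi w'.
Hypothesis xiE : forall w w', sdom setH 2 [:: w; w'] ->
  eta [:: w; w'] = (chi (gap w w') + xi w - xi w')%R.

(* The values of [height w] on [Ga w] form a torsor under [chi]; fixing this
   value cuts [Ga w] down to a coset of the kernel of [chi]. *)
Definition height w x : R := (chi (x^-1 * gam w) + xi w)%R.

Lemma near_N_height w x : Ga w x -> near_N (x^-1 * gam w).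
Proof.
move=> xw; have [y yw ey] := gam_near w; exists (x^-1 * y); first exact: (adm_div AG xw yw).
by apply: (eqmM Lb lM0); [apply: (eqm_refl Lb) | apply: eqm_sub ey].
Qed.

Lemma heightM w x n : Ga w x -> N n -> height w (x * n) = (height w x - chi n)%R.
Proof.
move=> xw nN; have hn := near_N_N nN.
rewrite /height invgM -mulgA (chiM (near_NV hn) (near_N_height xw)) chi_inv //; ring.
Qed.

Lemma height_edge w w' x y : sdom setH 2 [:: w; w'] -> Ga w x -> Ga w' y ->
  near_N (y^-1 * x * beta [:: w; w']) /\
  chi (y^-1 * x * beta [:: w; w']) = (height w' y - height w x + eta [:: w; w'])%R.
Proof.
move=> D xw yw; have h1 := near_N_height xw; have h2 := near_N_height yw.
have h3 := near_N_gap D.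
have -> : y^-1 * x * beta [:: w; w'] =
    y^-1 * gam w' * gap w w' * (x^-1 * gam w)^-1 ^ beta [:: w; w'].
  by rewrite /gap conjgE invgM invgK !mulgA !(mulgVK, mulgK).
have h4 : near_N ((x^-1 * gam w)^-1 ^ beta [:: w; w']) by apply: near_NJ; apply: near_NV.
split; first by apply: near_NM h4; apply: near_NM.
rewrite chiM //; last exact: near_NM.
rewrite chiM // chiJ; last exact: near_NV.
by rewrite chi_inv // (xiE D) /height; ring.
Qed.

(** Normalizing by the height of 1 over [w1] keeps 1 in the new section. *)
Definition shrink w x := Ga w x /\ height w x = height w1 1.

Lemma height_near : exists2 U, lev U & forall w w' x x', eqw U w w' -> Ga w x ->
  eqm M0 x x' -> height w x = height w' x'.
Proof.
have [V lV hV] := gam_lc; have [W lW hW] := xi_lc.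
have [U lU sU] := lev_cap La lV lW.
exists U => // w w' x x' e xw ex.
have e2 : eqw V w w' by move=> k; have /sU [] := e k.
have e3 : eqw W w w' by move=> k; have /sU [] := e k.
rewrite /height (hV _ _ e2) (hW _ _ e3); congr (_ + _)%R.
rewrite -(hV _ _ e2); apply: (chi_eqm (near_N_height xw)).
by apply: (eqmM Lb lM0); [apply: (eqmV Lb lM0) | apply: (eqm_refl Lb)].
Qed.

Lemma shrink_near M' : lve M' -> exists2 U, lev U & forall w w' x, eqw U w w' ->
  shrink w x -> exists2 x', shrink w' x' & eqm M' x x'.
Proof.
move=> lM'; have [M1 lM1 sM1] := lev_cap Lb lM' lM0.
have [U lU hU] := adm_uniform La Lb AG lM1; have [V lV hV] := height_near.
have [W lW sW] := lev_cap La lU lV.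
exists W => // w w' x e [xw hx].
have e1 : eqw U w w' by move=> k; have /sW [] := e k.
have e2 : eqw V w w' by move=> k; have /sW [] := e k.
have [x' xw' ex] := hU _ _ e1 _ xw; exists x'; last by apply: eqm_sub ex => z /sM1 [].
split => //; rewrite -hx; apply/esym; apply: hV => //.
by apply: eqm_sub ex => z /sM1 [].
Qed.

Lemma chi_exp n i : N n -> N (n ^+ i) /\ chi (n ^+ i) = (chi n *+ i)%R.
Proof.
move=> nN; elim: i => [|i [IN IH]]; first by rewrite expg0 chi_one mulr0n; split => //; apply: (N_1 AG).
rewrite expgS mulrS -IH; split; first exact: (N_M AG).
by apply: chiM; apply: near_N_N.
Qed.

Lemma chi_surj (P : E -> Prop) n (d : R) :
  (forall i, P (n ^+ i)) -> N n -> chi n <> 0%R -> exists m, [/\ P m, N m & chi m = d].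
Proof.
move=> Pn nN /eqP n0; pose i := nat_of_ord (d / chi n)%R.
have [h1 h2] := chi_exp i nN; exists (n ^+ i); split => //; rewrite h2.
by rewrite -mulr_natl natr_Zp mulfVK.
Qed.

Lemma shrinkN n : N n -> shrink w1 n <-> chi n = 0%R.
Proof.
move=> nN; rewrite /shrink -[n]mul1g (heightM (N_1 AG) nN) mul1g.
split=> [[_ /eqP]|-> ]; last by rewrite subr0.
by rewrite -subr_eq0 addrAC subrr sub0r oppr_eq0 => /eqP.
Qed.

(** Compatibility of the heights with [F] and with [H] is reduced by this to edges, where the
    invariance of [beta] and [eta] decides; the reduction is the connectedness in
    [edge_constant]. *)
Lemma shrink_transport (tr : Om -> E -> R) :
  (forall w w' y y', sdom setH 2 [:: w; w'] -> shrink w y -> shrink w' y' ->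
     tr w y = tr w' y') ->
  (exists U M', [/\ lev U, lve M' & forall w w' y y', eqw U w w' -> eqm M' y y' ->
     shrink w y -> shrink w' y' -> tr w y = tr w' y']) ->
  (forall w, exists x, shrink w x) ->
  forall w y, shrink w y -> tr w y = tr w1 1.
Proof.
move=> ed [U [M' [lU lM' hU]]] tot.
have [Y hY] := choice tot.
have dup w : sdom setH 2 [:: w; w].
  by split => // k _; apply: (@step_const _ _ _ _ _ _ TB _ (w k)); rewrite /= eqxx.
have trY w y : shrink w y -> tr w y = tr w (Y w) by move=> yw; apply: ed (dup w) yw (hY w).
move=> w y /trY ->; rewrite (trY w1 1); last by split => //; apply: (N_1 AG).
apply: (edge_constant La TB (g := fun w => tr w (Y w))); last first.
  by move=> v v' D; apply: ed D (hY v) (hY v').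
have [V lV hV] := shrink_near lM'; have [W lW sW] := lev_cap La lU lV.
exists W => // v v' e.
have e1 : eqw U v v' by move=> k; have /sW [] := e k.
have e2 : eqw V v v' by move=> k; have /sW [] := e k.
have [y' yv' ey] := hV _ _ _ e2 (hY v).
by rewrite -(trY v' y' yv'); apply: hU e1 ey (hY v) yv'.
Qed.

Hypothesis chi_nt : exists2 n, N n & chi n = 1%R.

Lemma shrink_total w : exists x, shrink w x.
Proof.
have [n nN n1] := chi_nt; have [x xw] := adm_total AG w.
have [|||m [_ mN hm]] := @chi_surj (fun=> True) n (height w x - height w1 1)%R.
- by [].
- by [].
- by rewrite n1; apply/eqP; apply: oner_neq0.
exists (x * m); split; first exact: (adm_mulN AG).
by rewrite heightM // hm; ring.
Qed.

Lemma shrink_edge w w' x y : sdom setH 2 [:: w; w'] -> shrink w x -> shrink w' y ->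
  near_N (y^-1 * x * beta [:: w; w']) /\ chi (y^-1 * x * beta [:: w; w']) = eta [:: w; w'].
Proof.
move=> D [xw hx] [yw hy]; have [h1 h2] := height_edge D xw yw; split => //.
by rewrite h2 hx hy; ring.
Qed.

Lemma shrink_1 : shrink w1 1.
Proof. by split => //; apply: (N_1 AG). Qed.

Lemma shrink_lin f x w y : shrink (fun=> f) x -> shrink w y -> shrink (lmul f w) (x * y).
Proof.
move=> [xf hx] yw; split; first by case: yw => yw _; apply: (adm_lin AG).
have -> : height w1 1 = height (lmul f w1) (x * 1).
  by rewrite -hx mulg1; congr height; apply/funext => k; rewrite /lmul mulg1.
apply: (shrink_transport (tr := fun w y => height (lmul f w) (x * y))) yw => //; last exact: shrink_total.
- move=> v v' z z' D zv zv'; have [h1 h2] := shrink_edge D zv zv'.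
  have [_] := height_edge (dom_lmul f D) (adm_lin AG xf zv.1) (adm_lin AG xf zv'.1).
  have -> : beta [:: lmul f v; lmul f v'] = beta [:: v; v'] := beta_fs f D.
  have -> : eta [:: lmul f v; lmul f v'] = eta [:: v; v'] := uc_fs uc_eta f D.
  rewrite invgM -(mulgA _ x^-1) mulKg h2 => e.
  apply/esym/eqP; rewrite -subr_eq0; apply/eqP.
  have -> : (height (lmul f v') (x * z') - height (lmul f v) (x * z))%R =
    (height (lmul f v') (x * z') - height (lmul f v) (x * z) + eta [:: v; v'] - eta [:: v; v'])%R by ring.
  by rewrite -e subrr.
- have [U lU hU] := height_near; exists U, M0; split => // v v' z z' e ez zv zv'.
  apply: hU; last by apply: (eqmM Lb lM0) ez; apply: (eqm_refl Lb).
    by move=> k; rewrite /lmul /eqm invgM mulgA mulgVK; apply: e.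
  by apply: (adm_lin AG xf); case: zv.
Qed.

Lemma shrink_act h w x : shrink w x -> shrink (hact h w) (b h x).
Proof.
move=> xw; split; first by case: xw => xw _; apply: (adm_act AG).
have -> : height w1 1 = height (hact h w1) (b h 1).
  rewrite (lact1r Lb); congr height.
  by apply/funext => k; rewrite hactE (lact1r La).
apply: (shrink_transport (tr := fun w y => height (hact h w) (b h y))) xw => //; last exact: shrink_total.
- move=> v v' z z' D zv zv'; have [h1 h2] := shrink_edge D zv zv'.
  have [_] := height_edge (dom_hs La TB h D) (adm_act AG h zv.1) (adm_act AG h zv'.1).
  have -> : beta [:: hact h v; hact h v'] = b h (beta [:: v; v']) := beta_hs h D.
  have -> : eta [:: hact h v; hact h v'] = eta [:: v; v'] := uc_hs uc_eta h D.
  rewrite -(lactV Lb) -!(lactD Lb) chiA // h2 => e.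
  apply/esym/eqP; rewrite -subr_eq0; apply/eqP.
  have -> : (height (hact h v') (b h z') - height (hact h v) (b h z))%R =
    (height (hact h v') (b h z') - height (hact h v) (b h z) + eta [:: v; v'] - eta [:: v; v'])%R by ring.
  by rewrite -e subrr.
- have [U lU hU] := height_near; exists U, M0; split => // v v' z z' e ez zv zv'.
  apply: hU; last by apply: (eqm_act Lb lM0) ez.
    by move=> k; apply: (eqm_act La lU); apply: e.
  by apply: (adm_act AG); case: zv.
Qed.

(** If some [S]-fixed element of [N] has nonzero character, a power of it corrects the height of the
    old [z]. Otherwise [S] belongs to [UU]; then [eta] vanishes on the edge and [z] differs from
    [beta] by an [S]-fixed element close to [N], whose character is zero, so the old [z] already
    serves. *)
Lemma shrink_fix w w' S x : simplex B setH [:: w; w'] -> S \subset stab [:: w; w'] ->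
  shrink w x -> exists z, (forall h, h \in S -> b h z = z) /\ shrink w' (x * z).
Proof.
move=> X Sst [xw hx]; have D : sdom setH 2 [:: w; w'] by [].
have [z [zS xzw']] := adm_fix AG X Sst xw.
pose d := (height w' (x * z) - height w1 1)%R.
have [[n [nN nS n0]]|none] := pselect (exists n, [/\ N n, forall h, h \in S -> b h n = n & chi n <> 0%R]).
  have [|m [mS mN hm]] := @chi_surj (fun m => forall h, h \in S -> b h m = m) n d _ nN n0.
    move=> i h hS; elim: i => [|i IH]; first by rewrite expg0 (lact1r Lb).
    by rewrite expgS (lactD Lb) nS // IH.
  exists (z * m); split; first by move=> h hS; rewrite (lactD Lb) zS // mS.
  rewrite mulgA; split; first exact: (adm_mulN AG).
  by rewrite heightM // hm /d; ring.
have hS : UU S.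
  apply/asboolP => n nN nS; apply: contrapT => n0; by apply: none; exists n.
exists z; split => //; split => //.
have [z0 c0 e0] := beta_coset D.
have bS h : h \in S -> b h (beta [:: w; w']) = beta [:: w; w'].
  move=> /(fintype.subsetP Sst) /stabP [f ef].
  by rewrite -beta_hs // ef beta_fs.
have e1 : eqm M (z^-1 * z0) (z^-1 * beta [:: w; w']).
  by apply: (eqmM Lb lM); [apply: (eqm_refl Lb) | apply: (eqm_sym Lb)].
have n1 : N (z^-1 * z0).
  have := adm_div AG xzw' (edge_cosetP AG c0 xw).
  by rewrite invgM -mulgA mulKg.
have yS h : h \in S -> b h (z^-1 * beta [:: w; w']) = z^-1 * beta [:: w; w'].
  by move=> hS'; rewrite (lactD Lb) (lactV Lb) zS // bS.
have cz := M2 (asboolW hS) n1 e1 yS.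
have e0' : eta [:: w; w'] = 0%R.
  apply: (uc_sing uc_eta D); apply: (family_UU.1 S) hS; exact: Sst.
have [_] := height_edge D xw xzw'.
rewrite invgM mulgVK cz e0' hx addr0 => /eqP.
by rewrite eq_sym subr_eq0 => /eqP.
Qed.

Lemma admissible_shrink : admissible a b lev lve B rho shrink.
Proof.
have diff w x y : shrink w x -> shrink w y -> N (y * x^-1) /\ chi (y * x^-1) = 0%R.
  move=> [xw hx] [yw hy]; have nN := adm_div AG xw yw.
  split; first exact: (adm_quot AG xw yw).
  have := heightM xw nN; rewrite mulKVg hx hy => /eqP.
  rewrite -subr_eq0 opprB addrC subrK => /eqP e.
  rewrite -e -(chiJ x^-1 (near_N_N nN)); congr chi.
  by rewrite conjgE invgK !mulgA mulgV mul1g.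
split.
- move=> w x h; have xw : Ga w x.
    apply: (adm_closed AG) => U M' lU lM'; have [w' [x' [[xw' _] e e']]] := h U M' lU lM'.
    by exists w', x'.
  split => //; have [U lU hU] := height_near.
  have [w' [x' [[xw' hx'] e e']]] := h U M0 lU lM0.
  by rewrite -hx'; apply: hU.
- exact: shrink_total.
- by move=> w x y xw yw; have [nN e] := diff w x y xw yw; apply/(shrinkN nN).
- exact: shrink_1.
- exact: shrink_lin.
- exact: shrink_act.
- move=> n x sn; have nN : N n by case: sn.
  move: sn => /(shrinkN nN) e; apply/(shrinkN (adm_conj AG x nN)).
  by rewrite chiJ //; apply: near_N_N.
- exact: shrink_fix.
- by move=> w x [xw _]; apply: (adm_rho AG).
Qed.

Lemma shrink_proper : exists2 n, N n & ~ shrink w1 n.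
Proof.
have [n nN n1] := chi_nt; exists n => // /(shrinkN nN); rewrite n1.
by apply/eqP; apply: oner_neq0.
Qed.

End WithPotential.
End Correct.

End WithEdgeSection.
End Shrinking.

(** * Descent to a single-valued section *)

Section Lifting.
Variables (p : nat) (H : finGroupType) (F E : groupType).
Variables (a : H -> F -> F) (b : H -> E -> E).
Variables (lev : set (set F)) (lve : set (set E)) (B : H -> set F).
Hypotheses (La : leveled_action a lev) (TB : tree_family p a lev B).
Hypotheses (Lb : leveled_action b lve) (chE : has_characters p b lve).
Hypotheses (pp : prime p) (pH : p.-group [set: H]).
Local Notation Om := (H -> F).
Local Notation R := ('F_p : comNzRingType).
Implicit Types (U : set F) (M : set E).
Implicit Types (S K : {group H}) (w : Om) (x y z n m : E).
Local Notation w1 := ((fun=> 1) : Om).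
Local Notation hact := (hact a).
Variables (rho : E -> Om) (sec : Om -> E).
Hypothesis rhoM : forall x y k, rho (x * y) k = rho x k * rho y k.
Hypothesis rho_act : forall h x, rho (b h x) = hact h (rho x).
Hypothesis rho_cont : forall U, lev U -> exists2 M, lve M &
  forall x y, eqm M x y -> forall k, eqm U (rho x k) (rho y k).
Hypothesis secK : forall w, rho (sec w) = w.
Hypothesis sec_act : forall h w, sec (hact h w) = b h (sec w).
Local Notation admissible := (admissible a b lev lve B rho).

Lemma admissible_smaller (Ga : Om -> E -> Prop) : admissible Ga ->
  (exists2 n, Ga w1 n & n <> 1) ->
  exists Ga', [/\ admissible Ga', forall w x, Ga' w x -> Ga w x
    & exists2 n, Ga w1 n & ~ Ga' w1 n].
Proof.
move=> AG nt.
have [M0 [chi [lM0 chi_nt chM ch0 ch_inv]]] := chE (N_1 AG) (@N_div _ _ _ _ _ _ _ _ _ _ AG)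
  (@adm_conj _ _ _ _ _ _ _ _ _ _ AG) (@N_act _ _ _ _ _ _ _ _ La _ _ AG) nt.
have nearP x : near_N Ga M0 x -> exists n m, [/\ Ga w1 n, M0 m & x = n * m].
  by move=> [n nN e]; exists n, (n^-1 * x); rewrite mulKVg.
have chiM x y : near_N Ga M0 x -> near_N Ga M0 y -> chi (x * y) = (chi x + chi y)%R.
  by move=> /nearP hx /nearP hy; apply: chM.
have chiJ x y : near_N Ga M0 x -> chi (x ^ y) = chi x.
  by move=> /nearP /ch_inv [].
have chiA x h : near_N Ga M0 x -> chi (b h x) = chi x.
  by move=> /nearP /ch_inv [].
have [M [lM sM M2]] := chi_fixed_level La Lb AG lM0 chiM ch0.
have [beta [bulc bfs bhs bdup bcos]] := edge_section La TB Lb AG lM.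
have fU := family_UU La Lb AG lM0 chiA.
have uo := uc_obstruction La TB Lb AG lM0 ch0 chiA lM sM M2 bulc bfs bhs bdup bcos.
have co := obstruction_cocycle Lb AG lM0 chiM chiJ lM sM bcos.
have [eta ueta deta] := relative_acyclic TB pp pH fU uo co.
have [U lU hU] := adm_uniform La Lb AG lM.
(* Choosing values at representatives of the classes modulo [U] makes the choice locally constant;
   it stays within [M] of the section by [adm_uniform]. *)
pose rep w : Om := xget w1 (fun v : Om => eqw U w v).
have repP w : eqw U w (rep w).
  by rewrite /rep; case: xgetP => [v -> //|/(_ w) []] k; apply: (eqm_refl La).
have repE w w' : eqw U w w' -> rep w = rep w'.
  move=> e; rewrite /rep; congr xget; apply/funext => v; apply/propext.
  by split=> h k; [apply: (eqm_trans La lU (eqm_sym La lU (e k)))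
                  |apply: (eqm_trans La lU (e k))]; apply: h.
have [gam0 hgam] := choice (adm_total AG).
have glc : exists2 V, lev V & forall w w', eqw V w w' -> gam0 (rep w) = gam0 (rep w').
  by exists U => // w w' /repE ->.
have gnear w : exists2 x, Ga w x & eqm M x (gam0 (rep w)).
  have ew : eqw U (rep w) w by move=> k; apply: (eqm_sym La lU); apply: repP.
  have [x xw ex] := hU _ _ ew _ (hgam (rep w)); exists x => //.
  exact: (eqm_sym Lb lM).
have [xi xlc xiE] := defect_potential TB Lb AG lM0 chiM ch0 chiJ lM sM bulc bdup bcos
  ueta deta glc gnear.
exists (shrink Ga chi (fun w => gam0 (rep w)) xi); split.
- exact: (admissible_shrink TB Lb AG lM0 chiM ch0 chiJ chiA lM sM M2 bfs bhs bcos ueta glc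
    gnear xlc xiE chi_nt).
- by move=> w x [].
- exact: (shrink_proper Lb AG lM0 chiM ch0 sM gnear _ chi_nt).
Qed.

(** Values over the members of the chain, and the fixed elements of [adm_fix], are chosen separately
    and cluster by compactness; the closedness of each member puts the limit in the intersection. *)
Lemma admissible_chain (D : Type) (Ga : D -> Om -> E -> Prop) : inhabited D ->
  (forall d, admissible (Ga d)) ->
  (forall d e, (forall w x, Ga d w x -> Ga e w x) \/ (forall w x, Ga e w x -> Ga d w x)) ->
  admissible (fun w x => forall d, Ga d w x).
Proof.
move=> iD AG tot; have [d0] := iD.
have limit (x : D -> E) : exists y, forall M d, lve M -> exists2 e,
    (forall w x, Ga e w x -> Ga d w x) & eqm M y (x e).
  have [|||y hy] := lev_compact Lb (D := D) (le := fun d e => forall w x, Ga e w x -> Ga d w x)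
    (fun d (i : 'I_1) => x d).
  - by [].
  - by move=> d e; case: (tot d e) => h; [exists d | exists e].
  - by move=> d e f h1 h2 w y /h2 /h1.
  by exists (y ord0) => M d lM; have [e de he] := hy M d lM; exists e.
have closed_near w y : (forall M d, lve M -> exists e z,
    [/\ forall w x, Ga e w x -> Ga d w x, eqm M y z & Ga e w z]) -> forall d, Ga d w y.
  move=> h d; apply: (adm_closed (AG d)) => U M lU lM; have [e [z [de ez zw]]] := h M d lM.
  by exists w, z; split => //; [apply: de | move=> k; apply: (eqm_refl La)].
split.
- move=> w x h d; apply: (adm_closed (AG d)) => U M lU lM.
  by have [w' [x' [xw ew ex]]] := h U M lU lM; exists w', x'.
- move=> w; have [x hx] := choice (fun d => adm_total (AG d) w).
  have [y hy] := limit x; exists y; apply: closed_near => M d lM.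
  by have [e de ey] := hy M d lM; exists e, (x e).
- by move=> w x y xw yw d; apply: (adm_quot (AG d) (xw d) (yw d)).
- by move=> d; apply: (adm_1 (AG d)).
- by move=> f x w y xf yw d; apply: (adm_lin (AG d)).
- by move=> h w x xw d; apply: (adm_act (AG d)).
- by move=> n x nN d; apply: (adm_conj (AG d)).
- move=> w w' S x X Sst xw; have [z hz] := choice (fun d => adm_fix (AG d) X Sst (xw d)).
  have [y hy] := limit z; exists y; split.
    move=> h hS; apply: (eqm_sep Lb) => M lM; have [e _ ey] := hy M d0 lM.
    have := eqm_act Lb lM h ey; rewrite (hz e).1 // => ey'.
    exact: (eqm_trans Lb lM ey' (eqm_sym Lb lM ey)).
  apply: closed_near => M d lM; have [e de ey] := hy M d lM; exists e, (x * z e); split => //.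
    by apply: (eqmM Lb lM) ey; apply: (eqm_refl Lb).
  by have [] := hz e.
- by move=> w x xw; apply: (adm_rho (AG d0)).
Qed.

Lemma admissible_minimal : exists2 Ga, admissible Ga & forall n, Ga w1 n -> n = 1.
Proof.
have A0 := admissible_graph B La rhoM rho_act rho_cont secK sec_act.
pose T := {Ga : Om -> E -> Prop | admissible Ga}.
(* The order is reverse inclusion, so a maximal element is a minimal multivalued section. *)
pose R (s t : T) := `[< forall w x, sval t w x -> sval s w x >].
have [||||[Ga AG] minG] := @Zorn T R.
- by move=> t; apply/asboolP.
- by move=> r s t /asboolP rs /asboolP st; apply/asboolP => w x /st /rs.
- move=> [s As] [t At] /asboolP /= st /asboolP /= ts; apply: eq_exist.
  by apply/funext => w; apply/funext => x; apply/propext; split=> [/ts|/st].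
- move=> A totA; have [[d Ad]|nA] := pselect (exists d, A d); last first.
    by exists (exist _ _ A0) => s As; case: nA; exists s.
  pose D := {d : T | A d}.
  have AI : admissible (fun w x => forall d : D, sval (sval d) w x).
    apply: admissible_chain; first by constructor; exists d.
      by move=> [e Ae]; exact: (svalP e).
    move=> [e Ae] [f Af] /=; case: (totA _ _ Ae Af) => /asboolP h; [right | left]; exact: h.
  exists (exist _ _ AI) => s As; apply/asboolP => w x /= h.
  exact: (h (exist _ s As)).
exists Ga => // n nN; apply: contrapT => n1.
have [|Ga' [AG' sG [m mN nm]]] := admissible_smaller AG; first by exists n.
have /(congr1 sval) /= e := minG (exist _ Ga' AG') (asboolT sG).
by apply: nm; rewrite e.
Qed.

Theorem equivariant_lifting : exists g : Om -> E,
  [/\ forall w, rho (g w) = w, g w1 = 1,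
      forall f w, g (lmul f w) = g (fun=> f) * g w,
      forall h w, g (hact h w) = b h (g w)
    & forall M, lve M -> exists2 U, lev U & forall w w', eqw U w w' -> eqm M (g w) (g w')].
Proof.
have [Ga AG N1] := admissible_minimal.
have uniq w x y : Ga w x -> Ga w y -> x = y.
  move=> xw yw; have /N1 e := adm_div AG xw yw.
  by apply: (mulgI x^-1); rewrite e mulVg.
have [g hg] := choice (adm_total AG); exists g; split.
- by move=> w; apply: (adm_rho AG).
- by apply: (N1 _ (hg w1)).
- by move=> f w; apply: uniq (hg _) (adm_lin AG (hg _) (hg _)).
- by move=> h w; apply: uniq (hg _) (adm_act AG h (hg _)).
- move=> M lM; have [U lU hU] := adm_uniform La Lb AG lM; exists U => // w w' e.
  by have [x' xw' ex] := hU _ _ e _ (hg w); rewrite (uniq _ _ _ (hg w') xw').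
Qed.

End Lifting.

Local Open Scope classical_set_scope.
Local Open Scope card_scope.
Local Open Scope group_scope.

(** * Profinite groups *)

Lemma compact_directed (T : topologicalType) (I : Type) (C : I -> set T) :
  compact [set: T] -> inhabited I ->
  (forall i j, exists k, C k `<=` C i `&` C j) ->
  (forall i, closed (C i)) -> (forall i, C i !=set0) ->
  exists y, forall i, C i y.
Proof.
move=> cT [i0] dC clC neC.
have FF : Filter (filter_from [set: I] C) by apply: filter_fromT_filter => //; exists i0.
have PF : ProperFilter (filter_from [set: I] C) by apply: filter_from_proper.
have [//|y [_ cy]] := cT _ PF; first by exists i0.
by exists y => i; apply: (clC i) => D /cy; apply; exists i.
Qed.

Lemma ultra_compact (T : topologicalType) (D : Type) (Ul : set_system D) (f : D -> T) :
  UltraFilter Ul -> compact [set: T] -> exists y : T, f @ Ul --> y.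
Proof.
move=> UU cT; have [|y [_ cy]] := cT (fmap f Ul) (fmap_proper_filter f ultra_proper); first exact: filterT.
exists y => A yA; case: (in_ultra_setVsetC (f @^-1` A) UU) => // nA.
by have [z [nz Az]] := cy (~` A) A nA yA.
Qed.

(** The intersection [Q] of the clopen sets containing [x] is connected: a separation of [Q] extends
    to disjoint open sets by normality, some clopen set around [x] lies in their union by
    compactness, and cutting it gives a smaller clopen set. Total disconnectedness then reduces [Q]
    to [x]. *)
Lemma profinite_zero_dimensional (T : topologicalType) :
  profinite_space T -> zero_dimensional T.
Proof.
move=> [cT hT tT] x y xy; apply: contrapT => no.
pose J := {U : set T | clopen U /\ U x}.
pose Q := \bigcap_(U in [set U : set T | clopen U /\ U x]) U.
have Qx : Q x by move=> U [].
have Qy : Q y by move=> U [cU Ux]; apply: contrapT => Uy; apply: no; exists U.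
have clQ : closed Q by apply: closed_bigI => U [[]].
suff cQ : connected Q.
  have /(_ y Qy) := connected_component_max Qx (@subsetT _ _) cQ.
  by rewrite tT // => /= yx; move: xy; rewrite yx eqxx.
move=> B neB [O oO BO] [C cC BC].
have clB : closed B by rewrite BC; apply: closedI.
have clB' : closed (Q `&` ~` O) by apply: closedI => //; apply: open_closedC.
have nB : set_nbhs B (~` (Q `&` ~` O)).
  apply/set_nbhsP; exists (~` (Q `&` ~` O)); split => //; first exact: closed_openC.
  by rewrite BO => z [_ Oz] [_ /(_ Oz)].
have [V /set_nbhsP [O1 [oO1 BO1 O1V]] cV] := compact_normal hT cT clB nB.
pose O2 := ~` closure V.
have oO2 : open O2 by apply: closed_openC; apply: closed_closure.
have O12 z : O1 z -> O2 z -> False by move=> /O1V /subset_closure Vz /(_ Vz).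
have QO z : Q z -> O1 z \/ O2 z.
  move=> Qz; have [Oz|nOz] := pselect (O z); first by left; apply: BO1; rewrite BO.
  by right => /cV; apply.
have [U cU UO] : exists2 U : set T, clopen U /\ U x & forall z, U z -> O1 z \/ O2 z.
  apply: contrapT => nU.
  have [||||z hz] := @compact_directed T J (fun U => sval U `&` ~` (O1 `|` O2)) cT.
  - by constructor; exists setT; split => //; apply: clopenT.
  - move=> [U [cU Ux]] [U' [cU' Ux']].
    by exists (exist _ (U `&` U') (conj (clopenI cU cU') (conj Ux Ux'))) => z /= [[]].
  - move=> [U [[oU cU] Ux]]; apply: closedI => //; apply: open_closedC; exact: openU.
  - move=> [U [cU Ux]] /=; apply: contrapT => h; apply: nU; exists U => // z Uz.
    by apply: contrapT => nz; apply: h; exists z.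
  have Qz : Q z by move=> U hU; have [] := hz (exist _ U hU).
  by have [_] := hz (exist _ setT (conj clopenT I)); apply; apply: QO.
case: cU => cU Ux.
have [oU clU] := cU.
have cl1 (P P' : set T) : open P -> open P' -> (forall z, P z -> P' z -> False) ->
    (forall z, U z -> P z \/ P' z) -> P x -> Q `<=` P.
  move=> oP oP' PP' UP Px; have e : U `&` P = U `&` ~` P'.
    by apply/seteqP; split=> z [Uz h]; split => //; [apply: PP' | case: (UP z Uz)].
  have c : clopen (U `&` P).
    split; first exact: openI.
    by rewrite e; apply: closedI => //; apply: open_closedC.
  by move=> z Qz; have [] := Qz (U `&` P) (conj c (conj Ux Px)).
have [O1x|O2x] := QO x Qx.
  apply/seteqP; split=> [z|z Qz]; first by rewrite BO => -[].
  rewrite BO; split => //; apply: contrapT => nOz.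
  apply: (O12 z); first exact: (cl1 O1 O2 oO1 oO2 O12 UO O1x).
  by move=> /cV; apply.
have [b Bb] := neB; exfalso; apply: (O12 b); first exact: BO1.
apply: (cl1 O2 O1 oO2 oO1 _ _ O2x) => [z h1 h2|z /UO [|]|]; try by [apply: (O12 z)|right|left].
by move: Bb; rewrite BO => -[].
Qed.

Lemma profinite_clopen (T : topologicalType) (x : T) (O : set T) :
  profinite_space T -> nbhs x O -> exists C, [/\ clopen C, C x & C `<=` O].
Proof.
move=> pT /(zero_dimensional_cvg _ (profinite_zero_dimensional pT)).
by case: pT => cT hT _ /(_ hT cT) [C [Cx cC] CO]; exists C.
Qed.

(** * Open normal subgroups invariant under a finite group *)

Section Group.
Variable G : topologicalGroupType.

Lemma mulg_cvg (T : Type) (Fi : set_system T) (f g : T -> G) x y : Filter Fi ->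
  f @ Fi --> x -> g @ Fi --> y -> (fun t => f t * g t) @ Fi --> x * y.
Proof.
move=> FF fx gy; apply: (@cvg_comp _ _ _ (fun t => (f t, g t)) (fun u => u.1 * u.2) _
  (nbhs (x, y))); first exact: cvg_pair.
exact: (@mulg_continuous G (x, y)).
Qed.

Lemma mull_continuous (x : G) : continuous (fun y => x * y).
Proof. by move=> y; apply: mulg_cvg; [apply: cvg_cst | apply: cvg_id]. Qed.

Variables (H : finGroupType) (a : H -> G -> G).
Hypotheses (pG : profinite_space G) (ac : continuous_action a).

Definition inv_level (U : set G) := open_normal_subgroup U /\ forall h x, U x -> U (a h x).

Lemma action_continuous h : continuous (a h).
Proof.
case: ac => _ _ _ ca x; apply: (@cvg_comp _ _ _ (fun y => (h : discrete_topology H, y))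
  (fun u : discrete_topology H * G => a u.1 u.2) _ (nbhs (h : discrete_topology H, x))).
  by apply: (cvg_pair (cvg_cst (h : discrete_topology H)) cvg_id).
exact: (ca (h, x)).
Qed.

Lemma inv_level_base (O : set G) : nbhs 1 O -> exists2 U, inv_level U & U `<=` O.
Proof.
move=> O1; have [C [[oC clC] C1 CO]] := profinite_clopen pG O1.
case: (ac) => a1 aM aD _.
have ah1 h : a h 1 = 1 by apply: (mulgI (a h 1)); rewrite -aD !mulg1.
have ahV h x : a h x^-1 = (a h x)^-1 by apply: (mulgI (a h x)); rewrite -aD !mulgV.
(* Quantifying over both translates makes [W] a normal subgroup at once; it is
   open by compactness of [G * G]. *)
pose W : set G := fun x => forall h (y z : G), C (y * a h x * z) <-> C (y * z).
have WV x : W x -> W x^-1.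
  by move=> Wx h y z; rewrite -(Wx h _ z) ahV mulgVK.
exists W; last first.
  by move=> x /(_ 1 1 1); rewrite a1 !mulg1 mul1g => hx; apply: CO; apply/hx.
split; last by move=> h x Wx k y z; rewrite -aM; apply: Wx.
split.
- rewrite openE => x Wx.
  apply: (@filter_forall _ _ (fun h x' => forall y z, C (y * a h x' * z) <-> C (y * z))) => h.
  have cG : compact [set: G * G] by rewrite -setXTT; apply: compact_setX; case: pG.
  have := (compact_near_coveringP [set: G * G]).1 cG G (nbhs x)
    (fun x' u => C (u.1 * a h x' * u.2) <-> C (u.1 * u.2)).
  move=> cov; suff: nbhs x (fun x' => [set: G * G] `<=`
      (fun u => C (u.1 * a h x' * u.2) <-> C (u.1 * u.2))).
    by apply: filterS => x' h' y z; apply: (h' (y, z)).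
  apply: cov.
  move=> [y z] _ /=.
  have c1 : (fun v : (G * G) * G => v.1.1 * a h v.2 * v.1.2) @ nbhs ((y, z), x) --> y * a h x * z.
    apply: mulg_cvg; first apply: mulg_cvg.
    - by apply: (@cvg_comp _ _ _ fst fst _ (nbhs (y, z))); apply: cvg_fst.
    - by apply: (@cvg_comp _ _ _ snd (a h) _ (nbhs x)); [apply: cvg_snd | apply: action_continuous].
    - by apply: (@cvg_comp _ _ _ fst snd _ (nbhs (y, z))); [apply: cvg_fst | apply: cvg_snd].
  have c2 : (fun v : (G * G) * G => v.1.1 * v.1.2) @ nbhs ((y, z), x) --> y * z.
    apply: mulg_cvg.
    - by apply: (@cvg_comp _ _ _ fst fst _ (nbhs (y, z))); apply: cvg_fst.
    - by apply: (@cvg_comp _ _ _ fst snd _ (nbhs (y, z))); [apply: cvg_fst | apply: cvg_snd].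
  have [Cyz|nCyz] := pselect (C (y * z)).
    have n1 : nbhs (y * a h x * z) C by apply: open_nbhs_nbhs; split => //; apply/(Wx h).
    have n2 : nbhs (y * z) C by apply: open_nbhs_nbhs.
    have h1 : nbhs ((y, z), x) (fun v => C (v.1.1 * a h v.2 * v.1.2)) := c1 _ n1.
    have h2 : nbhs ((y, z), x) (fun v => C (v.1.1 * v.1.2)) := c2 _ n2.
    by apply: filterS (filterI h1 h2) => v [/= ? ?].
  have oC' : open (~` C) by apply: closed_openC.
  have n1 : nbhs (y * a h x * z) (~` C) by apply: open_nbhs_nbhs; split => //; move/(Wx h).
  have n2 : nbhs (y * z) (~` C) by apply: open_nbhs_nbhs.
  have h1 : nbhs ((y, z), x) (fun v => ~ C (v.1.1 * a h v.2 * v.1.2)) := c1 _ n1.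
  have h2 : nbhs ((y, z), x) (fun v => ~ C (v.1.1 * v.1.2)) := c2 _ n2.
  by apply: filterS (filterI h1 h2) => v [/= ? ?].
- by move=> h y z; rewrite ah1 mulg1.
- by move=> x y Wx /WV Wy h s t; rewrite aD mulgA -(mulgA _ _ t) (Wx h) mulgA (Wy h).
- move=> x g Wx h y z; rewrite conjgE !aD ahV !mulgA -(mulgA _ (a h g)) (Wx h).
  by rewrite mulgA mulgVK.
Qed.

Lemma level_nbhs U x : inv_level U -> nbhs x (eqm U x).
Proof.
move=> [[oU U1 _ _] _]; have := @mull_continuous x^-1 x U.
by apply; rewrite mulVg; apply: open_nbhs_nbhs.
Qed.

Lemma nbhs_level x O : nbhs x O <-> exists2 U, inv_level U & forall y, eqm U x y -> O y.
Proof.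
split=> [xO|[U lU UO]]; last by apply: filterS UO _; apply: level_nbhs.
have O1 : nbhs 1 (fun y => O (x * y)).
  by apply: (@mull_continuous x 1); rewrite mulg1.
have [U lU UO] := inv_level_base O1; exists U => // y /UO /=.
by rewrite mulKVg.
Qed.

Lemma leveled_inv_level : leveled_action a inv_level.
Proof.
case: (ac) => a1 aM aD _.
split=> //.
- exists setT; split => //; split => //; exact: openT.
- by move=> U [[]].
- by move=> U x y [[_ _ h _] _]; apply: h.
- by move=> U x y [[_ _ _ h] _]; apply: h.
- by move=> U h x [_]; apply.
- move=> U V [[oU U1 dU cU] aU] [[oV V1 dV cV] aV]; exists (U `&` V); last by move=> x [].
  split; last by move=> h x [? ?]; split; [apply: aU | apply: aV].
  split; first exact: openI.
  + by split.
  + by move=> x y [? ?] [? ?]; split; [apply: dU | apply: dV].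
  + by move=> x y [? ?]; split; [apply: cU | apply: cV].
- move=> x hx; apply: contrapT => x1; case: pG => _ hG _.
  have [|U lU UO] := @inv_level_base (~` [set x]).
    apply: open_nbhs_nbhs; split; last by move=> /esym.
    apply: closed_openC; apply: accessible_closed_set1; exact: hausdorff_accessible.
  by apply: (UO x); first exact: hx.
- move=> I D le x iD dD tD.
  have FF : Filter (filter_from [set: D] le).
    apply: filter_fromT_filter; first by case: iD => d; exists d.
    move=> d e; have [f df ef] := dD d e; exists f => g fg.
    by split; [apply: tD fg | apply: tD fg].
  have PF : ProperFilter (filter_from [set: D] le).
    by apply: filter_from_proper => d _; have [f df _] := dD d d; exists f.
  have [Ul [UUl sU]] := ultraFilterLemma PF.
  have hx i : exists z : G, (fun d => x d i) @ Ul --> z by apply: ultra_compact; case: pG.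
  have [y hy] := choice hx.
  exists y => U d lU.
  have h : Ul (fun e => forall i, U ((y i)^-1 * x e i)).
    apply: (@filter_forall _ _ (fun i e => U ((y i)^-1 * x e i))) => i.
    by apply: (hy i (eqm U (y i))); apply: level_nbhs.
  have h' : Ul (le d) by apply: sU; exists d.
  have [e [de ue]] := filter_ex (@filterI _ Ul _ _ _ h' h).
  by exists e.
Qed.

End Group.

Lemma coset_enumeration (G : groupType) (N : set G) m :
  N 1 -> (forall x y, N x -> N y -> N (x * y^-1)) ->
  [set (fun y => x * y) @` N | x in [set: G]] #= `I_m ->
  exists q : G -> 'I_m, (forall x y, q x = q y <-> eqm N x y) /\ forall i, exists x, q x = i.
Proof.
move=> N1 Nd /card_set_bijP [f [ff fi fs]].
have NV x : N x -> N x^-1 by move=> Nx; rewrite -[_^-1]mul1g; apply: Nd.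
have NM x y : N x -> N y -> N (x * y) by move=> Nx Ny; rewrite -[y]invgK; apply: Nd => //; apply: NV.
pose C x := (fun y => x * y) @` N.
have Cx x : [set C x | x in [set: G]] (C x) by exists x.
have fC x : f (C x) < m by exact: (ff (C x) (Cx x)).
have CE x y : C x = C y <-> eqm N x y.
  split=> [e|e].
    have : C y x by rewrite -e; exists 1; rewrite ?mulg1.
    by move=> [z Nz <-]; rewrite /eqm invgM mulgVK; apply: NV.
  apply/seteqP; split=> z [t Nt <-]; last first.
    by exists (x^-1 * y * t); [apply: NM | rewrite !mulgA mulgV mul1g].
  exists (y^-1 * x * t); last by rewrite !mulgA mulgV mul1g.
  by apply: NM => //; have := NV _ e; rewrite invgM invgK.
exists (fun x => Ordinal (fC x)); split=> [x y|i].
  split=> [[e]|/CE e]; last by apply/val_inj; rewrite /= e.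
  by apply/CE; apply: fi e; rewrite inE.
have [_ [x _ <-] e] := fs i (ltn_ord i).
by exists x; apply/val_inj.
Qed.

(** * Finite quotients as permutation groups *)

Section Cosets.
Variables (G : groupType) (N : set G) (m : nat) (q : G -> 'I_m).
Hypotheses (N1 : N 1) (Nd : forall x y, N x -> N y -> N (x * y^-1)).
Hypothesis NJ : forall x y, N x -> N (x ^ y).
Hypothesis qP : forall x y, q x = q y <-> eqm N x y.
Hypothesis q_surj : forall i, exists x, q x = i.

Definition coset_rep i := sval (cid (q_surj i)).

Lemma coset_repK i : q (coset_rep i) = i.
Proof. exact: (svalP (cid (q_surj i))). Qed.

Lemma q_mulr x y z : q x = q y -> q (x * z) = q (y * z).
Proof.
move=> /qP xy; apply/qP; rewrite /eqm.
have -> : (x * z)^-1 * (y * z) = (x^-1 * y) ^ z by rewrite conjgE invgM !mulgA.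
exact: NJ.
Qed.

(** Permutations compose from left to right, so right translations of the cosets give a
    homomorphism. It realizes the quotient by [N] inside the concrete group ['S_m]. *)
Definition rtrans_fun x i := q (coset_rep i * x).

Lemma rtrans_funE x y : rtrans_fun x (q y) = q (y * x).
Proof. by apply: q_mulr; rewrite coset_repK. Qed.

Lemma rtrans_fun_inj x : injective (rtrans_fun x).
Proof.
apply: (can_inj (g := rtrans_fun x^-1)) => i; rewrite -(coset_repK i).
by rewrite !rtrans_funE mulgK.
Qed.

Definition rtrans x : 'S_m := perm (@rtrans_fun_inj x).

Lemma rtransE x y : rtrans x (q y) = q (y * x).
Proof. by rewrite permE rtrans_funE. Qed.

Lemma rtransM x y : rtrans (x * y) = rtrans x * rtrans y.
Proof. by apply/permP => i; rewrite -(coset_repK i) permM !rtransE mulgA. Qed.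

Lemma rtrans_inj x y : rtrans x = rtrans y <-> q x = q y.
Proof.
split=> [/permP /(_ (q 1))|e]; first by rewrite !rtransE !mul1g.
apply/permP => i; rewrite -(coset_repK i) !rtransE; apply/qP.
by rewrite /eqm invgM mulgA mulgVK; apply/qP.
Qed.

Lemma rtrans1 x : rtrans x = 1 <-> N x.
Proof.
have -> : 1 = rtrans 1 by apply/permP => i; rewrite -(coset_repK i) rtransE perm1 mulg1.
rewrite rtrans_inj; split=> [/esym /qP|h]; first by rewrite /eqm invg1 mul1g.
by apply/esym/qP; rewrite /eqm invg1 mul1g.
Qed.

Definition rtrans_set : {set 'S_m} := [set s | `[< exists x, rtrans x = s >]]%SET.

Lemma rtransP s : reflect (exists x, rtrans x = s) (s \in rtrans_set).
Proof. by rewrite inE; apply: asboolP. Qed.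

Lemma mem_rtrans x : rtrans x \in rtrans_set.
Proof. by apply/rtransP; exists x. Qed.

Lemma rtrans_group_set : group_set rtrans_set.
Proof.
apply/group_setP; split.
  by apply/rtransP; exists 1; apply/rtrans1.
by move=> s t /rtransP [x <-] /rtransP [y <-]; rewrite -rtransM mem_rtrans.
Qed.

Canonical rtrans_group := Group rtrans_group_set.

Lemma card_rtrans : #|rtrans_set| = m.
Proof.
have cm : #|(fun s : 'S_m => s (q 1)) @: rtrans_set| = m.
  rewrite (_ : _ @: _ = finset.setT) ?cardsT ?card_ord //.
  apply/setP => i; rewrite !inE; apply/imsetP.
  by exists (rtrans (coset_rep i)); rewrite ?mem_rtrans // rtransE mul1g coset_repK.
rewrite -[RHS]cm; apply/esym/card_in_imset => s t /rtransP [x <-] /rtransP [y <-].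
by rewrite !rtransE !mul1g => e; apply/rtrans_inj.
Qed.

End Cosets.

Lemma open_normal_enumeration p (G : topologicalGroupType) (N : set G) :
  pro_p_group p G -> open_normal_subgroup N -> exists n (q : G -> 'I_(p ^ n)),
    (forall x y, q x = q y <-> eqm N x y) /\ forall i, exists x, q x = i.
Proof.
move=> [_ pG] oN; have [n hn] := pG N oN; exists n.
by case: oN => _ N1 Nd _; apply: coset_enumeration.
Qed.

(** * Invariant characters of normal subgroups *)

Section Characters.
Variables (p : nat) (H : finGroupType) (E : topologicalGroupType) (b : H -> E -> E).
Hypotheses (pp : prime p) (pH : p.-group [set: H]%SET) (pE : pro_p_group p E).
Hypothesis bc : continuous_action b.

(** In a finite quotient where [N] stays nontrivial, the image [Rg] of [N] is normal in the finite
    [p]-group [L] generated by the quotient and the action of [H]. Nilpotency makes the commutator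
    of [Rg] with [L] proper in [Rg]; a maximal subgroup containing it is the kernel of an
    [L]-invariant character. *)
Lemma pro_p_characters : has_characters p b (inv_level b).
Proof.
move=> N N1 Nd NJ NA [n nN n1].
have Lb := leveled_inv_level pE.1 bc.
have [M lM nM] : exists2 M, inv_level b M & ~ M n.
  apply: contrapT => h; apply: n1; apply: (lev_sep Lb) => U lU.
  by apply: contrapT => nU; apply: h; exists U.
have [[oM M1 Md MJ] MA] := lM.
have [k [q [qP qs]]] := open_normal_enumeration pE (And4 oM M1 Md MJ).
pose r := rtrans MJ qP qs.
have rE x y : r x (q y) = q (y * x) by apply: rtransE.
have rM x y : r (x * y) = r x * r y by apply: rtransM.
have r1 x : r x = 1 <-> M x by apply: rtrans1.
have rJ x y : r (y ^ x) = r y ^ r x.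
  by apply: (mulgI (r x)); rewrite -rM -!conjgC rM.
(* The inverse turns the left action of [H] into a homomorphism for composition from left to
   right. *)
have ra_inj h : injective (fun i => q (b h^-1 (coset_rep qs i))).
  move=> i j /qP e; rewrite -(coset_repK qs i) -(coset_repK qs j); apply/qP.
  by have := MA h _ e; rewrite -(lactV Lb) -(lactD Lb) (lactKV Lb).
pose al h : {perm 'I_(p ^ k)} := perm (ra_inj h).
have alE h x : al h (q x) = q (b h^-1 x).
  rewrite permE; apply/qP; apply: (eqm_act Lb lM); apply/qP; exact: coset_repK.
have alM h h' : al (h * h') = al h * al h'.
  apply/permP => i; rewrite -(coset_repK qs i) permM !alE invgM.
  by rewrite -(lactM Lb).
have alJ h x : al h * r (b h^-1 x) = r x * al h.
  apply/permP => i; rewrite -(coset_repK qs i) !permM alE !rE alE.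
  by rewrite (lactD Lb).
pose P := rtrans_group M1 MJ qP qs.
pose A := [set al h | h in [set: H]]%SET.
have gA : group_set A.
  apply/group_setP; split.
    apply/imsetP; exists 1 => //; apply/permP => i.
    by rewrite -(coset_repK qs i) alE perm1 invg1 (lact1 Lb).
  move=> s t /imsetP [h _ ->] /imsetP [h' _ ->].
  by rewrite -alM; apply: imset_f.
have pA : p.-group A.
  rewrite /pgroup -[A]/(gval (Group gA)).
  have f : {in [set: H]%SET &, {morph al : x y / x * y}} by move=> x y _ _; apply: alM.
  have -> : gval (Group gA) = (Morphism f @* [set: H]%SET)%g by rewrite morphimEdom.
  exact: morphim_pgroup.
have pP : p.-group P by rewrite /pgroup card_rtrans pnatX pnat_id.
have nAP : A \subset 'N(P).
  apply/fintype.subsetP => s /imsetP [h _ ->]; apply/normP.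
  apply/eqP; rewrite eqEcard cardJg leqnn andbT.
  apply/fintype.subsetP => t /imsetP [u] /rtransP [x <-] ->.
  apply/rtransP; exists (b h^-1 x).
  by apply: (mulgI (al h)); rewrite alJ conjgE !mulgA mulgV mul1g.
pose L := (P <*> Group gA)%G.
have eL : L = P * Group gA :> {set _} := @norm_joinEr _ P (Group gA) nAP.
have pL : p.-group L by rewrite eL pgroupM pP.
pose Rs : {set 'S_(p ^ k)} := [set s | `[< exists2 x, N x & r x = s >]]%SET.
have RsP s : reflect (exists2 x, N x & r x = s) (s \in Rs) by rewrite inE; apply: asboolP.
have PP s : reflect (exists x, r x = s) (s \in P) by apply: rtransP.
have gR : group_set Rs.
  apply/group_setP; split; first by apply/RsP; exists 1 => //; apply/r1.
  move=> s t /RsP [x Nx <-] /RsP [y Ny <-]; apply/RsP.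
  exists (x * y); last exact: rM.
  by rewrite -[y]invgK; apply: (Nd) => //; rewrite -[y^-1]mul1g; apply: (Nd).
pose Rg := Group gR.
have RP : Rg \subset P.
  apply/fintype.subsetP => s /RsP [x _ <-].
  by apply/PP; exists x.
have RL : Rg \subset L by apply: fintype.subset_trans RP (joing_subl _ _).
have nLR : L \subset 'N(Rg).
  rewrite join_subG; apply/andP; split.
    apply/fintype.subsetP => s /PP [x <-]; apply/normP.
    apply/eqP; rewrite eqEcard cardJg leqnn andbT.
    apply/fintype.subsetP => t /imsetP [u] /RsP [y Ny <-] ->.
    apply/RsP; exists (y ^ x); first exact: NJ.
    exact: rJ.
  apply/fintype.subsetP => s /imsetP [h _ ->]; apply/normP.
  apply/eqP; rewrite eqEcard cardJg leqnn andbT.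
  apply/fintype.subsetP => t /imsetP [u] /RsP [x Nx <-] ->.
  apply/RsP; exists (b h^-1 x); first exact: NA.
  by apply: (mulgI (al h)); rewrite alJ conjgE !mulgA mulgV mul1g.
have ntR : Rg != 1 :> {set _}.
  apply/eqP => e; have : r n \in Rg by apply/RsP; exists n.
  by rewrite e => /set1P /r1.
have sub : L \subset 'N_L(Rg) by rewrite finset.subsetI fintype.subxx.
have prop := nil_comm_properl (pgroup_nil pL) RL ntR sub.
have [e|[K mK cK]] := maximal_exists (proper_sub prop).
  by move: prop; rewrite /= e => /andP [_ /negP []].
have pR := pgroupS RL pL.
have [chi [chiM chi0 [s sR s1]]] := Fp_character pp (p_maximal_normal pR mK) (p_maximal_index pR mK).
exists M, (fun x => chi (r x)).
have NMR x : (exists n m, [/\ N n, M m & x = n * m]) -> r x \in Rg.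
  move=> [y [z [Ny Mz ->]]]; apply/RsP; exists y => //.
  by rewrite rM (r1 z).2 // mulg1.
have KR := proper_sub (maxgroupp mK).
have chiJ s' t : s' \in Rg -> t \in L -> chi (s' ^ t) = chi s'.
  move=> s'R tL; have c : [~ s', t] \in K.
    by apply: (fintype.subsetP cK); apply: mem_commg.
  rewrite conjg_mulR chiM //; last exact: (fintype.subsetP KR).
  by have /eqP -> : chi [~ s', t] == 0%R; rewrite ?GRing.addr0 // chi0 //; apply: (fintype.subsetP KR).
have rL x : r x \in L by apply: (fintype.subsetP (joing_subl P A)); apply: mem_rtrans.
have aL h : al h \in L by apply: (fintype.subsetP (joing_subr P A)); apply/imsetP; exists h.
split => //.
- by have /RsP [x Nx e] := sR; exists x; rewrite ?e.
- by move=> x y /NMR xR /NMR yR; rewrite rM chiM.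
- by move=> x Mx; apply/eqP; rewrite (r1 x).2 // chi0 // group1.
- move=> x /NMR xR; split=> [y|h].
    rewrite -(chiJ _ _ xR (rL y)); congr chi.
    exact: rJ.
  rewrite -(chiJ _ _ xR (aL h^-1)); congr chi.
  have := alJ h^-1 x; rewrite invgK => e.
  by apply: (mulgI (al h^-1)); rewrite e conjgE !mulgA mulgV mul1g.
Qed.

End Characters.

(** * Free pro-p groups *)

(** As [N] contains the kernel of [phi], its cosets correspond to those of its image [K] in the
    image [L] of [G], and an index in a [p]-group is a power of [p]. *)
Lemma finite_image_cosets (p : nat) (G : groupType) (gT : finGroupType) (A : {group gT})
    (phi : G -> gT) (N : set G) :
  p.-group A -> {morph phi : x y / x * y} -> (forall x, phi x \in A) ->
  N 1 -> (forall x y, N x -> N y -> N (x * y^-1)) -> (forall x, phi x = 1 -> N x) ->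
  exists n, [set (fun y => x * y) @` N | x in [set: G]] #= `I_(p ^ n).
Proof.
move=> pA phiM phiA N1 Nd kN.
have NV x : N x -> N x^-1 by move=> Nx; rewrite -[_^-1]mul1g; apply: (Nd).
have NM x y : N x -> N y -> N (x * y) by move=> Nx Ny; rewrite -[y]invgK; apply: (Nd) => //; apply: (NV).
have phi1 : phi 1 = 1 by apply: (mulgI (phi 1)); rewrite -phiM !mulg1.
have phiV x : phi x^-1 = (phi x)^-1 by apply: (mulgI (phi x)); rewrite -phiM !mulgV.
pose im (Q : set G) : {set gT} := [set s | `[< exists2 x, Q x & phi x = s >]]%SET.
have imP Q s : reflect (exists2 x, Q x & phi x = s) (s \in im Q) by rewrite inE; apply: asboolP.
have gim (Q : set G) : Q 1 -> (forall x y, Q x -> Q y -> Q (x * y)) -> group_set (im Q).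
  move=> Q1 QM; apply/group_setP; split; first by apply/imP; exists 1.
  by move=> s t /imP [x Qx <-] /imP [y Qy <-]; apply/imP; exists (x * y) => //; apply: QM.
pose K := Group (gim N N1 NM).
pose L := Group (gim setT I (fun _ _ _ _ => I)).
have LA : L \subset A by apply/fintype.subsetP => s /imP [x _ <-].
have KL : K \subset L by apply/fintype.subsetP => s /imP [x _ <-]; apply/imP; exists x.
have pn : p.-nat #|lcosets K L|.
  by rewrite card_lcosets; apply: pnat_dvd (dvdn_indexg _ _) (pgroupS LA pA).
have [n en] := p_natP pn.
exists n.
have CE x : (fun y => x * y) @` N = fun z => phi z \in phi x *: K.
  apply/funext => z; apply/propext; split=> [[y Ny <-]|].
    by rewrite phiM mem_lcoset mulKg; apply/imP; exists y.
  rewrite mem_lcoset => /imP [y Ny e]; exists (x^-1 * z); last by rewrite mulKVg.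
  rewrite -[x^-1 * z](mulKVg y); apply: (NM) => //; apply: (kN).
  by rewrite !phiM !phiV e mulVg.
pose f (i : 'I_#|lcosets K L|) : set G := fun z => phi z \in enum_val i.
have fP (i : 'I_#|lcosets K L|) : exists x, enum_val i = phi x *: K.
  by have [s /imP [x _ <-] e] := lcosetsP (enum_valP i); exists x.
have -> : [set (fun y => x * y) @` N | x in [set: G]] = f @` setT.
  apply/seteqP; split=> C [x _ <-].
    have hx : phi x *: K \in lcosets K L by rewrite -lcosetE; apply: imset_f; apply/imP; exists x.
    by exists (enum_rank_in hx (phi x *: K)) => //; rewrite CE /f enum_rankK_in.
  by have [y ey] := fP x; exists y => //; rewrite CE /f ey.
apply: card_eq_trans (_ : f @` setT #= [set: 'I_#|lcosets K L|]) _.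
  apply: inj_card_eq => i j _ _ e; apply: enum_val_inj.
  have [x ex] := fP i; have [y ey] := fP j.
  have : f j x by rewrite -e /f ex lcoset_refl.
  by rewrite /f ex ey => /lcoset_eqP ->.
rewrite en; rewrite card_eq_sym; exact: card_II.
Qed.

HB.instance Definition _ (gT : finGroupType) :=
  monoid.Group.copy (discrete_topology gT) gT.

Lemma discrete_mul_continuous (gT : finGroupType) :
  continuous (fun u : discrete_topology gT * discrete_topology gT => u.1 * u.2).
Proof.
move=> [x y]; apply/discrete_cvg; exists ([set x], [set y]).
  by split; apply: discrete_set1.
by move=> [x' y'] [/= -> ->].
Qed.

Lemma discrete_inv_continuous (gT : finGroupType) :
  continuous (fun x : discrete_topology gT => x^-1).
Proof.
move=> x; apply/discrete_cvg; have := discrete_set1 x.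
by apply: (@filterS _ (nbhs x)) => y ->.
Qed.

HB.instance Definition _ (gT : finGroupType) := isTopologicalGroup.Build
  (discrete_topology gT) (@discrete_mul_continuous gT) (@discrete_inv_continuous gT).

Lemma discrete_pro_p (p : nat) (gT : finGroupType) : p.-group [set: gT]%SET ->
  pro_p_group p (discrete_topology gT).
Proof.
move=> pg; split.
  split.
  - apply: finite_compact; exact: finite_finset.
  - exact: discrete_hausdorff.
  - apply: zero_dimension_totally_disconnected => x y xy; exists [set x].
    split => //; last by move=> /= e; rewrite e eqxx in xy.
    by split; [apply: discrete_open | apply: discrete_closed].
move=> N [_ N1 Nd _]; apply: (finite_image_cosets (A := [set: gT]%G) (phi := idfun)) => //.
  by move=> x; rewrite finset.inE.
by move=> x /= ->.
Qed.

(** * A wreath product of a finite quotient with the cyclic group of order p *)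

Section SkewPermutations.
Variables (p : nat) (G : groupType) (N : set G) (n : nat) (q : G -> 'I_(p ^ n)).
Hypotheses (pp : prime p) (N1 : N 1) (NJ : forall x y, N x -> N (x ^ y)).
Hypothesis qP : forall x y, q x = q y <-> eqm N x y.
Hypothesis q_surj : forall i, exists x, q x = i.
Local Notation T := ('I_(p ^ n) * 'F_p)%type.
Local Notation rt := (rtrans NJ qP q_surj).

(** Homomorphisms to these permutations that lift the translations encode crossed homomorphisms with
    values in functions on the cosets, hence integrals along a tree. *)
Definition skew_fun (s : 'S_(p ^ n)) (d : 'I_(p ^ n) -> 'F_p) (z : T) : T :=
  (s z.1, (z.2 + d z.1)%R).

Lemma skew_fun_inj s d : injective (skew_fun s d).
Proof.
move=> [i t] [j u] e; have := congr1 snd e; have := congr1 fst e.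
by rewrite /= => /perm_inj -> /addIr ->.
Qed.

Definition skew s d : {perm T} := perm (@skew_fun_inj s d).

Lemma skewE s d i t : skew s d (i, t) = (s i, (t + d i)%R).
Proof. by rewrite permE. Qed.

Definition skew_set : {set {perm T}} := [set g | `[< exists x d, g = skew (rt x) d >]]%SET.

Lemma skewP g : reflect (exists x d, g = skew (rt x) d) (g \in skew_set).
Proof. by rewrite inE; apply: asboolP. Qed.

Lemma skewM s s' d d' : skew s d * skew s' d' = skew (s * s') (fun i => (d i + d' (s i))%R).
Proof. by apply/permP => -[i t]; rewrite permM !skewE permM addrA. Qed.

Lemma skew1 d : (forall i, d i = 0%R) -> skew 1 d = 1.
Proof. by move=> d0; apply/permP => -[i t]; rewrite skewE !perm1 d0 addr0. Qed.

Lemma skew_group_set : group_set skew_set.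
Proof.
apply/group_setP; split.
  apply/skewP; exists 1, (fun=> 0%R); rewrite (rtrans1 NJ qP q_surj 1).2 //.
  by rewrite skew1.
move=> g g' /skewP [x [d ->]] /skewP [x' [d' ->]]; apply/skewP.
by exists (x * x'); eexists; rewrite skewM -rtransM.
Qed.

Canonical skew_group := Group skew_group_set.

Lemma skewX s d i : exists d', skew s d ^+ i = skew (s ^+ i) d'.
Proof.
elim: i => [|i [d' IH]]; first by exists (fun=> 0%R); rewrite !expg0 skew1.
by eexists; rewrite !expgS IH skewM.
Qed.

Lemma skew1X d i : skew 1 d ^+ i = skew 1 (fun j => d j *+ i)%R.
Proof.
elim: i => [|i IH]; first by rewrite expg0 skew1 // => j; rewrite mulr0n.
rewrite expgS IH skewM mulg1; congr skew; apply/funext => j.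
by rewrite perm1 mulrS.
Qed.

(** The [p ^ n]-th power of an element covers the trivial translation, and the [p]-th power of that
    is trivial; by Cauchy every prime dividing the order is [p]. *)
Lemma skew_pgroup : p.-group skew_group.
Proof.
apply/pgroupP => r pr rA; have [g gA gr] := Cauchy pr rA.
suff : g ^+ (p ^ n * p) = 1.
  by move/eqP; rewrite -order_dvdn gr -expnSr Euclid_dvdX // => /andP [+ _]; rewrite dvdn_prime2 // => /eqP ->; rewrite inE.
have /skewP [x [d ->]] := gA; rewrite expgM.
have [d' ->] := skewX (rt x) d (p ^ n).
have -> : rt x ^+ (p ^ n) = 1.
  have h : rt x \in rtrans_group N1 NJ qP q_surj by apply: mem_rtrans.
  by have := expg_cardG h; rewrite card_rtrans.
rewrite skew1X skew1 // => j; rewrite -mulr_natl.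
by rewrite pchar_Fp_0 // mul0r.
Qed.

End SkewPermutations.

(** * The trees of a free pro-p group *)

Section FreeGroup.
Variables (p : nat) (X : topologicalType) (x0 : X) (F : topologicalGroupType).
Variables (om : X -> F) (H : finGroupType) (a : H -> F -> F).
Hypotheses (pp : prime p) (free : free_pro_p_on p x0 om) (ac : continuous_action a).
Local Notation lev := (inv_level a).

Let pF : pro_p_group p F. Proof. by case: free. Qed.
Let La : leveled_action a lev. Proof. exact: leveled_inv_level pF.1 ac. Qed.

(** The universal property needs a pro-[p] target: the subgroup [A] as a discrete group, since the
    ambient [gT] need not be a [p]-group. *)
Definition dsubg (gT : finGroupType) (A : {group gT}) (s : gT) :
  discrete_topology (subg_of A) := subg A s.

Lemma pro_p_subg (gT : finGroupType) (A : {group gT}) : p.-group A ->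
  pro_p_group p (discrete_topology (subg_of A)).
Proof. by move=> pA; apply: discrete_pro_p; rewrite /pgroup -(card_isog (isog_subg A)). Qed.

Lemma free_hom (gT : finGroupType) (A : {group gT}) (f : X -> gT) :
  p.-group A -> (forall x, f x \in A) -> f x0 = 1 ->
  (forall x, \forall y \near x, f y = f x) ->
  exists phi : F -> gT, [/\ {morph phi : u v / u * v}, forall u, phi u \in A,
    forall x, phi (om x) = f x & exists2 U, lev U & forall u, U u -> phi u = 1].
Proof.
move=> pA fA f0 fc; case: free => _ _ _ _ /(_ _ (fun x => dsubg A (f x)) (pro_p_subg pA)).
case.
- move=> x; apply/discrete_cvg; have := fc x.
  by apply: (@filterS _ (nbhs x)) => y /= ->.
- by rewrite f0; apply: val_inj; rewrite /= subgK.
move=> g [[[gM gc] gf] _]; exists (fun u => sgval (g u)).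
have g1 : g 1 = 1 by apply: (mulgI (g 1)); rewrite -gM !mulg1.
split.
- by move=> u v; rewrite gM.
- by move=> u; apply: subgP.
- by move=> x; rewrite gf subgK.
have n1 : nbhs 1 (fun u => g u = 1).
  by have := gc 1 [set 1]; rewrite g1; apply; apply: discrete_set1.
have [U lU UO] := (nbhs_level pF.1 ac 1 _).1 n1; exists U => // u Uu.
by rewrite UO // /eqm invg1 mul1g.
Qed.

Lemma free_hom_unique (gT : finGroupType) (A : {group gT}) (phi psi : F -> gT) U :
  p.-group A -> {morph phi : u v / u * v} -> {morph psi : u v / u * v} ->
  (forall u, phi u \in A) -> (forall u, psi u \in A) -> lev U ->
  (forall u, U u -> phi u = 1) -> (forall u, U u -> psi u = 1) ->
  (forall x, phi (om x) = psi (om x)) -> phi =1 psi.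
Proof.
move=> pA phM psM phA psA lU phU psU e u.
have cont (g : F -> gT) : {morph g : u v / u * v} -> (forall u, U u -> g u = 1) ->
    continuous (fun v => dsubg A (g v)).
  move=> gM gU v; apply/discrete_cvg; have := level_nbhs v lU.
  by apply: (@filterS _ (nbhs v)) => w vw /=; rewrite -(mulKVg v w) gM (gU _ vw) mulg1.
have hom (g : F -> gT) : {morph g : v w / v * w} -> (forall v, g v \in A) ->
    {morph (fun v => dsubg A (g v)) : v w / v * w}.
  by move=> gM gA v w; apply: val_inj; rewrite /= gM !subgK ?groupM.
case: free => _ _ co o1 /(_ _ (fun x => dsubg A (phi (om x))) (pro_p_subg pA)).
case.
- by move=> x; exact: (@continuous_comp _ _ _ om (fun v => dsubg A (phi v)) x (co x) (cont _ phM phU (om x))).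
- rewrite o1; apply: val_inj; rewrite /= subgK //.
  by apply: (mulgI (phi 1)); rewrite -phM !mulg1.
move=> gg [_ uniq].
have e1 := uniq (fun v => dsubg A (phi v)) (conj (conj (hom _ phM phA) (cont _ phM phU)) (fun x => erefl)).
have e2 : gg = (fun v => dsubg A (psi v)).
  by apply: uniq; split => [|x]; [split; [apply: hom | apply: cont] | rewrite e].
have := congr1 (fun h => sgval (h u)) e1; rewrite e2 /= !subgK //.
Qed.

(** The translate by [k] of the given basis; [om x0 = 1] supplies the constant edges. *)
Definition tree_basis (k : H) : set F := a k @` range om.

Lemma free_tree_closed k x :
  (forall U, lev U -> exists2 b, tree_basis k b & eqm U x b) -> tree_basis k x.
Proof.
move=> h; case: free => -[cX _ _] _ co _ _.
have cl : closed (tree_basis k).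
  apply: compact_closed; first by case: pF.1.
  apply: continuous_compact; first exact/continuous_subspaceT/action_continuous.
  by apply: continuous_compact => //; apply: continuous_subspaceT.
apply: (cl x) => O /(nbhs_level pF.1 ac) [U lU UO].
by have [b Bb e] := h U lU; exists b; split => //; apply: UO.
Qed.

Section Enumerated.
Variables (U : set F) (n : nat) (q : F -> 'I_(p ^ n)).
Hypothesis lU : lev U.
Hypothesis qP : forall x y, q x = q y <-> eqm U x y.
Hypothesis q_surj : forall i, exists x, q x = i.
Let U1 : U 1 := lev_1 La lU.
Let UJ x y : U x -> U (x ^ y) := fun h => lev_conj La y lU h.
Local Notation rt := (rtrans UJ qP q_surj).
Local Notation rep := (coset_rep q_surj).
Local Notation A := (skew_group U1 UJ qP q_surj).

(** Send [x] to the skew permutation with translation [om x] and shifts [c _ x]. Freeness extends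
    this to [F], and [g u] is the second component of the image of [(q 1, 0)] under [u]; multiplying
    by [om x] adds [c u x] to it. *)
Lemma skew_cocycle_hom (c : F -> X -> 'F_p) :
  (forall u u' x, eqm U u u' -> c u x = c u' x) ->
  (forall u x x', eqm U (om x) (om x') -> c u x = c u x') ->
  (forall u, c u x0 = 0%R) ->
  exists g : F -> 'F_p, [/\ exists2 V, lev V & forall u u', eqm V u u' -> g u = g u',
    g 1 = 0%R & forall u x, g (u * om x) = (g u + c u x)%R].
Proof.
move=> cu cx c0; case: (free) => _ _ co o1 _.
pose f x := skew (rt (om x)) (fun i => c (rep i) x).
have [|||phi [phM phA phf [V lV phV]]] := @free_hom _ A f (skew_pgroup pp U1 UJ qP q_surj).
- by move=> x; apply/skewP; eexists; eexists.
- by rewrite /f o1 (rtrans1 UJ qP q_surj 1).2 // skew1.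
- move=> x; have : nbhs x (fun y => eqm U (om x) (om y)) := co x _ (level_nbhs (om x) lU).
  apply: (@filterS _ (nbhs x)) => y e; rewrite /f.
  have -> : rt (om y) = rt (om x) by apply/rtrans_inj/qP; apply: (eqm_sym La lU).
  by congr skew; apply/funext => i; apply: cx; apply: (eqm_sym La lU).
have ch u : exists y, exists d, phi u = skew (rt y) d by apply/skewP/phA.
have [y hy] := choice ch; have [d hd] := choice hy.
have rty u i : rt (y u) i = (phi u (i, 0%R)).1 by rewrite hd skewE.
have [W lW sW] := lev_cap La lU lV.
(* The translation parts form a homomorphism that agrees with the coset translations on the basis,
   so uniqueness identifies the two. *)
have e : (fun u => rt (y u)) =1 (fun u => rt u).
  apply: (@free_hom_unique _ (rtrans_group U1 UJ qP q_surj) _ _ W) => //.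
  - by rewrite /pgroup card_rtrans pnatX pnat_id.
  - move=> u v; apply/permP => i; rewrite rty phM !permM !hd !skewE.
    by [].
  - by move=> u v; apply: rtransM.
  - by move=> u; apply: mem_rtrans.
  - by move=> u; apply: mem_rtrans.
  - by move=> u /sW [_ Vu]; apply/permP => i; rewrite rty phV // !perm1.
  - by move=> u /sW [Uu _]; apply/rtrans1.
  - by move=> x; apply/permP => i; rewrite rty phf skewE.
exists (fun u => (phi u (q 1, 0%R)).2); split.
- exists V => // u u' uu'; suff -> : phi u' = phi u by [].
  by rewrite -[u'](mulKVg u) phM (phV _ uu') mulg1.
- have -> : phi 1 = 1 by apply: (mulgI (phi 1)); rewrite -phM !mulg1.
  by rewrite perm1.
- move=> u x; rewrite phM permM phf.
  have -> : phi u (q 1, 0%R) = (q u, (phi u (q 1, 0%R)).2).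
    by rewrite {1}[LHS]surjective_pairing -rty e rtransE mul1g.
  rewrite skewE /=; congr (_ + _)%R; apply: cu.
  by apply/qP; rewrite coset_repK.
Qed.

(* Conjugating the translation action by [(i, t) |-> (i, t + g i)] gives a second
   homomorphism agreeing with the first one on the basis. *)
Lemma translation_invariant_const (g : F -> 'F_p) :
  (forall u u', eqm U u u' -> g u = g u') ->
  (forall u x, g (u * om x) = g u) -> forall u, g u = g 1.
Proof.
move=> gU gx u.
have gr i : g (rep (q i)) = g i by apply: gU; apply/qP; rewrite coset_repK.
pose th u := skew (rt u) (fun=> 0%R : 'F_p).
pose th' u := skew (rt u) (fun i => (g (rep (rt u i)) - g (rep i))%R).
have rt1 v : U v -> rt v = 1 by move=> Uv; apply/rtrans1.
have /(_ u) : th =1 th'.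
  apply: (@free_hom_unique _ A _ _ U) => //.
  - exact: skew_pgroup.
  - by move=> v w; rewrite /th skewM rtransM; congr skew; apply/funext => i; rewrite addr0.
  - move=> v w; rewrite /th' skewM rtransM; congr skew; apply/funext => i.
    by rewrite permM [RHS]addrC addrA subrK.
  - by move=> v; apply/skewP; eexists; eexists.
  - by move=> v; apply/skewP; eexists; eexists.
  - by move=> v /rt1; rewrite /th => ->; rewrite skew1.
  - by move=> v /rt1; rewrite /th' => ->; rewrite skew1 // => i; rewrite perm1 subrr.
  - move=> x; rewrite /th /th'; congr skew; apply/funext => i.
    by rewrite -{1 2}(coset_repK q_surj i) rtransE !gr gx subrr.
move=> /permP /(_ (q 1, 0%R)); rewrite !skewE rtransE mul1g !gr => /(congr1 snd) /=.
by rewrite !add0r => /esym /eqP; rewrite subr_eq0 => /eqP.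
Qed.

End Enumerated.

(** The automorphism [a k] carries the tree of the given basis to the tree [k], which reduces the
    last two clauses to that basis. *)
Lemma free_tree_family : tree_family p a lev tree_basis.
Proof.
have act_eqm k u u' U : lev U -> eqm U u u' -> eqm U (a k u) (a k u') by move=> lU; apply: (eqm_act La lU).
case: (free) => _ _ co o1 _.
split.
- by move=> k; exists 1; [exists x0 | apply: (lact1r La)].
- by move=> h k x [u hu <-]; exists u => //; rewrite (lactM La).
- exact: free_tree_closed.
- move=> k c [U lU hU] c1; have [n [q [qP qs]]] := open_normal_enumeration pF lU.1.
  have Bk x : tree_basis k (a k (om x)) by exists (om x) => //; exists x.
  have [|||g [[V lV gV] g1 gx]] := skew_cocycle_hom lU qP qs (c := fun u x => c (a k u) (a k (om x))).
  - move=> u u' x e; apply: hU => //; first exact: act_eqm.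
    exact: (eqm_refl La).
  - move=> u x x' e; apply: hU => //; last exact: act_eqm.
    exact: (eqm_refl La).
  - by move=> u; rewrite o1 (lact1r La).
  exists (fun u => g (a k^-1 u)); split.
  + by exists V => // u u' e; apply: gV; apply: act_eqm.
  + by rewrite (lact1r La).
  + move=> u _ [_ [x _ <-] <-].
    by rewrite (lactD La) (lactK La) gx (lactKV La).
- move=> k g [U lU hU] gB u; have [n [q [qP qs]]] := open_normal_enumeration pF lU.1.
  have := translation_invariant_const lU qP qs (g := fun u => g (a k u)) _ _ (a k^-1 u).
  rewrite (lactKV La) (lact1r La); apply.
    by move=> v v' e; apply: hU; apply: act_eqm.
  by move=> v x; rewrite (lactD La) gB //; exists (om x) => //; exists x.
Qed.

End FreeGroup.

(** * Construction of free pro-p groups *)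

Section Words.
Variable Y : Type.
Definition word := seq (Y * bool).

Fixpoint ev (T : groupType) (f : Y -> T) (w : word) : T :=
  if w is (y, e) :: w' then (if e then f y else (f y)^-1) * ev f w' else 1.

Lemma ev_cat (T : groupType) (f : Y -> T) w w' : ev f (w ++ w') = ev f w * ev f w'.
Proof. by elim: w => [|[y e] w IH] /=; rewrite ?mul1g // IH mulgA. Qed.

Definition word_inv (w : word) : word := rev [seq (u.1, ~~ u.2) | u <- w].

Lemma ev_inv (T : groupType) (f : Y -> T) w : ev f (word_inv w) = (ev f w)^-1.
Proof.
elim: w => [|[y e] w IH] /=; first by rewrite invg1.
rewrite /word_inv map_cons rev_cons -cats1 ev_cat [ev f (rev _)]IH /= mulg1 invgM.
by case: e; rewrite ?invgK.
Qed.

Lemma ev_morph (T T' : groupType) (phi : T -> T') (f : Y -> T) w :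
  {morph phi : x y / x * y} -> phi (ev f w) = ev (fun y => phi (f y)) w.
Proof.
move=> phM; have ph1 : phi 1 = 1 by apply: (mulgI (phi 1)); rewrite -phM !mulg1.
elim: w => [|[y e] w IH] //=; rewrite phM IH; congr (_ * _); case: e => //.
by apply: (mulgI (phi (f y))); rewrite -phM !mulgV.
Qed.

Lemma ev_mem (gT : finGroupType) (A : {group gT}) (f : Y -> gT) w :
  (forall y, f y \in A) -> ev f w \in A.
Proof.
move=> fA; elim: w => [|[y e] w IH] /=; first exact: group1.
by case: e; rewrite groupM ?groupV.
Qed.

End Words.

Section FreeConstruction.
Variables (p : nat) (Y : Type) (y0 : Y) (lc : forall m, (Y -> 'S_m) -> Prop).

Definition index := {m : nat & Y -> 'S_m}.

(** [lc] stands for local constancy; keeping it abstract lets [Y] be a type without topology. *)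
Definition good_coord m (f : Y -> 'S_m) : Prop :=
  [/\ lc f, f y0 = 1 & exists2 A : {group 'S_m}, p.-group A & forall y, f y \in A].

Definition good_part m (f : Y -> 'S_m) : Y -> 'S_m :=
  if pselect (good_coord f) then f else fun=> 1.

Lemma good_partE m (f : Y -> 'S_m) : good_coord f -> good_part f = f.
Proof. by rewrite /good_part; case: pselect. Qed.

Lemma good_partN m (f : Y -> 'S_m) : ~ good_coord f -> good_part f = fun=> 1.
Proof. by rewrite /good_part; case: pselect. Qed.

(* Coordinates range over the concrete groups ['S_m] and over all functions,
   the unwanted ones being trivialized by [good_part]; this keeps the index type
   small and free of proofs. *)
Definition coords := forall j : index, 'S_(projT1 j).
Implicit Types (e : coords) (J : seq index).

Fixpoint agree e e' J : Prop := if J is j :: J' then e j = e' j /\ agree e e' J' else True.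

Lemma agree_refl e J : agree e e J. Proof. by elim: J. Qed.

Lemma agree_trans e' e e'' J : agree e e' J -> agree e' e'' J -> agree e e'' J.
Proof. by elim: J => //= j J IH [-> h] [-> h']; split => //; apply: IH. Qed.

Lemma agree_cat e e' J J' : agree e e' (J ++ J') <-> agree e e' J /\ agree e e' J'.
Proof. by elim: J => [|j J IH] /=; tauto. Qed.

Definition evc (w : word Y) : coords := fun j => ev (good_part (projT2 j)) w.

(** The closure, in the product of all coordinates, of the subgroup generated by [Y]. *)
Definition approximable e := forall J, exists w, agree e (evc w) J.

Definition freep := {e : coords | approximable e}.

HB.instance Definition _ := gen_eqMixin freep.
HB.instance Definition _ := gen_choiceMixin freep.

Definition crd (x : freep) (j : index) : 'S_(projT1 j) := sval x j.

Lemma crd_inj (x y : freep) : (forall j, crd x j = crd y j) -> x = y.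
Proof.
case: x y => [e Ae] [e' Ae'] h; apply: eq_exist; apply: functional_extensionality_dep.
exact: h.
Qed.

Lemma freep_one_subproof : approximable (fun j => 1).
Proof. by move=> J; exists [::]; elim: J. Qed.

Lemma freep_inv_subproof (x : freep) : approximable (fun j => (crd x j)^-1).
Proof.
move=> J; have [w hw] := svalP x J; exists (word_inv w).
by elim: J hw => //= j J IH [e /IH h]; split => //; rewrite /evc ev_inv -/(evc w j) -e.
Qed.

Lemma freep_mul_subproof (x y : freep) : approximable (fun j => crd x j * crd y j).
Proof.
move=> J; have [w hw] := svalP x J; have [w' hw'] := svalP y J; exists (w ++ w').
elim: J hw hw' => //= j J IH [e h] [e' h']; split; last exact: IH.
by rewrite /evc ev_cat -/(evc w j) -/(evc w' j) -e -e'.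
Qed.

Definition freep_one : freep := exist _ _ freep_one_subproof.
Definition freep_inv x : freep := exist _ _ (freep_inv_subproof x).
Definition freep_mul x y : freep := exist _ _ (freep_mul_subproof x y).

Lemma freep_mulA : associative freep_mul.
Proof. by move=> x y z; apply: crd_inj => j; apply: mulgA. Qed.
Lemma freep_mul1 : left_id freep_one freep_mul.
Proof. by move=> x; apply: crd_inj => j; apply: mul1g. Qed.
Lemma freep_mulr1 : right_id freep_one freep_mul.
Proof. by move=> x; apply: crd_inj => j; apply: mulg1. Qed.
Lemma freep_mulV : left_inverse freep_one freep_inv freep_mul.
Proof. by move=> x; apply: crd_inj => j; apply: mulVg. Qed.
Lemma freep_mulrV : right_inverse freep_one freep_inv freep_mul.
Proof. by move=> x; apply: crd_inj => j; apply: mulgV. Qed.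

HB.instance Definition _ := monoid.isGroup.Build freep
  freep_mulA freep_mul1 freep_mulr1 freep_mulV freep_mulrV.

Lemma crdM (x y : freep) j : crd (x * y) j = crd x j * crd y j. Proof. by []. Qed.
Definition near_at (x y : freep) J := agree (sval x) (sval y) J.

Definition freep_nbhs (x : freep) : set_system freep :=
  [set O | exists J, forall y, near_at x y J -> O y].

HB.instance Definition _ := hasNbhs.Build freep freep_nbhs.

Lemma freep_nbhs_filter (x : freep) : ProperFilter (nbhs x).
Proof.
apply: Build_ProperFilter.
  by move=> [J h]; apply: (h x); apply: agree_refl.
split; first by exists [::].
- move=> O O' [J h] [J' h']; exists (J ++ J') => y /agree_cat [a a'].
  by split; [apply: h | apply: h'].
- by move=> O O' s [J h]; exists J => y /h /s.
Qed.

Lemma freep_nbhs_singleton (x : freep) (O : set freep) : nbhs x O -> O x.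
Proof. by move=> [J h]; apply: h; apply: agree_refl. Qed.

Lemma freep_nbhs_nbhs (x : freep) (O : set freep) : nbhs x O -> nbhs x (nbhs^~ O).
Proof. by move=> [J h]; exists J => y xy; exists J => z yz; apply: h; apply: agree_trans xy yz. Qed.

HB.instance Definition _ := Nbhs_isNbhsTopological.Build freep
  freep_nbhs_filter freep_nbhs_singleton freep_nbhs_nbhs.

Lemma freep_mul_continuous : continuous (fun u : freep * freep => u.1 * u.2).
Proof.
move=> [x y] O [J h]; exists (near_at x ^~ J, near_at y ^~ J); first by split; exists J.
move=> [x' y'] [/= a b]; apply: h; elim: J a b => //= j J IH [a a'] [b b']; split; last exact: IH.
exact: (congr2 (fun s t => s * t) a b).
Qed.

Lemma freep_inv_continuous : continuous (fun x : freep => x^-1).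
Proof.
move=> x O [J h]; exists J => x' a; apply: h; elim: J a => //= j J IH [a a']; split; last exact: IH.
exact: (congr1 (fun s => s^-1) a).
Qed.

HB.instance Definition _ := isTopologicalGroup.Build freep
  freep_mul_continuous freep_inv_continuous.

Lemma freep_profinite : profinite_space freep.
Proof.
have clop j s : clopen [set x : freep | crd x j = s].
  have o (P : set 'S_(projT1 j)) : open [set x : freep | P (crd x j)].
    by rewrite openE => x Px; exists [:: j] => y [/= e _]; rewrite /crd -e.
  split; first exact: (o [set s]).
  rewrite -openC; exact: (o (~` [set s])).
have zd : zero_dimensional freep.
  move=> x y xy; have [j nj] : exists j, crd x j <> crd y j.
    by apply/existsNP => h; move/eqP: xy; apply; apply: crd_inj.
  by exists [set z | crd z j = crd x j]; split => //= /esym.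
split; last exact: zero_dimension_totally_disconnected.
- rewrite compact_ultra => Ul UUl _.
  have PU : ProperFilter Ul by apply: ultra_proper.
  have FU : Filter Ul by apply: filter_filter.
  have ex j : exists s, Ul [set x : freep | crd x j = s].
    apply: contrapT => no; have all s : Ul [set x : freep | crd x j <> s].
      case: (in_ultra_setVsetC [set x : freep | crd x j = s] UUl) => // h.
      by case: no; exists s.
    have h := @filter_forall _ _ (fun s x => crd x j <> s) Ul FU all.
    by have [x hx] := filter_ex h; apply: (hx (crd x j)).
  pose e j := sval (cid (ex j)).
  have he j : Ul [set x : freep | crd x j = e j] := svalP (cid (ex j)).
  have near J : Ul [set x : freep | agree e (sval x) J].
    elim: J => [|j J IH]; first exact: filterT.
    by apply: filterS (filterI (he j) IH) => x [h1 h2]; split => //; exact: esym h1.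
  have Ae : approximable e.
    move=> J; have [x ex'] := filter_ex (near J); have [w hw] := svalP x J.
    by exists w; apply: agree_trans ex' hw.
  exists (exist _ e Ae); split => // O [J h]; apply: filterS (near J) => x.
  exact: h.
- move=> x y cl; apply: contrapT => /eqP xy; have [U [[oU cU] Ux nUy]] := zd x y xy.
  have [z [Uz]] := cl U (~` U) (open_nbhs_nbhs (conj oU Ux))
    (open_nbhs_nbhs (conj (closed_openC cU) nUy)).
  by apply.
Qed.

Lemma crd_pgroup j : exists2 A : {group 'S_(projT1 j)}, p.-group A & forall x : freep, crd x j \in A.
Proof.
have [A pA hA] : exists2 A : {group 'S_(projT1 j)}, p.-group A &
    forall y, good_part (projT2 j) y \in A.
  have [gf|ng] := pselect (good_coord (projT2 j)).
    by rewrite (good_partE gf); case: gf.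
  rewrite (good_partN ng).
  by exists 1%G; [apply: pgroup1 | move=> y; apply: group1].
exists A => // x; have [w [e _]] := svalP x [:: j].
by rewrite /crd e; apply: ev_mem.
Qed.

Lemma crds_pgroup J : exists (gT : finGroupType) (phi : freep -> gT) (A : {group gT}),
  [/\ {morph phi : x y / x * y}, forall x, phi x = 1 -> near_at 1 x J,
      forall x, phi x \in A & p.-group A].
Proof.
elim: J => [|j J [gT [phi [A [phM ph1 phA pA]]]]].
  exists 'S_0, (fun=> 1), 1%G; split => //; last exact: pgroup1.
  by move=> x y; rewrite mulg1.
have [A' pA' hA'] := crd_pgroup j.
exists (gT * 'S_(projT1 j))%type, (fun x => (phi x, crd x j)), (setX_group A A'); split.
- by move=> x y; rewrite phM crdM.
- by move=> x [/ph1 h1 h2]; split.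
- by move=> x; rewrite inE /= phA hA'.
- by rewrite /pgroup cardsX pnatM; apply/andP.
Qed.

Lemma freep_pro_p : pro_p_group p freep.
Proof.
split; first exact: freep_profinite.
move=> N [oN N1 Nd _].
have [J hJ] : nbhs (1 : freep) N by apply: open_nbhs_nbhs.
have [gT [phi [A [phM ph1 phA pA]]]] := crds_pgroup J.
apply: (finite_image_cosets pA phM phA N1 Nd) => x /ph1; exact: hJ.
Qed.

End FreeConstruction.

(** With the trivial group acting, the results about invariant levels apply to any profinite
    group. *)
Lemma trivial_action (P : topologicalGroupType) :
  continuous_action (fun (_ : 'S_0) (x : P) => x).
Proof.
split => // -[h x] O nO; exists (setT, O); last by move=> [k y] [_ /=].
by split => //=; apply: filterT.
Qed.

Lemma open_normal_sep (P : topologicalGroupType) (x y : P) : profinite_space P ->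
  (forall N, open_normal_subgroup N -> eqm N x y) -> x = y.
Proof.
move=> pP h; apply: (eqm_sep (leveled_inv_level pP (trivial_action P))) => U [oU _].
exact: h.
Qed.

Lemma nbhs_open_normal (P : topologicalGroupType) (x : P) O : profinite_space P ->
  nbhs x O <-> exists2 N, open_normal_subgroup N & forall y, eqm N x y -> O y.
Proof.
move=> pP; split=> [/(nbhs_level pP (trivial_action P)) [U [oU _] UO]|[N oN NO]].
  by exists U.
by apply/(nbhs_level pP (trivial_action P)); exists N.
Qed.

(** * The universal property and the induced action *)

Section Universal.
Variables (p : nat) (Y : Type) (y0 : Y) (lc : forall m, (Y -> 'S_m) -> Prop).
Hypothesis pp : prime p.
Local Notation E := (freep p y0 lc).
Local Notation index := (index Y).
Implicit Types (J : seq index).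

Lemma sec_subproof (y : Y) : approximable p y0 lc (evc p y0 lc [:: (y, true)]).
Proof. by move=> J; exists [:: (y, true)]; apply: agree_refl. Qed.

Definition sec (y : Y) : E := exist _ _ (sec_subproof y).

Lemma crd_sec y j : crd (sec y) j = good_part p y0 lc (projT2 j) y.
Proof. exact: mulg1. Qed.

Lemma good_part1 m (f : Y -> 'S_m) : good_part p y0 lc f y0 = 1.
Proof.
have [g|n] := pselect (good_coord p y0 lc f); last by rewrite (good_partN n).
by rewrite (good_partE g); case: g.
Qed.

Lemma sec1 : sec y0 = 1.
Proof. by apply: crd_inj => j; rewrite crd_sec good_part1. Qed.

Lemma crd_ev_sec w j : crd (ev sec w) j = evc p y0 lc w j.
Proof.
rewrite (@ev_morph Y E 'S_(projT1 j) (fun x => crd x j)) // /evc.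
by congr (ev _ w); apply/funext => y; apply: crd_sec.
Qed.

Lemma ev_sec_dense (x : E) J : exists w, near_at x (ev sec w) J.
Proof.
have [w hw] := svalP x J; exists w; elim: J hw => //= j J IH [e h]; split; last exact: IH.
by rewrite e -crd_ev_sec.
Qed.

Lemma near_near (x : E) J : \forall y \near x, near_at x y J.
Proof. by exists J. Qed.

(** Words in the basis are dense, and open normal subgroups separate the points of [P]. *)
Lemma hom_unique (P : topologicalGroupType) (g g' : E -> P) : profinite_space P ->
  continuous_hom g -> continuous_hom g' -> (forall y, g (sec y) = g' (sec y)) -> g = g'.
Proof.
move=> pP [gM gc] [gM' gc'] e; apply/funext => x; apply: open_normal_sep => // N oN.
have lN : inv_level (fun (_ : 'S_0) (x : P) => x) N by [].
have LP := leveled_inv_level pP (trivial_action P).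
have [J hJ] : nbhs x (fun z => eqm N (g x) (g z) /\ eqm N (g' x) (g' z)).
  apply: filterI; [apply: (gc x (eqm N (g x))) | apply: (gc' x (eqm N (g' x)))].
    exact: (level_nbhs (g x) lN).
  exact: (level_nbhs (g' x) lN).
have [w /hJ [e1 e2]] := ev_sec_dense x J.
apply: (eqm_trans LP lN e1).
have -> : g (ev sec w) = g' (ev sec w).
  by rewrite (ev_morph _ _ gM) (ev_morph _ _ gM'); congr (ev _ w); apply/funext.
exact: (eqm_sym LP lN).
Qed.

(** For each open normal [N] of [P] the map [f] modulo [N] occurs among the coordinates of [E], so
    an element of [E] prescribes its image modulo every [N]. The conditions are compatible because
    words realize any finite set of coordinates, and compactness of [P] provides the image. *)
Lemma hom_extend (P : topologicalGroupType) (f : Y -> P) : pro_p_group p P ->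
  f y0 = 1 ->
  (forall N m (th : P -> 'S_m), open_normal_subgroup N -> {morph th : x y / x * y} ->
     (forall x, N x -> th x = 1) -> lc (fun y => th (f y))) ->
  exists g : E -> P, continuous_hom g /\ forall y, g (sec y) = f y.
Proof.
move=> pP f1 flc; have LP := leveled_inv_level pP.1 (trivial_action P).
pose I := {N : set P | open_normal_subgroup N}.
have lI (N : I) : inv_level (fun (_ : 'S_0) (x : P) => x) (sval N) by split => //; apply: svalP.
have ch (N : I) : exists jt : {j : index & P -> 'S_(projT1 j)},
    [/\ {morph projT2 jt : x y / x * y}, forall x, projT2 jt x = 1 <-> sval N x
      & forall y, good_part p y0 lc (projT2 (projT1 jt)) y = projT2 jt (f y)].
  case: N => N oN /=; have [n [q [qP qs]]] := open_normal_enumeration pP oN.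
  have [_ N1 _ NJ] := oN; pose th := rtrans NJ qP qs.
  have thM : {morph th : x y / x * y} by move=> x y; apply: rtransM.
  have thN x : th x = 1 <-> N x by apply: rtrans1.
  exists (existT _ (existT _ (p ^ n)%N (fun y => th (f y))) th); split => //= y.
  rewrite good_partE //; split.
  - by apply: (flc N) => // x /thN.
  - by rewrite f1; apply/thN.
  - exists (rtrans_group N1 NJ qP qs); first by rewrite /pgroup card_rtrans pnatX pnat_id.
    by move=> z; apply: mem_rtrans.
have [jt hjt] := choice ch.
pose th N := projT2 (jt N); pose jj N := projT1 (jt N).
have thM N : {morph th N : x y / x * y} by case: (hjt N).
have thE N x y : th N x = th N y <-> eqm (sval N) x y.
  have [_ h _] := hjt N; rewrite /eqm -h -/(th N) thM.
  have th1 : th N 1 = 1 by apply: (mulgI (th N 1)); rewrite -thM !mulg1.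
  have -> : th N x^-1 = (th N x)^-1 by apply: (mulgI (th N x)); rewrite -thM !mulgV.
  split=> [->|e]; first by rewrite mulVg.
  by apply: (mulgI (th N x)^-1); rewrite e mulVg.
have thw N w : th N (ev f w) = evc p y0 lc w (jj N).
  have [_ _ h] := hjt N; rewrite (ev_morph _ _ (thM N)) /evc.
  by congr (ev _ w); apply/funext => y; rewrite h.
have ex (x : E) : exists z, forall N, th N z = crd x (jj N).
  apply: (@compact_directed P I (fun N => [set z | th N z = crd x (jj N)])).
  - by case: pP.1.
  - have oT : open_normal_subgroup [set: P] by split => //; apply: openT.
    by constructor; exists setT.
  - move=> N N'; have [W [oW _] sW] := lev_cap LP (lI N) (lI N').
    exists (exist _ W oW) => z hz.
    have [w [e1 [e2 [e3 _]]]] := svalP x [:: jj (exist _ W oW); jj N; jj N'].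
    have : eqm W (ev f w) z by apply/(thE (exist _ W oW)); rewrite thw hz /crd e1.
    move=> /sW [hN hN']; split.
      by rewrite /= /crd e2 -thw; apply/esym/thE.
    by rewrite /= /crd e3 -thw; apply/esym/thE.
  - move=> N; rewrite -openC openE => z nz; apply/(nbhs_open_normal _ _ pP.1).
    by exists (sval N); [apply: svalP | move=> y /thE e h; apply: nz; rewrite -h].
  - move=> N; have [w [e _]] := svalP x [:: jj N].
    by exists (ev f w); rewrite /= thw -e.
have [g hg] := choice ex.
have uniq z z' : (forall N, th N z = th N z') -> z = z'.
  by move=> h; apply: (open_normal_sep pP.1) => N oN; apply/(thE (exist _ N oN)).
exists g; split; last first.
  move=> y; apply: uniq => N; rewrite hg crd_sec; by have [_ _ h] := hjt N; rewrite h.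
split; first by move=> x y; apply: uniq => N; rewrite thM !hg crdM.
move=> x O /(nbhs_open_normal _ _ pP.1) [N oN NO].
exists [:: jj (exist _ N oN)] => y [e _]; apply: NO; apply/(thE (exist _ N oN)).
by rewrite !hg.
Qed.

Section Action.
Variables (H : finGroupType) (act : H -> Y -> Y).
Hypothesis act_1 : forall y, act 1 y = y.
Hypothesis act_M : forall h k y, act (h * k) y = act h (act k y).
Hypothesis act_0 : forall h, act h y0 = y0.
Hypothesis act_lc : forall h m (f : Y -> 'S_m), lc f -> lc (fun y => f (act h y)).

Lemma good_act h m (f : Y -> 'S_m) : good_coord p y0 lc f -> good_coord p y0 lc (fun y => f (act h y)).
Proof.
move=> [lf f1 [A pA fA]]; split; first exact: act_lc.
  by rewrite act_0.
by exists A.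
Qed.

Lemma good_part_act h m (f : Y -> 'S_m) y :
  good_part p y0 lc (fun y => f (act h y)) y = good_part p y0 lc f (act h y).
Proof.
have [g|n] := pselect (good_coord p y0 lc f).
  by rewrite (good_partE g) good_partE //; apply: good_act.
rewrite (good_partN n) good_partN // => /(good_act h^-1) g; apply: n.
suff -> : f = fun y => f (act h (act h^-1 y)) by [].
by apply/funext => z; rewrite -act_M mulgV act_1.
Qed.

Definition ind_act h (j : index) : index := existT _ (projT1 j) (fun y => projT2 j (act h y)).

Lemma freep_act_subproof h (x : E) : approximable p y0 lc (fun j => crd x (ind_act h j)).
Proof.
move=> J; have [w hw] := svalP x (map (ind_act h) J).
exists [seq (act h u.1, u.2) | u <- w]; elim: J hw => //= j J IH [e /IH hJ]; split => //.
rewrite [LHS]e /evc /=; elim: (w) => [|[y s] v IHv] //=; rewrite IHv.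
by rewrite good_part_act.
Qed.

Definition freep_act h x : E := exist _ _ (freep_act_subproof h x).

Lemma freep_act_sec h y : freep_act h (sec y) = sec (act h y).
Proof. by apply: crd_inj => j; rewrite [LHS]crd_sec crd_sec good_part_act. Qed.

Lemma freep_action : continuous_action freep_act.
Proof.
split.
- move=> x; apply: crd_inj => -[m f]; rewrite /crd /= /crd /ind_act /=.
  by have -> : (fun y => f (act 1 y)) = f by apply/funext => y; rewrite act_1.
- move=> h k x; apply: crd_inj => -[m f]; rewrite /crd /= /crd /ind_act /=.
  by have -> : (fun y => f (act (h * k) y)) = (fun y => f (act h (act k y))) by apply/funext => y; rewrite act_M.
- by move=> h x y; apply: crd_inj.
- move=> [h x] O [J hJ]; exists ([set (h : discrete_topology H)], near_at x ^~ (map (ind_act h) J)).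
    by split; [apply: discrete_set1 | apply: near_near].
  move=> [_ y] [/= -> e]; apply: hJ; elim: J e => //= j J IH [e1 e2]; split => //.
  exact: IH.
Qed.

End Action.
End Universal.

(** * The embedding *)

Section SubspaceProfinite.
Variables (T : topologicalType) (B : set T).

Lemma nbhs_set_type (x : set_type B) (O : set (set_type B)) :
  nbhs x O <-> exists2 V, nbhs (set_val x) V & set_val @^-1` V `<=` O.
Proof.
split=> [|[V nV VO]]; last first.
  by apply: filterS VO _; apply: (@initial_continuous _ _ set_val x).
rewrite nbhsE => -[_ [[V oV <-] Vx] VO]; exists V; last exact: VO.
by exists V.
Qed.

Lemma profinite_set_type : profinite_space T -> closed B -> profinite_space (set_type B).
Proof.
move=> pT clB; have [cT hT _] := pT; have zT := profinite_zero_dimensional pT.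
have zB : zero_dimensional (set_type B).
  move=> x y xy; have [|U [cU Ux nUy]] := zT (set_val x) (set_val y).
    by apply: contraNN xy => /eqP /val_inj ->.
  exists (set_val @^-1` U); split => //; apply: preimage_clopen => //.
  exact: initial_continuous.
split; last exact: zero_dimension_totally_disconnected.
- rewrite compact_ultra => Ul UUl _.
  have PU : ProperFilter Ul by apply: ultra_proper.
  have FU : Filter Ul by apply: filter_filter.
  have [y hy] := ultra_compact (@set_val T B) UUl cT.
  have By : B y.
    apply: clB => O nO; have [z Oz] := @filter_ex _ Ul PU (set_val @^-1` O) (hy O nO).
    by exists (set_val z); split => //; apply: set_valP.
  exists (exist _ y (mem_set By)); split => // O /nbhs_set_type [V nV VO].
  exact: filterS VO (hy V nV).
- move=> x y cl; apply: contrapT => /eqP xy; have [U [[oU cU] Ux nUy]] := zB x y xy.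
  have [z [Uz]] := cl U (~` U) (open_nbhs_nbhs (conj oU Ux))
    (open_nbhs_nbhs (conj (closed_openC cU) nUy)).
  by apply.
Qed.

End SubspaceProfinite.

(** * The free group on functions from H to F and its permuted basis *)

Section Permuted.
Variables (p : nat) (F : topologicalGroupType) (H : finGroupType) (a : H -> F -> F).
Hypotheses (pp : prime p) (pF : pro_p_group p F) (ac : continuous_action a).
Local Notation Om := (H -> F).
Local Notation w1 := ((fun=> 1) : Om).
Local Notation lev := (inv_level a).
Local Notation hact := (hact a).
Let La : leveled_action a lev := leveled_inv_level pF.1 ac.

(** Local constancy on [Om] for the product topology, stated through levels; by [unif_local]
    uniformity costs nothing. *)
Definition unif m (f : Om -> 'S_m) : Prop :=
  exists2 U, lev U & forall w w', eqw U w w' -> f w = f w'.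

Lemma unif_local m (f : Om -> 'S_m) :
  (forall w, exists2 U, lev U & forall w', eqw U w w' -> f w = f w') -> unif f.
Proof.
move=> loc; apply: contrapT => no.
have ch U : exists v : Om * Om, lev U -> eqw U v.1 v.2 /\ f v.1 <> f v.2.
  have [lU|] := pselect (lev U); last by exists (w1, w1).
  apply: contrapT => hn; apply: no; exists U => // w w' e; apply: contrapT => h.
  by apply: hn; exists (w, w').
have [v hv] := choice ch.
have [//|t szt ht] := cluster_lev La (m := 1) (s := fun U => [:: (v U).1]).
case: t szt ht => [|w [|]] //= _ ht.
have [U lU hU] := loc w; have [V [lV VU /eqw_eqs ew]] := ht U lU.
have [ev []] := hv V lV; rewrite -(hU _ ew); apply: hU => k.
by apply: (eqm_trans La lU (ew k)); apply: eqm_sub (ev k).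
Qed.

Local Notation E := (freep p w1 unif).
Local Notation sec := (@sec p Om w1 unif).

Lemma hact_w1 h : hact h w1 = w1.
Proof. by apply/funext => k; rewrite hactE (lact1r La). Qed.

Lemma unif_hact h m (f : Om -> 'S_m) : unif f -> unif (fun w => f (hact h w)).
Proof.
move=> [U lU hU]; exists U => // w w' e; apply: hU => k.
exact: (eqm_act La lU).
Qed.

Local Notation b := (freep_act (p := p) (hact1 La) (hactM La) hact_w1 unif_hact).

Lemma pE : pro_p_group p E. Proof. exact: freep_pro_p. Qed.
Lemma bc : continuous_action b. Proof. exact: freep_action. Qed.
Let Lb : leveled_action b (inv_level b) := leveled_inv_level pE.1 bc.

Lemma coordinate_hom k : exists g : E -> F, continuous_hom g /\ forall w, g (sec w) = w k.
Proof.
apply: (hom_extend pp pF) => // N m th oN thM thN.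
have [|U lU UN] := @inv_level_base _ _ _ pF.1 ac N.
  by case: oN => oN N1 _ _; apply: open_nbhs_nbhs.
exists U => // w w' e.
by rewrite -(mulKVg (w k) (w' k)) thM (thN ((w k)^-1 * w' k)) ?mulg1 //; apply: UN; apply: e.
Qed.

Definition rho (x : E) : Om := fun k => sval (cid (coordinate_hom k)) x.

Lemma rho_hom k : continuous_hom (fun x => rho x k).
Proof. by rewrite /rho; case: cid => g []. Qed.

Lemma rho_sec w : rho (sec w) = w.
Proof. by apply/funext => k; rewrite /rho; case: cid => g []. Qed.

Lemma rhoM x y k : rho (x * y) k = rho x k * rho y k.
Proof. exact: (rho_hom k).1. Qed.

Lemma sec_hact h w : sec (hact h w) = b h (sec w).
Proof. by rewrite freep_act_sec. Qed.

(** In each coordinate both sides are continuous homomorphisms of [x] that agree on the basis. *)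
Lemma rho_act h x : rho (b h x) = hact h (rho x).
Proof.
apply/funext => k.
suff e : (fun y => rho (b h y) k) = (fun y => a h (rho y (h^-1 * k))).
  exact: (congr1 (fun f => f x) e).
apply: (hom_unique pF.1).
- split; first by move=> y z; rewrite (lactD Lb) rhoM.
  by move=> y; apply: (@continuous_comp _ _ _ (b h) (fun z => rho z k));
    [apply: action_continuous bc h y | apply: (rho_hom k).2].
- split; first by move=> y z; rewrite rhoM (lactD La).
  by move=> y; apply: (@continuous_comp _ _ _ (fun z => rho z (h^-1 * k)) (a h));
    [apply: (rho_hom _).2 | apply: action_continuous ac h _].
- by move=> w; rewrite -sec_hact !rho_sec.
Qed.

Lemma rho_cont U : lev U -> exists2 M, inv_level b M &
  forall x y, eqm M x y -> forall k, eqm U (rho x k) (rho y k).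
Proof.
move=> lU; have rho1 k : rho 1 k = 1 by apply: (mulgI (rho 1 k)); rewrite -rhoM !mulg1.
have n1 : nbhs (1 : E) (fun x => forall k, U (rho x k)).
  apply: (@filter_forall E H (fun k x => U (rho x k)) (nbhs (1 : E)) _) => k.
  apply: ((rho_hom k).2 1 U); rewrite rho1.
  by case: lU => -[oU U1 _ _] _; apply: open_nbhs_nbhs.
have [M lM MU] := inv_level_base pE.1 bc n1; exists M => // x y /MU h k.
have := h k; rewrite rhoM.
have -> // : rho x^-1 k = (rho x k)^-1.
by apply: (mulgI (rho x k)); rewrite -rhoM !mulgV rho1.
Qed.

Lemma sec_near w (J : seq (index Om)) :
  exists2 U, lev U & forall w', eqw U w w' -> near_at (sec w) (sec w') J.
Proof.
elim: J => [|j J [U lU hU]]; first by have [U lU] := lev_has La; exists U.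
have [V lV hV] : exists2 V, lev V & forall w', eqw V w w' -> crd (sec w) j = crd (sec w') j.
  have [g|n] := pselect (good_coord p w1 unif (projT2 j)); last first.
    by exists U => // w' _; rewrite !crd_sec (good_partN n).
  have [[V lV hV] _ _] := g; exists V => // w' e.
  by rewrite !crd_sec (good_partE g); apply: hV.
have [W lW sW] := lev_cap La lU lV; exists W => // w' e; split.
  by apply: hV => k; have [] := sW _ (e k).
by apply: hU => k; have [] := sW _ (e k).
Qed.

(** A point of the closure is approximated by some [sec w] on each finite list of coordinates; a
    cluster point of these [w] is a preimage, since [sec] is continuous by [sec_near]. *)
Lemma closed_range_sec : closed (range sec).
Proof.
move=> x cx.
have ch J : exists w, near_at x (sec w) J.
  by have [_ [[w _ <-] h]] := cx _ (near_near x J); exists w.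
have [v hv] := choice ch.
pose le J J' := forall e e' : coords Om, agree e e' J' -> agree e e' J.
have [|||w hw] := lev_compact La (D := seq (index Om)) (le := le) v.
- by constructor; exact: [::].
- by move=> J J'; exists (J ++ J') => e e' /agree_cat [].
- by move=> J J' J'' h1 h2 e e' /h2 /h1.
exists w => //; apply: crd_inj => j; rewrite crd_sec.
have [U lU hU] := sec_near w [:: j]; have [J jJ e] := hw U [:: j] lU.
have [e1 _] := hU (v J) e; have [e2 _] := jJ _ _ (hv J).
by rewrite -crd_sec /crd e1 e2.
Qed.

Lemma range_sec1 : (1 : E) \in range sec.
Proof. by apply: mem_set; exists w1 => //; apply: sec1. Qed.

(** A continuous map on the subspace, composed with [sec] and a finite quotient of [P], is locally
    constant on [Om] by [sec_near], so [hom_extend] applies. *)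
Lemma range_sec_basis : pointed_basis p (range sec).
Proof.
exists range_sec1; split.
- by apply: profinite_set_type; [case: pE | apply: closed_range_sec].
- exact: pE.
- exact: initial_continuous.
- by [].
move=> P f pP fc f1.
have ms w : sec w \in range sec by apply: mem_set; exists w.
pose sB w : set_type (range sec) := exist _ (sec w) (ms w).
have [||g [gh gf]] := @hom_extend p Om w1 unif pp P (fun w => f (sB w)) pP.
- by rewrite -[RHS]f1; congr f; apply: val_inj; apply: sec1.
- move=> N m th oN thM thN; apply: unif_local => w.
  have n1 : nbhs (f (sB w)) (eqm N (f (sB w))) by apply/(nbhs_open_normal _ _ pP.1); exists N.
  have /nbhs_set_type [V [J hJ] VO] := fc (sB w) _ n1.
  have [U lU hU] := sec_near w J; exists U => // w' /hU /hJ Vw'.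
  have e : eqm N (f (sB w)) (f (sB w')) by apply: (VO (sB w')).
  by rewrite -(mulKVg (f (sB w)) (f (sB w'))) thM (thN _ e) mulg1.
exists g; split.
  split => // x; have [w _ ew] := set_valP x.
  by rewrite -[set_val x]ew gf; congr f; apply: val_inj.
move=> g' [gh' gf']; apply: (hom_unique pP.1) => // w.
by rewrite gf -(gf' (sB w)).
Qed.

End Permuted.

Section Embedding.
Variables (p : nat) (F : topologicalGroupType) (H : finGroupType) (a : H -> F -> F).
Hypotheses (pp : prime p) (fF : free_pro_p_group p F) (pH : p.-group [set: H]%SET).
Hypothesis ac : continuous_action a.

Lemma equivariant_embedding :
  exists (E : topologicalGroupType) (iota : F -> E) (b : H -> E -> E) (B : set E),
    [/\ closed_subgroup_embedding iota, continuous_action b,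
        forall h x, b h (iota x) = iota (a h x), pointed_basis p B
      & forall h, b h @` B = B].
Proof.
have [X [x0 [om free]]] := fF; have pF : pro_p_group p F by case: free.
pose La := leveled_inv_level pF.1 ac; have TB := free_tree_family pp free ac.
pose E := freep p ((fun=> 1) : H -> F) (@unif F H a).
pose sec : (H -> F) -> E := @sec p (H -> F) (fun=> 1) (@unif F H a).
pose b := freep_act (p := p) (hact1 La) (hactM La) (hact_w1 pF ac) (unif_hact pF ac).
have pE' : pro_p_group p E := pE p a.
have bc' : continuous_action b by apply: freep_action.
have Lb := leveled_inv_level pE'.1 bc'.
pose rho' : E -> H -> F := rho pp pF ac.
have [g [rg g1 gl gh gc]] := equivariant_lifting La TB Lb (pro_p_characters pp pH pE' bc') pp pH
  (rho := rho') (sec := sec) (rhoM pp pF ac) (rho_act pp pF ac) (rho_cont pp pF ac)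
  (rho_sec pp pF ac) (sec_hact pF ac).
(* On constant functions the identity of [g] for [lmul] becomes multiplicativity. *)
pose iota f : E := g (fun=> f).
have iotaM : {morph iota : x y / x * y} by move=> x y; rewrite /iota -gl.
have rho_iota f k : rho' (iota f) k = f by rewrite rg.
have ic : continuous iota.
  move=> x O /(nbhs_level pE'.1 bc') [M lM MO].
  have [U lU hU] := gc M lM; apply/(nbhs_level pF.1 ac); exists U => // y e.
  by apply: MO; apply: hU.
exists E, iota, b, (range sec); split => //.
- split => //.
  + by move=> x y e; rewrite -(rho_iota x 1) e rho_iota.
  + apply: compact_closed; first by case: pE'.1.
    apply: continuous_compact; first exact: continuous_subspaceT.
    by case: pF.1.
  + move=> U; split=> [oU|[V oV <-]]; last by apply: open_comp => // x _; apply: ic.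
    (* Every coordinate of [rho'] is a continuous left inverse of [iota]; the coordinate 1 is
       taken. *)
    exists ((fun x => rho' x 1) @^-1` U).
      by apply: open_comp => // x _; apply: (rho_hom pp pF ac 1).2.
    by apply/funext => f; rewrite /preimage /= rho_iota.
- by move=> h x; rewrite /iota -gh.
- exact: range_sec_basis.
- move=> h; apply/seteqP; split=> x.
    by move=> [_ [w _ <-] <-]; exists (hact a h w) => //; apply: (sec_hact pF ac h w).
  move=> [w _ <-]; exists (sec (hact a h^-1 w)); first by exists (hact a h^-1 w).
  apply: (eq_trans (esym (sec_hact pF ac h _))).
  by rewrite -(hactM La) mulgV (hact1 La).
Qed.

End Embedding.

Local Close Scope group_scope.
Local Close Scope card_scope.
Local Close Scope classical_set_scope.

Theorem theorem1p3 (p : nat) (F : topologicalGroupType) (H : finGroupType)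
    (a : H -> F -> F) :
  prime p ->
  free_pro_p_group p F ->
  (p.-group [set: H])%g ->
  continuous_action a ->
  exists (F' : topologicalGroupType) (iota : F -> F') (a' : H -> F' -> F')
         (B : set F'),
    [/\ closed_subgroup_embedding iota,
        continuous_action a',
        (forall (h : H) (x : F), a' h (iota x) = iota (a h x)),
        pointed_basis p B
      & (forall h : H, (a' h @` B)%classic = B)].
Proof. exact: equivariant_embedding. Qed.
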